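(* Let $(E,\rho)$ be a Polish space with Borel $\sigma$-algebra $\mathcal{B}(E)$, and let $(P_t)_{t\ge 0}$ be the semigroup of a time-homogeneous Markov process on $E$. Suppose that there are a positive measurable function $H$ on $E\times E$ and constants $\varepsilon\ge0$, $\kappa\ge1$ such that $$P_t\log f(x)\le\log P_tf(y)+H(x,y)(\varepsilon+t^{-\kappa})$$ for all $x,y\in E$, $t>0$ and all bounded measurable $f:E\to\mathbb{R}$ with $f\ge1$. Let $(P_t)$ have an invariant probability measure $\mu$. Then for any $\alpha\in(0,1]$: (1) The entropy-cost inequality $$\mu\left(((P_t^\alpha)^*f)\log (P_t^\alpha)^*f\right)\le W_H(f\mu,\mu)\left(\varepsilon+\frac{\Gamma\left(\frac{\kappa}{\alpha}\right)}{\alpha\, t^{\frac{\kappa}{\alpha}}\,\Gamma(\kappa)}\right)$$ holds for all $t>0$ and all measurable $f\ge0$ with $\mu(f)=1$, where $(P_t^\alpha)^*$ is the adjoint of $P_t^\alpha$ in $L^2(E;\mu)$. (2) If for every $x\in E$ one has $H(x,y)\to0$ as $y\to x$, then for every $t>0$ the operator $P_t^\alpha$ is strong Feller and thus has a transition density $p_t(x,y)$ with respect to $\mu$ on $\operatorname{supp}\mu$, which satisfies the entropy inequality $$\int_E p_t(x,z)\log\frac{p_t(x,z)}{p_t(y,z)}\,\mu(dz)\le H(x,y)\left(\varepsilon+\frac{\Gamma\left(\frac{\kappa}{\alpha}\right)}{\alpha\, t^{\frac{\kappa}{\alpha}}\,\Gamma(\kappa)}\right),\qquad t>0,\ x,y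\in\operatorname{supp}\mu.$$
   Context: $\Gamma$ is the Gamma function, $\mu(g):=\int_E g\,d\mu$, and $f\mu$ is the measure with density $f$ with respect to $\mu$. For $\alpha\in(0,1]$, $\{\mu_t^\alpha\}_{t\ge0}$ denotes the convolution semigroup of probability measures on $[0,\infty)$ (that is, $\mu^\alpha_{t+s}=\mu^\alpha_t*\mu^\alpha_s$ and $\mu_t^\alpha\to\mu_0^\alpha=\delta_0$ weakly as $t\to0$) determined by the Laplace transform $$\int_0^\infty e^{-xs}\mu_t^\alpha(ds)=e^{-tx^\alpha},\qquad x\ge0,\ t\ge0.$$ The subordinated semigroup is $P_t^\alpha f(x):=\int_0^\infty P_sf(x)\,\mu_t^\alpha(ds)$, $t\ge0$ (it is assumed that $s\mapsto P_sf(x)$ is measurable, so that the integral makes sense). The adjoint $(P_t^\alpha)^*$ is understood as extended to $L^1(E;\mu)$ when $f\notin L^2(E;\mu)$. $W_H$ is the transportation cost (Wasserstein distance) induced by $H$: for probability measures $\mu_1,\mu_2$ on $E$, $$W_H(\mu_1,\mu_2)=\inf_{\pi\in\mathcal{C}(\mu_1,\mu_2)}\int_{E\times E}H(x,y)\,\pi(dx,dy),$$ where $\mathcal{C}(\mu_1,\mu_2)$ is the set of all couplings of $\mu_1$ and $\mu_2$. Strong Feller means that $P_t^\alpha$ maps bounded measurable functions to bounded continuous functions. A transition density with respect to $\mu$ on $\operatorname{supp}\mu$ is a function $p_t(x,z)$ with $P_t^\alpha f(x)=\int_E p_t(x,z)f(z)\,\mu(dz)$ for $x\in\operatorname{supp}\mu$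 and bounded measurable $f$. *)

(* Defs.v *)
From HB Require Import structures.
From mathcomp Require Import all_boot all_order all_algebra.
From mathcomp Require Import all_classical all_reals all_analysis.
From mathcomp Require Import measurable_realfun.

Set Implicit Arguments.
Unset Strict Implicit.
Unset Printing Implicit Defensive.
Import Order.TTheory GRing.Theory Num.Theory.
Import numFieldNormedType.Exports.

Local Open Scope classical_set_scope.
Local Open Scope ring_scope.
Local Open Scope ereal_scope.

(** A complete separable metric space whose measurable sets are the Borel
    sets. Measurable types are pointed in MathComp-Analysis, so the space is
    nonempty, as is any space that carries a probability measure. *)
HB.mixin Record isPolish (R : realType) (d : measure_display) E
    of Metric R E & Complete E & Measurable d E := {
  polish_separable : exists2 D : set E, countable D & dense D ;
  polish_borel : (measurable : set (set E)) = <<s open >>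
}.

#[short(type="polishType")]
HB.structure Definition Polish (R : realType) (d : measure_display) :=
  { E of Metric R E & Complete E & Measurable d E & isPolish R d E }.

Section markov_semigroups.
Context (R : realType) (d : measure_display) (E : polishType R d).
Implicit Types (P : R -> R.-pker E ~> E) (mu : probability E R).

Definition bounded_measurable (f : E -> R) :=
  measurable_fun [set: E] f /\ bounded_fun f.

Definition semigroup_op P (t : R) (f : E -> \bar R) (x : E) : \bar R :=
  \int[P t x]_y f y.

(** Transition semigroup of a time-homogeneous Markov process, indexed by the
    times [t >= 0]; the values of [P] at negative times are irrelevant. *)
Definition markov_semigroup P :=
  (forall x A, measurable A -> P 0%R x A = \d_x A) /\
  (forall s t : R, (0 <= s)%R -> (0 <= t)%R -> forall x A, measurable A ->
     P (s + t)%R x A = \int[P s x]_y P t y A).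

Definition measurable_in_time P :=
  forall f, bounded_measurable f -> forall x,
    measurable_fun (`[0%R, +oo[ : set (measurableTypeR R))
      (fun s => semigroup_op P s (EFin \o f) x).

Definition log_Harnack P (H : E * E -> R) (eps kappa : R) :=
  forall (x y : E) (t : R), (0 < t)%R ->
  forall f, bounded_measurable f -> (forall z, (1 <= f z)%R) ->
    semigroup_op P t (fun z => (ln (f z))%:E) x <=
    lne (semigroup_op P t (EFin \o f) y) +
    (H (x, y) * (eps + t `^ (- kappa)))%:E.

Definition invariant_measure P mu :=
  forall t : R, (0 <= t)%R -> forall A, measurable A ->
    \int[mu]_x P t x A = mu A.

Definition subordinated P (nu : R -> probability (measurableTypeR R) R)
    (t : R) (f : E -> \bar R) (x : E) : \bar R :=
  \int[nu t]_(s in `[0%R, +oo[) semigroup_op P s f x.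

Definition strong_Feller (T : (E -> \bar R) -> E -> \bar R) :=
  forall f, bounded_measurable f ->
    exists g : E -> R, [/\ continuous g, bounded_fun g &
      forall x, T (EFin \o f) x = (g x)%:E].

Definition supp mu : set E :=
  [set x | forall U, open U -> U x -> 0 < mu U].

(** Applied to the indicator functions of measurable sets, the last condition
    forces [p x] to be nonnegative [mu]-almost everywhere. *)
Definition transition_density mu (T : (E -> \bar R) -> E -> \bar R)
    (p : E -> E -> R) :=
  forall x, supp mu x ->
    measurable_fun [set: E] (p x) /\
    forall f, bounded_measurable f ->
      T (EFin \o f) x = \int[mu]_z (p x z * f z)%:E.

(** [g] is (a version of) the image of [f] under the adjoint of [T] in
    [L^2(mu)]. *)
Definition adjoint_L2 mu (T : (E -> \bar R) -> E -> \bar R) (f g : E -> R) :=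
  [/\ f \in Lfun mu 2%:E, g \in Lfun mu 2%:E &
    forall h, h \in Lfun mu 2%:E ->
      \int[mu]_x (g x * h x)%:E = \int[mu]_x ((f x)%:E * T (EFin \o h) x)].

(** The same for the extension of the [L^2] adjoint to [L^1(mu)] by
    [L^1]-continuity. *)
Definition adjoint_L1 mu (T : (E -> \bar R) -> E -> \bar R) (f g : E -> R) :=
  [/\ f \in Lfun mu 1, g \in Lfun mu 1 &
    exists f_ g_ : nat -> E -> R,
    [/\ forall n, adjoint_L2 mu T (f_ n) (g_ n),
        \int[mu]_x `|f_ n x - f x|%:E @[n --> \oo] --> 0 &
        \int[mu]_x `|g_ n x - g x|%:E @[n --> \oo] --> 0]].

End markov_semigroups.

Section stable_subordinators.
Context (R : realType).
Implicit Types (nu : R -> probability (measurableTypeR R) R).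

Definition Gamma (a : R) : R :=
  (\int[lebesgue_measure]_(s in `]0, +oo[) (s `^ (a - 1) * expR (- s)))%R.

(** A convolution semigroup of probability measures on [0, +oo[, viewed as
    measures on the line that do not charge ]-oo, 0[. *)
Definition convolution_semigroup nu :=
  [/\ forall t : R, (0 <= t)%R -> nu t [set s | (s < 0)%R] = 0,
      forall s t : R, (0 <= s)%R -> (0 <= t)%R -> forall A, measurable A ->
        nu (s + t)%R A = (nu s \x nu t) [set xy | A (xy.1 + xy.2)%R],
      forall A, measurable A -> nu 0%R A = \d_(0%R : R) A &
      forall phi : R -> R, continuous phi -> bounded_fun phi ->
        \int[nu t]_s (phi s)%:E @[t --> 0^'+] --> (phi 0%R)%:E].

Definition stable_subordinator (alpha : R) nu :=
  convolution_semigroup nu /\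
  forall t x : R, (0 <= t)%R -> (0 <= x)%R ->
    \int[nu t]_(s in `[0%R, +oo[) (expR (- (x * s)))%:E =
    (expR (- (t * x `^ alpha)))%:E.

Definition rate (eps kappa alpha t : R) : R :=
  (eps + Gamma (kappa / alpha) / (alpha * t `^ (kappa / alpha) * Gamma kappa))%R.

End stable_subordinators.

Section transportation_cost.
Context (R : realType) (d : measure_display) (E : measurableType d).

Definition with_density (f : E -> R) (mu : {measure set E -> \bar R})
  : set E -> \bar R := fun A => \int[mu]_(x in A) (f x)%:E.

Definition coupling (mu1 mu2 : set E -> \bar R) : set (probability (E * E)%type R) :=
  [set pi | forall A, measurable A ->
    pi (A `*` setT) = mu1 A /\ pi (setT `*` A) = mu2 A].

(** [W_H], with the value [+oo] when no coupling has finite cost. *)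
Definition Wasserstein (H : E * E -> R) (mu1 mu2 : set E -> \bar R) : \bar R :=
  ereal_inf [set \int[pi]_xy (H xy)%:E | pi in coupling mu1 mu2].

End transportation_cost.

(* Main.v *)
(** Integrating the log-Harnack inequality over time against the stable law
    [nu t], with Jensen's inequality for the logarithm on the right-hand side,
    gives the same inequality for the subordinated semigroup, the factor
    [eps + s^-kappa] becoming [rate] because
    [int s^-kappa nu_t(ds)] is an explicit quotient of Gamma values; the latter
    follows from [Gamma(kappa) s^-kappa = int_0^oo x^(kappa-1) e^(-xs) dx] and
    the Laplace transform of [nu t].

    The exchange of integrals requires [(x, s) |-> P_s(x, A)] to be jointly
    measurable, while only measurability in [s] is assumed. The log-Harnack
    inequality makes every [P_r(x, .)] absolutely continuous with respect to
    [mu], so these measures form a separable set for the total variation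
    distance, and [P_(r+s)(x, A)] is 1-Lipschitz in [P_r(x, .)]; this yields
    joint measurability on [s > 0].

    For the subordinated semigroup, testing the inequality with [1 + e f] bounds
    the oscillation [P f(x) - P f(y)] by [e + H(x, y) rate / e], whence the strong
    Feller property. Testing it with [min(p_x / p_y, n) + delta] gives the entropy
    inequality for densities; testing it with [min(g, n) + delta], where [g] is
    the adjoint of [f], and integrating over a coupling of [f mu] and [mu] gives
    the entropy-cost inequality. *)
Require Import Defs.
From HB Require Import structures.
From mathcomp Require Import all_boot all_order all_algebra.
From mathcomp Require Import all_classical all_reals all_analysis.
From mathcomp Require Import measurable_realfun ring lra.

Set Implicit Arguments.
Unset Strict Implicit.
Unset Printing Implicit Defensive.
Import Order.TTheory GRing.Theory Num.Theory.
Import numFieldNormedType.Exports.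

Local Open Scope classical_set_scope.
Local Open Scope ring_scope.
Local Open Scope ereal_scope.

(** Once a jointly measurable kernel [K] is available, subordination at time [t] is integration
    against a single Markov kernel, [mixture K (nu t)]; from there on the arguments concern one
    kernel with an invariant measure and a log-Harnack inequality. Time [0] has to be kept out: the
    kernel there is a point mass, in general not absolutely continuous, and [s^-kappa] is singular.
    The Laplace transform at infinity shows that [nu t] has no atom there.

    Jensen's inequality is applied as the tangent bound [ln b <= ln B + b / B - 1], with [B] the
    mean of [b] or a bound for it: this is linear in [b] and integrates directly.

    Densities and adjoints are arbitrary versions, nonnegative only almost everywhere, while [ln] is
    a total function equal to [0] outside the positive reals. This is why they are replaced by
    nonnegative versions before any entropy is estimated, and why the truncated ratios carry the
    shift [delta], which keeps the test functions away from [0]. *)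

(** * Countable generation of the Borel sigma-algebra *)

Section borel_generator.
Context (R : realType) (d : measure_display) (E : polishType R d).

Lemma open_ball_metric (x : E) (e : R) : open (ball x e).
Proof.
rewrite openE => y; rewrite ballEmdist/= => xy.
apply/nbhs_ballP; exists (e - mdist x y)%R => /=; first by rewrite subr_gt0.
move=> z; rewrite ballEmdist/= ltrBrDl => yz.
by rewrite (le_lt_trans (metric_triangle x y z)).
Qed.

Lemma polish_open_measurable (U : set E) : open U -> measurable U.
Proof. by move=> oU; rewrite polish_borel; exact: sub_sigma_algebra. Qed.

(** Balls of radius [1/(k+1)] around a countable dense set form a countable base of the topology, so
    an open set is the union of the members of the base that it contains. *)
Lemma polish_countably_generated : exists B : nat -> set E,
  (forall n, measurable (B n)) /\
  (measurable : set (set E)) `<=` <<s range B >>.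
Proof.
have [D cD dD] := @polish_separable R d E.
have /pcard_injP [f injf] : (D #<= [set: nat])%card by exact: cD.
(* [f] codes the points of [D] injectively but need not reach every integer: the union runs over the
   at most one point of code [nk.1] and is empty if there is none, which saves choosing a centre. *)
pose C (nk : nat * nat) : set E :=
  \bigcup_(x in [set x | D x /\ f x = nk.1]) ball x (nk.2.+1%:R^-1 : R).
have mC nk : open (C nk).
  by apply: bigcup_open => x _; exact: open_ball_metric.
pose B n := C (odflt (0, 0)%N (unpickle n)).
exists B; split; first by move=> n; exact/polish_open_measurable/mC.
rewrite polish_borel; apply: smallest_sub; first exact: smallest_sigma_algebra.
move=> U oU.
have -> : U = \bigcup_(n in [set n | B n `<=` U]) B n.
  apply/seteqP; split => [x Ux|x [n /= BU Bx]]; last exact: BU.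
  have /nbhs_ballP[e /= e0 xeU] : nbhs x U by exact: open_nbhs_nbhs.
  have e20 : (0 < e / 2)%R by rewrite divr_gt0.
  have [k ke] : exists k, (k.+1%:R^-1 < e / 2 :> R)%R.
    by have /ltr_add_invr[k] := e20; rewrite add0r; exists k.
  have k0 : (0 < k.+1%:R^-1 :> R)%R by rewrite invr_gt0.
  have [||y [xy Dy]] := dD (ball x (k.+1%:R^-1 : R)).
  - by exists x; exact: ballxx.
  - exact: open_ball_metric.
  have By z : B (pickle (f y, k)) z -> ball y (k.+1%:R^-1 : R) z.
    rewrite /B pickleK/= => -[y' [Dy' /= fy']].
    by rewrite (injf y' y)// inE.
  exists (pickle (f y, k)) => /=.
    move=> z /By yz; apply: xeU.
    rewrite [e]splitr; apply: (@ball_triangle _ _ y).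
      by apply: le_ball xy; exact/ltW.
    by apply: le_ball yz; exact/ltW.
  rewrite /B pickleK; exists y => //.
  exact: ball_sym.
rewrite bigcup_mkcond; apply: sigma_algebra_bigcup => n.
case: ifPn => _; last exact: sigma_algebra0.
by apply: sub_sigma_algebra; exists n.
Qed.

End borel_generator.

(** * Separability of [L^1] *)

Section L1_separability.
Context (R : realType) (d : measure_display) (E : measurableType d).
Variables (B : nat -> set E).
Hypotheses (mB : forall n, measurable (B n))
  (Bgen : (measurable : set (set E)) `<=` <<s range B >>).

(** Concatenation of lists gives intersections and the empty list gives the whole space, so these
    sets form a pi-system. *)
Definition pi_set (w : seq nat) : set E := \big[setI/setT]_(i <- w) B i.

(** Rational coefficients and lists of integers keep the index in a countable type, so that [pickle]
    enumerates the approximants by integers. *)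
Definition approximant (v : seq (rat * seq nat)) (x : E) : R :=
  (\sum_(p <- v) ratr p.1 * \1_(pi_set p.2) x)%R.

Lemma measurable_pi_set w : measurable (pi_set w).
Proof. by rewrite /pi_set; elim/big_ind : _ => //; exact: measurableI. Qed.

Lemma measurable_approximant v : measurable_fun [set: E] (approximant v).
Proof.
apply: measurable_sum => p; apply: measurable_funM => //.
by apply: measurable_indic; exact: measurable_pi_set.
Qed.

Variable la : {finite_measure set E -> \bar R}.

Definition approximable (f : E -> R) := forall e : R, (0 < e)%R ->
  exists v, \int[la]_x `|f x - approximant v x|%:E < e%:E.

Let N (f : E -> R) := \int[la]_x `|f x|%:E.

Let mabs (f : E -> R) : measurable_fun [set: E] f ->
  measurable_fun [set: E] (fun x => `|f x|%:E).
Proof. by move=> mf; apply/measurable_EFinP; exact: measurableT_comp. Qed.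

Let ND (f g : E -> R) : measurable_fun [set: E] f -> measurable_fun [set: E] g ->
  N (f \+ g)%R <= N f + N g.
Proof.
move=> mf mg; rewrite /N -ge0_integralD//; [|exact: mabs|exact: mabs].
apply: ge0_le_integral => //.
- by apply: mabs; exact: measurable_funD.
- by apply: emeasurable_funD; exact: mabs.
- by move=> x _; rewrite lee_fin ler_normD.
Qed.

Let NZ (c : R) f : measurable_fun [set: E] f -> N (fun x => c * f x)%R = `|c|%:E * N f.
Proof.
move=> mf; rewrite /N -ge0_integralZl//; last exact: mabs.
by apply: eq_integral => x _; rewrite normrM EFinM.
Qed.

Lemma approximable_lim (f : E -> R) : measurable_fun [set: E] f ->
  (forall e : R, (0 < e)%R -> exists g : E -> R, [/\ measurable_fun [set: E] g,
     approximable g & \int[la]_x `|f x - g x|%:E < e%:E]) -> approximable f.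
Proof.
move=> mf h e e0; have e20 : (0 < e / 2)%R by rewrite divr_gt0.
have [g [mg ag fg]] := h _ e20; have [v gv] := ag _ e20; exists v.
have mv := measurable_approximant v.
rewrite (splitr e) EFinD; apply: le_lt_trans (lteD fg gv).
apply: le_trans (@ND (fun x => f x - g x)%R
  (fun x => g x - approximant v x)%R _ _).
- rewrite /N le_eqVlt; apply/orP; left; apply/eqP; apply: eq_integral => x _ /=.
  by rewrite addrA subrK.
- exact: measurable_funB.
- exact: measurable_funB.
Qed.

Lemma approximableD (f g : E -> R) : measurable_fun [set: E] f ->
  measurable_fun [set: E] g -> approximable f -> approximable g ->
  approximable (f \+ g)%R.
Proof.
move=> mf mg af ag e e0; have e20 : (0 < e / 2)%R by rewrite divr_gt0.
have [v fv] := af _ e20; have [w gw] := ag _ e20; exists (v ++ w).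
have mv := measurable_approximant v; have mw := measurable_approximant w.
rewrite (splitr e) EFinD; apply: le_lt_trans (lteD fv gw).
apply: le_trans (@ND (fun x => f x - approximant v x)%R
  (fun x => g x - approximant w x)%R _ _).
- rewrite /N le_eqVlt; apply/orP; left; apply/eqP; apply: eq_integral => x _ /=.
  by rewrite /approximant big_cat/= opprD addrACA.
- exact: measurable_funB.
- exact: measurable_funB.
Qed.

(** The coefficient [c] is real but must become rational: with [q] close to [c],
    [c f - q v = (c - q) f + q (f - v)], and each term is made smaller than [e / 2]. *)
Lemma approximableZ (c : R) (f : E -> R) : measurable_fun [set: E] f -> N f < +oo ->
  approximable f -> approximable (fun x => c * f x)%R.
Proof.
move=> mf Nf af e e0.
have N0 : 0 <= N f by apply: integral_ge0 => x _; rewrite lee_fin.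
have Nfin : N f \is a fin_num by rewrite ge0_fin_numE.
pose M := (fine (N f) + 1)%R.
have M0 : (0 < M)%R by rewrite ltr_pwDr// fine_ge0.
(* The bound [1] keeps [|q|] below [|c| + 1], which fixes the precision asked of [v]; the other
   bound makes [|c - q|] times the norm of [f] small. The [+ 1] in [M] guards against a zero
   norm. *)
have [q] : exists q : rat, (c < ratr q < c + Num.min 1 (e / 2 / M))%R.
  have : (c < c + Num.min 1 (e / 2 / M))%R.
    by rewrite ltrDl lt_min ltr01/= !divr_gt0.
  by move=> /rat_in_itvoo[q]; rewrite in_itv/=; exists q.
move=> /andP[cq qc].
have cqe : (`|c - ratr q| < e / 2 / M)%R.
  rewrite ltr0_norm ?subr_lt0// opprB ltrBlDl (lt_le_trans qc)// lerD2l.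
  by rewrite ge_min lexx orbT.
have q1 : (`|ratr q : R| <= `|c| + 1)%R.
  have -> : (ratr q = c + (ratr q - c) :> R)%R by rewrite addrC subrK.
  rewrite (le_trans (ler_normD _ _))// lerD2l ger0_norm ?subr_ge0 ?ltW//.
  by rewrite ltrBlDl (lt_le_trans qc)// lerD2l ge_min lexx.
pose C := (`|c| + 1)%R; have C0 : (0 < C)%R by rewrite ltr_wpDl.
have [|v fv] := af (e / 2 / C)%R; first by rewrite !divr_gt0.
exists [seq (q * p.1, p.2)%R | p <- v].
have mv := measurable_approximant v.
have H : N (fun x => (c - ratr q) * f x)%R < (e / 2)%:E.
  rewrite NZ// -(fineK Nfin) -EFinM lte_fin.
  apply: (@le_lt_trans _ _ (`|c - ratr q| * M)%R).
    by rewrite ler_wpM2l// lerDl.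
  by rewrite -ltr_pdivlMr.
have H' : N (fun x => ratr q * (f x - approximant v x))%R < (e / 2)%:E.
  rewrite NZ//; last exact: measurable_funB.
  apply: (@le_lt_trans _ _ (C%:E * N (fun x => f x - approximant v x)%R)).
    rewrite lee_wpmul2r ?lee_fin//; apply: integral_ge0 => x _.
    by rewrite lee_fin.
  by rewrite muleC -lte_pdivlMr.
rewrite [in ltRHS](splitr e) EFinD; apply: le_lt_trans (lteD H H').
apply: le_trans (@ND (fun x => (c - ratr q) * f x)%R
  (fun x => ratr q * (f x - approximant v x))%R _ _).
- rewrite /N le_eqVlt; apply/orP; left; apply/eqP; apply: eq_integral => x _ /=.
  rewrite /approximant big_map mulrBl mulrBr addrA subrK mulr_sumr.
  congr (`|_ - _|%:E); apply: eq_bigr => p _.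
  by rewrite [in LHS]/= rmorphM -mulrA.
- exact: measurable_funM.
- by apply: measurable_funM => //; exact: measurable_funB.
Qed.

Let approximable_eq f g : f =1 g -> approximable f -> approximable g.
Proof. by move=> /funext ->. Qed.

Let Nindic A : measurable A -> N \1_A = la A.
Proof.
move=> mA; rewrite -[X in _ = la X]setIT -integral_indic//; apply: eq_integral => x _.
by rewrite ger0_norm.
Qed.

Let laoo A : measurable A -> la A < +oo.
Proof. by move=> mA; rewrite -ge0_fin_numE//; exact: fin_num_measure. Qed.

Lemma approximable_pi_set w : approximable \1_(pi_set w).
Proof.
move=> e e0; exists [:: (1%R, w)]; rewrite (eq_integral (cst 0)).
  by rewrite integral0 lte_fin.
by move=> x _; rewrite /approximant big_seq1/= rmorph1 mul1r subrr normr0.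
Qed.

(** Dynkin's argument: the sets with an approximable indicator form a lambda-system around the
    pi-system of the [pi_set w]. Stability under increasing unions rests on the finiteness of [la],
    by which the indicators converge in [L^1]. *)
Lemma approximable_indic A : measurable A -> approximable \1_A.
Proof.
move=> mA; pose H : set (set E) := [set A | measurable A /\ approximable \1_A].
suff : <<s range pi_set >> `<=` H.
  move=> /(_ A) -[]//; apply: smallest_sub (Bgen mA).
    exact: smallest_sigma_algebra.
  move=> _ [n _ <-]; apply: sub_sigma_algebra; exists [:: n] => //.
  by rewrite /pi_set big_seq1.
apply: lambda_system_subset => //.
- move=> _ _ [v _ <-] [w _ <-]; exists (v ++ w) => //.
  by rewrite /pi_set big_cat.
- split => //.
  + split => //; have := approximable_pi_set [::].
    by rewrite /pi_set big_nil.
  + move=> X Y YX [mX aX] [mY aY]; split; first exact: measurableD.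
    apply: (@approximable_eq (\1_X \+ (fun x => (-1) * \1_Y x))%R).
      move=> x /=; rewrite mulN1r !indicE in_setD.
      have [/set_mem/YX/mem_set->|] := boolP (x \in Y); first by rewrite subrr.
      by rewrite subr0 andbT.
    apply: approximableD => //.
    * exact: measurable_funM.
    * apply: approximableZ => //.
      by rewrite Nindic// laoo.
  + move=> F ndF HF; have mF i : measurable (F i) by have [] := HF i.
    have mU : measurable (\bigcup_i F i) by exact: bigcupT_measurable.
    split => //; apply: approximable_lim => // e e0.
    have : la (F n) @[n --> \oo] --> la (\bigcup_i F i).
      exact: nondecreasing_cvg_mu.
    have Ufin : la (\bigcup_i F i) \is a fin_num by exact: fin_num_measure.
    rewrite -(fineK Ufin) => /fine_cvgP[_ /cvgrPdist_lt/(_ _ e0)[n _ /(_ n)]].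
    move=> /(_ (leqnn n)) /= h; exists \1_(F n); split => //.
      by have [] := HF n.
    rewrite (_ : \int[la]_x _ = N \1_(\bigcup_i F i `\` F n)).
      rewrite Nindic; last exact: measurableD.
      rewrite measureD// ?laoo// setIidr; last exact: bigcup_sup.
      have Ffin : la (F n) \is a fin_num by exact: fin_num_measure.
      have -> : la (\bigcup_i F i) - la (F n) =
          (fine (la (\bigcup_i F i)) - fine (la (F n)))%:E.
        by rewrite EFinB !fineK.
      rewrite lte_fin.
      by apply: le_lt_trans h; rewrite ler_norm.
    apply: eq_integral => x _; congr (`|_|%:E).
    rewrite !indicE in_setD.
    have [|] := boolP (x \in F n); last by rewrite subr0 andbT.
    move=> /set_mem Fx; rewrite andbF mem_set ?subrr//.
    by exists n.
- move=> _ [w _ <-]; split; first exact: measurable_pi_set.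
  exact: approximable_pi_set.
Qed.

Import HBSimple.

Lemma approximable_sfun (f : {sfun E >-> R}) : approximable f.
Proof.
apply: (@approximable_eq (fun x => \sum_(y \in range f) (y * \1_(f @^-1` [set y]) x))%R).
  by move=> x; rewrite fimfunE.
have -> : (fun x => \sum_(y \in range f) (y * \1_(f @^-1` [set y]) x))%R =
  (fun x => \sum_(y <- finmap.enum_fset (fset_set (range f))) (y * \1_(f @^-1` [set y]) x))%R.
  by apply/funext => x; rewrite fsbig_finite.
elim: (finmap.enum_fset _) => /= [|y s IH].
  apply: (@approximable_eq (fun x => 0 * \1_set0 x)%R).
    by move=> x; rewrite big_nil mul0r.
  apply: approximableZ => //; last exact: approximable_indic.
  by rewrite Nindic// laoo.
apply: (@approximable_eq ((fun x => y * \1_(f @^-1` [set y]) x) \+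
  (fun x => \sum_(y <- s) (y * \1_(f @^-1` [set y]) x)))%R).
  by move=> x; rewrite big_cons.
have mf z : measurable (f @^-1` [set z]) by exact: measurable_sfunP.
apply: approximableD => //.
- exact: measurable_funM.
- by apply: measurable_sum => z; exact: measurable_funM.
- apply: approximableZ => //; last exact: approximable_indic.
  by rewrite Nindic// laoo.
Qed.

Lemma integrable_approximable (f : E -> R) :
  la.-integrable [set: E] (EFin \o f) -> approximable f.
Proof.
move=> intf; have mf : measurable_fun [set: E] f.
  by apply/measurable_EFinP; exact: measurable_int intf.
apply: approximable_lim => // e e0.
have [g [_ _ h]] := approximation_sfun_integrable measurableT intf.
have {h} := h; move=> /fine_cvgP[hfin /cvgrPdist_lt/(_ _ e0) hlt].
have [n [nfin nlt]] : exists n, \int[la]_z `|(EFin \o f) z - (g n z)%:E| \is a fin_num /\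
  (`|0 - fine (\int[la]_z `|(EFin \o f) z - (g n z)%:E|)| < e)%R.
  near \oo => n; exists n; split; near: n; [exact: hfin|exact: hlt].
exists (g n); split => //; first exact: approximable_sfun.
have -> : \int[la]_x `|f x - g n x|%:E = \int[la]_z `|(EFin \o f) z - (g n z)%:E|.
  by apply: eq_integral => x _.
rewrite -(fineK nfin) lte_fin; apply: le_lt_trans nlt.
by rewrite sub0r normrN ler_norm.
Unshelve. all: end_near. Qed.

End L1_separability.

(** * Total variation distance between transition probabilities *)

Section kernel_at.
Context (R : realType) (d d' : measure_display) (X : measurableType d)
  (Y : measurableType d') (K : R.-pker X ~> Y).

(** The measure [K x] under a name of its own, to which the structure of a probability measure is
    attached. *)
Definition kernel_at (x : X) : set Y -> \bar R := K x.

HB.instance Definition _ x := Measure.on (kernel_at x).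

HB.instance Definition _ x :=
  Measure_isProbability.Build d' Y R (kernel_at x) (prob_kernel x).

End kernel_at.

Section measure_sum2.
Context (R : realType) (d : measure_display) (E : measurableType d).
Variables m1 m2 : {finite_measure set E -> \bar R}.

(** A function approximated in [L^1] of this sum is approximated at once in [L^1] of both terms. *)
Definition fin_measure_add : set E -> \bar R := measure_add m1 m2.

HB.instance Definition _ := Measure.on fin_measure_add.

Let fin_measure_add_fin : fin_num_fun fin_measure_add.
Proof.
move=> A mA; rewrite /fin_measure_add measure_addE fin_numD.
by rewrite !fin_num_measure.
Qed.

HB.instance Definition _ :=
  @Measure_isFinite.Build d E R fin_measure_add fin_measure_add_fin.

Lemma ge0_integral_fin_measure_add (f : E -> \bar R) :
  measurable_fun [set: E] f -> (forall x, 0 <= f x) ->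
  \int[fin_measure_add]_x f x = \int[m1]_x f x + \int[m2]_x f x.
Proof. by move=> mf f0; rewrite -ge0_integral_measure_add. Qed.
End measure_sum2.

Section bounded_integrals.
Context (R : realType) (d : measure_display) (E : measurableType d).
Variable (m : probability E R).

Lemma bounded_integrable (f : E -> R) (M : R) : measurable_fun [set: E] f ->
  (forall x, (`|f x| <= M)%R) -> m.-integrable [set: E] (EFin \o f).
Proof.
move=> mf fM; apply: measurable_bounded_integrable => //.
  by rewrite -ge0_fin_numE// fin_num_measure.
exists M; split; first exact: num_real.
by move=> r Mr x _ /=; rewrite (le_trans (fM x))// ltW.
Qed.

End bounded_integrals.

Section total_variation_net.
Context (R : realType) (d : measure_display) (E : measurableType d).
Variables (B : nat -> set E).
Hypotheses (mB : forall n, measurable (B n))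
  (Bgen : (measurable : set (set E)) `<=` <<s range B >>).
Variables (K : R.-pker E ~> E) (mu : probability E R).
Hypothesis Kmu : forall x, kernel_at K x `<< mu.

(** Clipping to [[0, 1]] brings an approximant no further from a function with values in [[0, 1]],
    and bounds its integrals uniformly. *)
Definition clipped (n : nat) (y : E) : R :=
  (Num.max 0 (Num.min 1 (approximant R B (odflt [::] (unpickle n)) y)))%R.

Let clipped_ge0 n y : (0 <= clipped n y)%R.
Proof. by rewrite /clipped le_max lexx. Qed.

Let clipped_le1 n y : (clipped n y <= 1)%R.
Proof. by rewrite /clipped ge_max ler01 ge_min lexx. Qed.

Let measurable_clipped n : measurable_fun [set: E] (clipped n).
Proof.
apply: measurable_maxr => //; apply: measurable_minr => //.
exact: measurable_approximant.
Qed.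

Let int01 (m : probability E R) (g : E -> R) : measurable_fun [set: E] g ->
  (forall y, 0 <= g y <= 1)%R -> m.-integrable [set: E] (EFin \o g).
Proof.
move=> mg g01; apply: (@bounded_integrable _ _ _ _ _ 1%R) => // x.
by have /andP[g0 g1] := g01 x; rewrite ger0_norm.
Qed.

Let clipped01 n y : (0 <= clipped n y <= 1)%R.
Proof. by rewrite clipped_ge0 clipped_le1. Qed.

Let Rint01 (m : probability E R) (g : E -> R) : measurable_fun [set: E] g ->
  (forall y, 0 <= g y <= 1)%R -> (0 <= \int[m]_y g y <= 1)%R.
Proof.
move=> mg g01; apply/andP; split.
  by apply: Rintegral_ge0 => y _; have /andP[] := g01 y.
have -> : (1 = \int[m]_y 1)%R.
  have /= := @Rintegral_cst _ _ _ m setT measurableT 1%R.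
  by rewrite probability_setT mul1r.
apply: le_Rintegral => //; first exact: int01.
- by apply: (@int01 m (cst 1%R)) => // y; rewrite ler01 lexx.
- by move=> y _; have /andP[] := g01 y.
Qed.

Let clip_int n x : R := (\int[kernel_at K x]_y clipped n y)%R.

Let measurable_clip_int n : measurable_fun [set: E] (clip_int n).
Proof.
apply: measurableT_comp => //.
apply: (@measurable_fun_integral_kernel _ _ _ _ _ (fun x => kernel_at K x)).
- by move=> U mU; exact: measurable_kernel.
- by move=> y; rewrite lee_fin.
- exact/measurable_EFinP.
Qed.

(** A supremum over countably many test functions, hence measurable in [x]; [tv_distP] shows that
    these tests control all measurable functions with values in [[0, 1]]. *)
Definition tv_dist (z x : E) : R :=
  fine (esups (fun n => `|clip_int n x - clip_int n z|%:E) 0%N).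

Let tv_le1 z x : esups (fun n => `|clip_int n x - clip_int n z|%:E) 0%N <= 1.
Proof.
apply: ge_ereal_sup => _ [n _ <-]; rewrite lee_fin.
have /andP[? ?] := Rint01 (kernel_at K x) (measurable_clipped n) (clipped01 n).
have /andP[? ?] := Rint01 (kernel_at K z) (measurable_clipped n) (clipped01 n).
by rewrite /clip_int ler_norml; apply/andP; split; lra.
Qed.

Let tv_ge z x n : `|clip_int n x - clip_int n z|%:E <=
  esups (fun n => `|clip_int n x - clip_int n z|%:E) 0%N.
Proof. by apply: ereal_sup_ubound; exists n. Qed.

Let tv_fin z x : esups (fun n => `|clip_int n x - clip_int n z|%:E) 0%N \is a fin_num.
Proof.
rewrite ge0_fin_numE; first by rewrite (le_lt_trans (tv_le1 z x))// ltry.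
by rewrite (le_trans _ (tv_ge z x 0%N))// lee_fin.
Qed.

Lemma measurable_tv_dist z : measurable_fun [set: E] (tv_dist z).
Proof.
apply: measurableT_comp => //.
apply: (@measurable_fun_esups _ _ _ _ (fun n x => `|clip_int n x - clip_int n z|%:E)) => n.
apply/measurable_EFinP; apply: measurableT_comp => //.
exact: measurable_funB.
Qed.

Lemma tv_distP (z x : E) (g : E -> R) : measurable_fun [set: E] g ->
  (forall y, 0 <= g y <= 1)%R ->
  (`|\int[kernel_at K x]_y g y - \int[kernel_at K z]_y g y| <= tv_dist z x)%R.
Proof.
move=> mg g01; apply/ler_addgt0Pr => e e0.
(* Approximation with respect to the sum of the two measures yields a single test function
   [clipped n] that serves at [x] and at [z]. *)
pose la : {finite_measure set E -> \bar R} :=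
  fin_measure_add (kernel_at K x) (kernel_at K z).
have intg : la.-integrable [set: E] (EFin \o g).
  apply: measurable_bounded_integrable => //.
    by rewrite -ge0_fin_numE// fin_num_measure.
  exists 1%R; split; first exact: num_real.
  move=> r Mr y _; have /andP[g0 g1] := g01 y.
  by rewrite /= ger0_norm// (le_trans g1)// ltW.
have [v] := integrable_approximable mB Bgen intg e0.
have mv : measurable_fun [set: E] (approximant R B v) by exact: measurable_approximant.
rewrite ge0_integral_fin_measure_add; last 2 first.
- by apply/measurable_EFinP; apply: measurableT_comp => //; exact: measurable_funB.
- by move=> y; rewrite lee_fin.
pose n := pickle v.
have clE y : clipped n y = Num.max 0%R (Num.min 1%R (approximant R B v y)).
  by rewrite /clipped pickleK.
have gcl y : (`|g y - clipped n y| <= `|g y - approximant R B v y|)%R.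
  have /andP[g0 g1] := g01 y; rewrite clE.
  case: (leP 1%R (approximant R B v y)) => h1.
    rewrite max_r// ler0_norm ?subr_le0// ler0_norm; last lra.
    lra.
  case: (leP 0%R (approximant R B v y)) => h2 //.
  rewrite subr0 ger0_norm// ger0_norm; lra.
have mgc : measurable_fun [set: E] (fun y => `|g y - clipped n y|)%R.
  by apply: measurableT_comp => //; exact: measurable_funB.
have key w : (`|\int[kernel_at K w]_y g y - clip_int n w|)%:E <=
    \int[kernel_at K w]_y `|g y - approximant R B v y|%:E.
  rewrite /clip_int -RintegralB//; [|exact: int01|exact: int01].
  have intgc : (kernel_at K w).-integrable [set: E] (EFin \o (fun y => g y - clipped n y)%R).
    rewrite (_ : _ \o _ = (EFin \o g) \- (EFin \o clipped n)).
      by apply: integrableB => //; exact: int01.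
    by apply/funext => y.
  rewrite EFin_normr_Rintegral//.
  apply: (le_trans (le_abse_integral _ _ _)) => //.
    exact: measurable_int intgc.
  apply: ge0_le_integral => //.
  - exact/measurable_EFinP.
  - by apply/measurable_EFinP; apply: measurableT_comp => //; exact: measurable_funB.
  - by move=> y _; rewrite lee_fin.
move=> /(le_lt_trans (leeD (key x) (key z))); rewrite -EFinD lte_fin => kxz.
have tvn : (`|clip_int n x - clip_int n z| <= tv_dist z x)%R.
  by rewrite -lee_fin /tv_dist fineK// tv_ge.
set a := (\int[_]_y _)%R in kxz *; set b := (\int[_]_y _)%R in kxz *.
rewrite (_ : a - b = (a - clip_int n x) + (clip_int n x - clip_int n z) +
  - (b - clip_int n z))%R; last by ring.
apply: (le_trans (ler_normD _ _)); rewrite normrN.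
have := ler_normD (a - clip_int n x)%R (clip_int n x - clip_int n z)%R.
by move: kxz tvn; lra.
Qed.

Let dens x y := fine (Radon_Nikodym_SigmaFinite.f (kernel_at K x) mu y).

Let densE x y : (dens x y)%:E = Radon_Nikodym_SigmaFinite.f (kernel_at K x) mu y.
Proof. by rewrite /dens fineK//; exact: (Radon_Nikodym_SigmaFinite.f_fin_num (Kmu x)). Qed.

Let int_dens x : mu.-integrable [set: E] (EFin \o dens x).
Proof.
rewrite (_ : _ \o _ = Radon_Nikodym_SigmaFinite.f (kernel_at K x) mu).
  exact: (Radon_Nikodym_SigmaFinite.f_integrable (Kmu x)).
by apply/funext => y; rewrite /= densE.
Qed.

Let mdens x : measurable_fun [set: E] (dens x).
Proof. by apply/measurable_EFinP; exact: measurable_int (int_dens x). Qed.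

Let clip_intE n x : (clip_int n x)%:E = \int[mu]_y (clipped n y * dens x y)%:E.
Proof.
rewrite /clip_int /Rintegral fineK; last first.
  by apply: integrable_fin_num => //; exact: int01.
rewrite -(@Radon_Nikodym_SigmaFinite.change_of_variables _ _ _ (kernel_at K x) mu)//.
- by apply: eq_integral => y _; rewrite -densE.
- exact: Kmu.
- by move=> y; rewrite lee_fin.
- exact/measurable_EFinP.
Qed.

(** Test functions with values in [[0, 1]] contract the [L^1] distance of the densities, so
    separability can be read off in [L^1] of [mu]. *)
Lemma tv_dist_density z x :
  (tv_dist z x)%:E <= \int[mu]_y `|dens x y - dens z y|%:E.
Proof.
rewrite /tv_dist fineK//; apply: ge_ereal_sup => _ [n _ <-].
have intc w : mu.-integrable [set: E] (fun y => (clipped n y * dens w y)%:E).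
  apply: (le_integrable measurableT _ _ (int_dens w)).
    by apply/measurable_EFinP; exact: measurable_funM.
  move=> y _ /=; rewrite lee_fin normrM ger0_norm//.
  by rewrite ler_piMl.
rewrite -abse_EFin EFinB !clip_intE -integralB//.
apply: le_trans (le_abse_integral _ _ _) _ => //.
  exact: measurable_int (integrableB _ (intc x) (intc z)).
apply: ge0_le_integral => //.
- apply: measurableT_comp => //.
  exact: measurable_int (integrableB _ (intc x) (intc z)).
- by apply/measurable_EFinP; apply: measurableT_comp => //; exact: measurable_funB.
- move=> y _; rewrite /= lee_fin -mulrBr normrM ger0_norm//.
  by rewrite ler_piMl.
Qed.

Lemma tv_dist_separable : exists z : nat -> E,
  forall x (e : R), (0 < e)%R -> exists n, (tv_dist (z n) x < e)%R.
Proof.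
(* [pt] picks points realising, up to [1 / (k + 1)], the distance from the family
   of densities to each element of a countable dense subset of [L^1 mu]. *)
pose near_dens (vk : seq (rat * seq nat) * nat) x :=
  \int[mu]_y `|dens x y - approximant R B vk.1 y|%:E < (vk.2.+1%:R^-1)%:E.
pose pt vk := if pselect (exists x, near_dens vk x) is left h
  then projT1 (cid h) else point.
exists (fun n => pt (odflt ([::], 0%N) (unpickle n))) => x e e0.
have e20 : (0 < e / 2)%R by rewrite divr_gt0.
have [k ke] : exists k, (k.+1%:R^-1 < e / 2 :> R)%R.
  by have /ltr_add_invr[k] := e20; rewrite add0r; exists k.
have k0 : (0 < k.+1%:R^-1 :> R)%R by rewrite invr_gt0.
have [v xv] := integrable_approximable mB Bgen (int_dens x) k0.
exists (pickle (v, k)); rewrite pickleK/=.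
have : near_dens (v, k) (pt (v, k)).
  rewrite /pt; case: pselect => [h|]; first by case: (cid h).
  by move=> /=; case; exists x.
set z := pt _; rewrite /near_dens/= => zv.
have mv : measurable_fun [set: E] (approximant R B v) by exact: measurable_approximant.
rewrite -lte_fin; apply: le_lt_trans (tv_dist_density z x) _.
apply: (@le_lt_trans _ _ (\int[mu]_y `|dens x y - approximant R B v y|%:E +
   \int[mu]_y `|dens z y - approximant R B v y|%:E)).
  rewrite -ge0_integralD//; last 2 first.
  - by apply/measurable_EFinP; apply: measurableT_comp => //; exact: measurable_funB.
  - by apply/measurable_EFinP; apply: measurableT_comp => //; exact: measurable_funB.
  apply: ge0_le_integral => //.
  - by apply/measurable_EFinP; apply: measurableT_comp => //; exact: measurable_funB.
  - by apply: emeasurable_funD => //;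
      apply/measurable_EFinP; apply: measurableT_comp => //; exact: measurable_funB.
  - move=> y _; rewrite -EFinD lee_fin [X in (_ <= _ + X)%R]distrC.
    by rewrite (le_trans _ (ler_normD _ _))// addrA subrK.
apply: lt_le_trans (lteD xv zv) _; rewrite -EFinD lee_fin.
by rewrite [leRHS]splitr lerD// ltW.
Qed.

End total_variation_net.

(** * Joint measurability of the semigroup in space and time *)

Section semigroup.
Context (R : realType) (d : measure_display) (E : polishType R d).
Variables (P : R -> R.-pker E ~> E) (mu : probability E R).

Lemma bounded_measurable_indic (A : set E) : measurable A ->
  bounded_measurable (\1_A : E -> R).
Proof.
move=> mA; split => //; exists 1%R; split; first exact: num_real.
move=> r r1 x _ /=; rewrite ger0_norm// indicE.
by rewrite (le_trans _ (ltW r1))// lern1; case: (_ \in _).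
Qed.

(** If [mu A = 0], invariance provides a point [y] with [P t y A = 0]. Testing with [1 + c 1_A]
    makes the logarithm on the right vanish and leaves [ln (1 + c) P t x A <= C] with [C]
    independent of [c]: impossible for large [c] unless [P t x A = 0]. *)
Lemma log_Harnack_null_dominates (H : E * E -> R) (eps kappa : R) :
  log_Harnack P H eps kappa -> invariant_measure P mu ->
  forall t : R, (0 < t)%R -> forall x, kernel_at (P t) x `<< mu.
Proof.
move=> LH mu_inv t t0 x; apply/null_content_dominatesP => A mA muA.
have mPA : measurable_fun [set: E] (fun z => P t z A).
  exact: measurable_kernel.
have [y Py] : exists y, P t y A = 0.
  have := mu_inv t (ltW t0) A mA; rewrite muA => PA0.
  have : \int[mu]_z `|P t z A| = 0.
    by rewrite -[RHS]PA0; apply: eq_integral => z _; rewrite gee0_abs.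
  move=> /(ae_eq_integral_abs mu measurableT mPA)[N [mN N0 hN]].
  have [y Ny] : exists y, ~ N y.
    apply: contrapT => /forallNP NT; have NE : N = setT.
      by apply/seteqP; split => // y _; apply: contrapT; exact: NT.
    rewrite NE in N0.
    have /eqP : (1 : \bar R) = 0 := etrans (esym (probability_setT mu)) N0.
    by rewrite onee_eq0.
  exists y; apply: contrapT => yA; apply: Ny; apply: hN => /=.
  by move=> h; apply: yA; exact: h.
rewrite /kernel_at; apply: contrapT => PxA.
have Pxfin : P t x A \is a fin_num.
  by have := @fin_num_measure _ _ _ (kernel_at (P t) x) A mA.
pose p := fine (P t x A); have p0 : (0 < p)%R.
  rewrite fine_gt0// lt_neqAle measure_ge0 andbT eq_sym.
  by rewrite (introF eqP PxA)/= ltey_eq Pxfin.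
pose C := (H (x, y) * (eps + t `^ (- kappa)))%R.
(* With this [c], [p ln (1 + c) > p ln c = |C| + 1], which contradicts the bound by [C]. *)
pose c := expR ((`|C| + 1) / p); have c0 : (0 < c)%R by exact: expR_gt0.
pose f z : R := (1 + c * \1_A z)%R.
have mf : measurable_fun [set: E] f.
  by apply: measurable_funD => //; exact: measurable_funM.
have f1 z : (1 <= f z)%R by rewrite lerDl mulr_ge0// ltW.
have fb : bounded_measurable f.
  split => //; exists (1 + c)%R; split; first exact: num_real.
  move=> r r1 z _ /=; rewrite ger0_norm; last exact: le_trans (f1 z).
  rewrite (le_trans _ (ltW r1))// lerD2l indicE.
  by case: (_ \in _); rewrite ?mulr1 ?mulr0//; exact: ltW.
have := LH x y t t0 f fb f1; rewrite /semigroup_op.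
have -> : \int[P t x]_z (ln (f z))%:E = (ln (1 + c) * p)%:E.
  rewrite (_ : (fun z => _) = (fun z => (ln (1 + c))%:E * (\1_A z)%:E)); last first.
    apply/funext => z; rewrite /f indicE -EFinM; congr EFin.
    by case: (_ \in _); rewrite ?mulr1 ?mulr0// addr0 ln1.
  rewrite ge0_integralZl//; last 2 first.
  - exact/measurable_EFinP.
  - by rewrite lee_fin ln_ge0// lerDl ltW.
  by rewrite integral_indic// setIT EFinM fineK.
have -> : \int[P t y]_z (EFin \o f) z = 1.
  rewrite (_ : _ \o _ = (fun z => 1 + c%:E * (\1_A z)%:E)); last first.
    by apply/funext => z; rewrite /= /f EFinD EFinM.
  have mc : measurable_fun [set: E] (fun z => c%:E * (\1_A z : R)%:E).
    by apply/measurable_EFinP; exact: measurable_funM.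
  rewrite ge0_integralD//; last first.
    by move=> z _; rewrite mule_ge0// lee_fin// ltW.
  rewrite ge0_integralZl//; last 2 first.
  - exact/measurable_EFinP.
  - by rewrite lee_fin ltW.
  rewrite integral_indic// setIT [X in _ + _ * X]Py mule0 adde0.
  by rewrite integral_cst// prob_kernel mule1.
rewrite lne1 add0e lee_fin -/C => hC.
have : (`|C| + 1 < ln (1 + c) * p)%R.
  rewrite -ltr_pdivrMr// -[ltLHS]expRK ltr_ln ?posrE ?ltrDr//.
  by rewrite addr_gt0.
by have := ler_norm C; lra.
Qed.

Hypotheses (P_semigroup : markov_semigroup P) (P_time : measurable_in_time P).
Hypothesis Pmu : forall t : R, (0 < t)%R -> forall x, kernel_at (P t) x `<< mu.

Lemma measurable_in_time_indic x (A : set E) : measurable A ->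
  measurable_fun (`[0%R, +oo[ : set (measurableTypeR R)) (fun s => P s x A).
Proof.
move=> mA; have := P_time (bounded_measurable_indic mA) x.
by apply: eq_measurable_fun => s _; rewrite /semigroup_op/= integral_indic// setIT.
Qed.

(* The map [x |-> P_s x A] is 1-Lipschitz for the total variation distance of
   the measures [P_r x], uniformly in [s >= r], and that distance is separable:
   hence the McShane-type formula below. *)
Lemma semigroup_jointly_measurable (r : R) (A : set E) : (0 < r)%R ->
  measurable A -> exists h : E * measurableTypeR R -> \bar R,
    measurable_fun [set: E * measurableTypeR R] h /\
    forall x s, (r <= s)%R -> h (x, s) = P s x A.
Proof.
move=> r0 mA; have [B [mB Bgen]] := polish_countably_generated E.
have [z zP] := tv_dist_separable mB Bgen (Pmu r0).
(* Times below [r] are cut off: there [P_s] does not factor through [P_r], and negative times carry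
   no measurability assumption. *)
pose g n (s : measurableTypeR R) := ((fun s => P s (z n) A) \_ `[r, +oo[) s.
have mg n : measurable_fun [set: measurableTypeR R] (g n).
  apply/(measurable_restrictT _ _).1 => //.
  apply: measurable_funS (measurable_in_time_indic (z n) mA) => //.
  by apply: subset_itvr; rewrite bnd_simp ltW.
exists (fun xs => esups (fun n => g n xs.2 - (tv_dist B (P r) (z n) xs.1)%:E) 0%N).
split.
  apply: (@measurable_fun_esups _ _ _ _
    (fun n (xs : E * measurableTypeR R) => g n xs.2 - (tv_dist B (P r) (z n) xs.1)%:E)) => n.
  apply: emeasurable_funB; first exact: measurableT_comp.
  apply/measurable_EFinP; apply: measurableT_comp => //.
  exact: measurable_tv_dist.
move=> x s rs /=.
have gE n : g n s = P s (z n) A.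
  by rewrite /g patchE mem_set//= in_itv/= rs.
pose k y := fine (P (s - r) y A).
have Pfin u y : P u y A \is a fin_num.
  by have := @fin_num_measure _ _ _ (kernel_at (P u) y) A mA.
have mk : measurable_fun [set: E] k.
  by apply: measurableT_comp => //; exact: measurable_kernel.
have k01 y : (0 <= k y <= 1)%R.
  apply/andP; split; first by rewrite fine_ge0.
  rewrite -lee_fin fineK// -(prob_kernel (s := P (s - r)) y).
  by apply: le_measure => //; rewrite inE.
have PkE y : P s y A = (\int[kernel_at (P r) y]_w k w)%:E.
  rewrite /Rintegral fineK; last first.
    apply: integrable_fin_num => //.
    apply: (@bounded_integrable _ _ _ _ _ 1%R) => // w.
    by have /andP[? ?] := k01 w; rewrite ger0_norm.
  rewrite -[in LHS](subrK r s) addrC P_semigroup.2//; last 2 first.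
  - exact: ltW.
  - by rewrite subr_ge0.
  by apply: eq_integral => w _; rewrite /k fineK.
have lip n := tv_distP mB Bgen (P r) (z n) x mk k01.
apply/eqP; rewrite eq_le; apply/andP; split.
  apply: ge_ereal_sup => _ [n _ <-]; rewrite gE !PkE -EFinB lee_fin.
  exact: (ler_distlCBl (lip n)).
apply/lee_addgt0Pr => e e0.
(* The distance to the net point is paid twice, in the Lipschitz bound and in the formula itself,
   hence the precision [e / 2]. *)
have e20 : (0 < e / 2)%R by rewrite divr_gt0.
have [n zn] := zP x _ e20.
apply: (@le_trans _ _ (g n s - (tv_dist B (P r) (z n) x)%:E + e%:E)).
  rewrite gE !PkE -EFinB -EFinD lee_fin.
  rewrite (le_trans (ler_distlDr (lip n)))// -addrA lerD2l addrC -lerBlDr opprK.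
  by rewrite [leRHS]splitr lerD// ltW.
by rewrite leeD2r//; apply: ereal_sup_ubound; exists n.
Qed.

(** At time [0] the semigroup is the point mass; using it at negative times too gives a Markov
    kernel on the whole line of times. *)
Definition time_kernel (xs : E * measurableTypeR R) : {measure set E -> \bar R} :=
  if (0 < xs.2)%R then (P xs.2 xs.1 : {measure set E -> \bar R}) else \d_(xs.1).

Let measurable_time_kernel A : measurable A ->
  measurable_fun [set: E * measurableTypeR R] (time_kernel ^~ A).
Proof.
move=> mA.
pose r n : R := n.+1%:R^-1%R.
have r0 n : (0 < r n)%R by rewrite invr_gt0.
pose h n := projT1 (cid (semigroup_jointly_measurable (r0 n) mA)).
have [mh hE] : (forall n, measurable_fun [set: E * measurableTypeR R] (h n)) /\
    forall n x s, (r n <= s)%R -> h n (x, s) = P s x A.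
  by split=> n; rewrite /h; case: cid => ? [].
(* At a time [s > 0] the terms with [r n <= s] all equal [P s x A] and the others are [0], so the
   supremum glues the versions obtained on [[r n, +oo[]. *)
pose H xs := esups (fun n => if (r n <= xs.2)%R then h n xs else 0) 0%N.
have mH : measurable_fun [set: E * measurableTypeR R] H.
  apply: (@measurable_fun_esups _ _ _ _
    (fun n (xs : E * measurableTypeR R) => if (r n <= xs.2)%R then h n xs else 0)) => n.
  apply: measurable_fun_ifT => //; exact: measurable_fun_ler.
rewrite (_ : time_kernel ^~ A = fun xs => if (0 < xs.2)%R then H xs else \d_(xs.1) A).
  apply: measurable_fun_ifT => //; first exact: measurable_fun_ltr.
  apply/measurable_EFinP; apply: measurableT_comp => //.
apply/funext => -[x s]; rewrite /time_kernel/=; case: ifPn => // s0.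
apply/eqP; rewrite eq_le; apply/andP; split.
  have [n ns] : exists n, (r n <= s)%R.
    by have /ltr_add_invr[n] := s0; rewrite add0r => /ltW; exists n.
  apply: ereal_sup_ubound; exists n => //=.
  by rewrite ns hE.
apply: ge_ereal_sup => _ [n _ <-] /=; case: ifPn => [ns|_] //.
by rewrite hE.
Qed.

HB.instance Definition _ :=
  isKernel.Build _ _ _ _ R time_kernel measurable_time_kernel.

Let time_kernel_prob xs : time_kernel xs [set: E] = 1.
Proof.
rewrite /time_kernel; case: ifPn => _; first exact: prob_kernel.
exact: probability_setT.
Qed.

HB.instance Definition _ :=
  Kernel_isProbability.Build _ _ _ _ R time_kernel time_kernel_prob.

Lemma semigroup_joint_kernel :
  exists K : R.-pker (E * measurableTypeR R)%type ~> E,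
    forall x s A, (0 <= s)%R -> measurable A -> K (x, s) A = P s x A.
Proof.
exists time_kernel => x s A; rewrite le_eqVlt => /predU1P[<-|s0] mA.
  by rewrite /= /time_kernel ltxx P_semigroup.1.
by rewrite /= /time_kernel s0.
Qed.

End semigroup.

(** * Negative moments of stable laws *)

Section gamma_integrals.
Context (R : realType).
Implicit Types a b c k u x : R.
Local Notation lambda := (@lebesgue_measure R).

Lemma cvg_powR_pinfty (b k : R) : (0 < b)%R -> (0 < k)%R ->
  (k * u `^ b)%R @[u --> +oo%R] --> +oo%R.
Proof.
move=> b0 k0; apply/cvgryPge => A.
have kb0 : (0 < Num.max A 1 / k)%R by rewrite divr_gt0// lt_max ltr01 orbT.
near=> u.
have u1 : ((Num.max A 1 / k) `^ b^-1 <= u)%R by near: u; exact: nbhs_pinfty_ge.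
have : ((Num.max A 1 / k) `^ b^-1 `^ b <= u `^ b)%R.
  apply: ge0_ler_powR => //; [exact: ltW|by rewrite nnegrE powR_ge0|].
  by rewrite nnegrE (le_trans _ u1)// powR_ge0.
rewrite -powRrM mulVf ?gt_eqF// powRr1 ?(ltW kb0)// ler_pdivrMr// mulrC => h.
by rewrite (le_trans _ h)// le_max lexx.
Unshelve. all: end_near. Qed.

Lemma continuous_powR (b u : R) : (0 < u)%R -> {for u, continuous ((fun v => v `^ b)%R : R -> R)}.
Proof.
move=> u0; apply: differentiable_continuous; apply/derivable1_diffP.
by apply: derivable_powR; rewrite in_itv/= u0.
Qed.

Lemma derive1_mulr_powR (b k u : R) : (0 < u)%R ->
  (derive1 (fun v : R => k * v `^ b) u = k * (b * u `^ (b - 1)))%R.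
Proof.
move=> u0; rewrite derive1E.
have [dp dE] := is_derive1_powR b u0.
by rewrite deriveZ//= dE.
Qed.

(** The change of variables [v = c u^b]. It is performed on [[r, +oo[] with [r > 0] because the
    derivative [c b u^(b-1)] is singular at [0] when [b < 1]; [b <= 1] makes that derivative
    converge at infinity. *)
Lemma powR_expR_substitution (a b c r : R) :
  (0 < b)%R -> (b <= 1)%R -> (0 < c)%R -> (0 < r)%R ->
  \int[lambda]_(v in `[(c * r `^ b)%R, +oo[)
     (v `^ (a / b - 1) * expR (- v) / (b * c `^ (a / b)))%:E =
  \int[lambda]_(u in `[r, +oo[) (u `^ (a - 1) * expR (- (c * u `^ b)))%:E.
Proof.
move=> b0 b1 c0 r0.
pose F u := (c * u `^ b)%R.
pose G v := (v `^ (a / b - 1) * expR (- v) / (b * c `^ (a / b)))%R.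
have F'E u : (0 < u)%R -> (F^`()%classic u = c * (b * u `^ (b - 1)))%R.
  exact: derive1_mulr_powR.
have cF' u : (0 < u)%R -> {for u, continuous F^`()%classic}.
  move=> u0; rewrite /prop_for /continuous_at F'E//.
  have h : (c * (b * v `^ (b - 1)))%R @[v --> u] --> (c * (b * u `^ (b - 1)))%R.
    apply: cvgM; first exact: cvg_cst.
    by apply: cvgM; [exact: cvg_cst|exact: continuous_powR].
  apply: cvg_trans h.
  apply: near_eq_cvg; near=> v; rewrite F'E//.
  by near: v; exact: lt_nbhsr.
rewrite (@increasing_ge0_integration_by_substitutiony _ F G r).
- apply: eq_integral => u; rewrite inE/= in_itv/= andbT => ru.
  have u0 : (0 < u)%R := lt_le_trans r0 ru.
  congr EFin; rewrite fctE /= F'E// /G /F.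
  rewrite powRM ?powR_ge0 ?ltW// -powRrM.
  have -> : (b * (a / b - 1) = a - b)%R.
    by rewrite mulrBr mulr1 mulrCA divff ?gt_eqF// mulr1.
  have -> : (c `^ (a / b - 1) = c `^ (a / b) / c)%R.
    rewrite powRB.
      by rewrite powRr1// ltW.
    by rewrite (gt_eqF c0) implybT.
  have -> : (a - 1 = (a - b) + (b - 1))%R by rewrite addrA subrK.
  rewrite [in RHS]powRD; last by rewrite (gt_eqF u0) implybT.
  have ca : (c `^ (a / b) != 0)%R by rewrite gt_eqF// powR_gt0.
  have cn : (c != 0)%R by rewrite gt_eqF.
  have bn : (b != 0)%R by rewrite gt_eqF.
  field.
  by rewrite ca bn cn.
- move=> u v; rewrite !in_itv/= !andbT => ru rv uv.
  rewrite ltr_pM2l//; apply: gt0_ltr_powR => //; rewrite nnegrE ltW//.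
    exact: lt_le_trans ru.
  exact: lt_le_trans rv.
- move=> u; rewrite in_itv/= andbT => ru; apply: cF'.
  exact: lt_trans ru.
- apply/cvg_ex; exists (F^`()%classic r); apply: cvg_at_right_filter.
  exact: cF'.
- move: b1; rewrite le_eqVlt => /predU1P[b1|b1].
    apply/cvg_ex; exists c.
    apply: (@cvg_trans _ (cst c @ +oo%R)); last exact: cvg_cst.
    apply: near_eq_cvg; near=> u; rewrite F'E; last first.
      by near: u; exact: nbhs_pinfty_gt.
    by rewrite /= b1 subrr powRr0 !mulr1.
  apply/cvg_ex; exists 0%R.
  have hp : \forall u \near +oo%R, (0 < (c * b)^-1 * u `^ (1 - b))%R.
    near=> u; have u0 : (0 < u)%R by near: u; exact: nbhs_pinfty_gt.
    by rewrite mulr_gt0 ?powR_gt0// invr_gt0 mulr_gt0.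
  have h : ((c * b)^-1 * u `^ (1 - b))^-1%R @[u --> +oo%R] --> (0 : R)%R.
    apply/(gtr0_cvgV0 hp); apply: cvg_powR_pinfty; first by rewrite subr_gt0.
    by rewrite invr_gt0 mulr_gt0.
  apply: cvg_trans h; apply: near_eq_cvg; near=> u.
  have u0 : (0 < u)%R by near: u; exact: nbhs_pinfty_gt.
  by rewrite F'E//= invfM invrK -powRN opprB mulrA.
- split.
    move=> u; rewrite in_itv/= andbT => ru.
    apply: derivableM => //; apply: derivable_powR.
    by rewrite in_itv/= (lt_trans r0 ru).
  apply: cvg_at_right_filter; apply: cvgM; first exact: cvg_cst.
  exact: continuous_powR.
- exact: cvg_powR_pinfty.
- apply: continuous_in_subspaceT => v; rewrite inE/= in_itv/= andbT => rv.
  have v0 : (0 < v)%R by rewrite (lt_le_trans _ rv)// mulr_gt0// powR_gt0.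
  rewrite /continuous_at; apply: cvgM; last exact: cvg_cst.
  apply: cvgM.
    exact: continuous_powR.
  apply: (@continuous_comp _ _ _ -%R expR); first exact: opp_continuous.
  exact: continuous_expR.
- move=> v _; rewrite /G mulr_ge0//.
    by rewrite mulr_ge0 ?powR_ge0 ?expR_ge0.
  by rewrite invr_ge0 mulr_ge0 ?powR_ge0 ?ltW.
Unshelve. all: end_near. Qed.

(** Monotone convergence recovers the half-line from the truncated domains on which the change of
    variables is carried out. *)
Lemma cvg_integral_itvcy0 (f : R -> R) (r_ : nat -> R) :
  measurable_fun [set: R] f -> (forall x, (0 < x)%R -> (0 <= f x)%R) ->
  (forall n, (0 < r_ n)%R) -> nonincreasing_seq r_ -> r_ n @[n --> \oo] --> 0%R ->
  \int[lambda]_(x in `[r_ n, +oo[) (f x)%:E @[n --> \oo] -->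
  \int[lambda]_(x in `]0%R, +oo[) (f x)%:E.
Proof.
move=> mf f0 r0 nr cr.
have -> : `]0%R, +oo[%classic = \bigcup_n `[r_ n, +oo[%classic.
  apply/seteqP; split => [x /=|x [n _] /=]; rewrite !in_itv/= !andbT.
    move=> x0; move: cr => /cvgr0_norm_lt /(_ _ x0)[n _ /(_ n (leqnn n)) rx].
    exists n => //=; rewrite in_itv/= andbT.
    by move: rx; rewrite gtr0_norm// => /ltW.
  by move=> rx; exact: lt_le_trans rx.
apply: ge0_nondecreasing_set_cvg_integral => //.
- move=> m n mn; rewrite subsetEset; apply: subset_itvr.
  by rewrite bnd_simp; exact: nr.
- by move=> n; apply: measurable_funTS; exact/measurable_EFinP.
- move=> n x /=; rewrite in_itv/= andbT lee_fin => rx; apply: f0.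
  exact: lt_le_trans rx.
Qed.

Lemma measurable_powR_expR (p : R) :
  measurable_fun [set: R] (fun x : R => x `^ p * expR (- x))%R.
Proof.
apply: measurable_funM => //.
by apply: measurableT_comp => //; exact: measurableT_comp.
Qed.

(** The integrand is dominated by a multiple of the exponential density of rate [1/2]. *)
Lemma gamma_integral_lty (a : R) : (1 <= a)%R ->
  \int[lambda]_(s in `]0%R, +oo[) (s `^ (a - 1) * expR (- s))%:E < +oo.
Proof.
move=> a1; pose b := (a - 1)%R; have b0 : (0 <= b)%R by rewrite subr_ge0.
(* Chosen so that [b / K <= 1/2]: then [ln s <= ln K + s / K], multiplied by [b], uses up at most
   half of the decay of [expR (- s)]. The [+ 1] covers [b = 0]; the factor [2] in [C] cancels the
   rate in the density. *)
pose K := (2 * (b + 1))%R; have K0 : (0 < K)%R by rewrite mulr_gt0// ltr_wpDl.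
pose C := (2 * expR (b * ln K))%R.
have C0 : (0 <= C)%R by rewrite mulr_ge0// expR_ge0.
have h s : (0 < s)%R ->
    (s `^ b * expR (- s) <= C * exponential_pdf 2^-1 s)%R.
  move=> s0; rewrite exponential_pdfE; last exact: ltW.
  rewrite /C mulrACA divff// mul1r /powR gt_eqF// -!expRD ler_expR.
  suff : (b * ln s <= b * ln K + s / 2)%R by lra.
  have : (ln s <= ln K + s / K)%R.
    rewrite -lerBlDl -ln_div ?posrE//; apply/ltW/ln_sublinear.
    by rewrite divr_gt0.
  move=> /(ler_wpM2l b0); rewrite mulrDr => /le_trans; apply; rewrite lerD2l.
  rewrite mulrA ler_pdivrMr// (_ : s / 2 * K = b * s + s)%R; last first.
    by rewrite /K; field.
  by rewrite lerDl ltW.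
apply: (@le_lt_trans _ _
   (\int[lambda]_(s in `]0%R, +oo[) (C%:E * (exponential_pdf 2^-1 s)%:E))).
  apply: ge0_le_integral => //.
  - by move=> s _; rewrite lee_fin mulr_ge0 ?powR_ge0 ?expR_ge0.
  - by apply: measurable_funTS; apply/measurable_EFinP; exact: measurable_powR_expR.
  - apply: measurable_funTS; apply: measurable_funeM.
    by apply/measurable_EFinP; exact: measurable_exponential_pdf.
  - by move=> s; rewrite /= in_itv/= andbT => s0; rewrite -EFinM lee_fin h.
rewrite ge0_integralZl//; last 2 first.
- apply: measurable_funTS; apply/measurable_EFinP.
  exact: measurable_exponential_pdf.
- by move=> s _; rewrite lee_fin exponential_pdf_ge0.
apply: lte_mul_pinfty => //.
apply: (@le_lt_trans _ _ (\int[lambda]_s (exponential_pdf 2^-1 s)%:E)).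
  apply: ge0_subset_integral => //.
  - by apply/measurable_EFinP; exact: measurable_exponential_pdf.
  - by move=> s _; rewrite lee_fin exponential_pdf_ge0.
by rewrite integral_exponential_pdf// ltry.
Qed.

Lemma GammaE (a : R) : (1 <= a)%R ->
  \int[lambda]_(s in `]0%R, +oo[) (s `^ (a - 1) * expR (- s))%:E = (Gamma a)%:E.
Proof.
move=> a1; rewrite /Gamma /Rintegral fineK// ge0_fin_numE.
  exact: gamma_integral_lty.
by apply: integral_ge0 => s _; rewrite lee_fin mulr_ge0 ?powR_ge0 ?expR_ge0.
Qed.

(** On [[1, 2]] the integrand is at least [expR (- 2)]. *)
Lemma Gamma_gt0 (a : R) : (1 <= a)%R -> (0 < Gamma a)%R.
Proof.
move=> a1; rewrite -lte_fin -GammaE//.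
apply: (@lt_le_trans _ _ (\int[lambda]_(s in `[1%R, 2%R]) (expR (- 2))%:E)).
  rewrite integral_cst//= lebesgue_measure_itv/= lte_fin ltr1n -EFinB -EFinM.
  by rewrite lte_fin mulr_gt0 ?expR_gt0// subr_gt0 ltr1n.
apply: (@le_trans _ _
    (\int[lambda]_(s in `[1%R, 2%R]) (s `^ (a - 1) * expR (- s))%:E)).
  apply: ge0_le_integral => //.
  - by apply: measurable_funTS; apply/measurable_EFinP; exact: measurable_powR_expR.
  - move=> s /=; rewrite in_itv/= lee_fin => /andP[s1 s2].
    rewrite -[leLHS]mul1r ler_pM ?expR_ge0//.
      apply: (@le_trans _ _ (1 `^ (a - 1))%R); first by rewrite powR1.
      apply: ge0_ler_powR => //; first by rewrite subr_ge0.
        by rewrite nnegrE.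
      by rewrite nnegrE (le_trans _ s1).
    by rewrite ler_expR lerN2.
apply: ge0_subset_integral => //.
- by apply: measurable_funTS; apply/measurable_EFinP; exact: measurable_powR_expR.
- by move=> s _; rewrite lee_fin mulr_ge0 ?powR_ge0 ?expR_ge0.
- by apply: subset_itv; rewrite bnd_simp.
Qed.

(** [powR_expR_substitution] on [[1/(n+1), +oo[], with [n] sent to infinity on both sides; the image
    domain starts at [c (1/(n+1))^b], which also decreases to [0]. As [a / b >= 1], the limit is a
    finite Gamma integral. *)
Lemma integral_powR_expR_powR (a b c : R) :
  (1 <= a)%R -> (0 < b)%R -> (b <= 1)%R -> (0 < c)%R ->
  \int[lambda]_(u in `]0%R, +oo[) (u `^ (a - 1) * expR (- (c * u `^ b)))%:E =
  (Gamma (a / b) / (b * c `^ (a / b)))%:E.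
Proof.
move=> a1 b0 b1 c0.
have ab1 : (1 <= a / b)%R by rewrite ler_pdivlMr// mul1r (le_trans b1).
pose k := (b * c `^ (a / b))%R; have k0 : (0 < k)%R by rewrite mulr_gt0// powR_gt0.
pose r_ n : R := n.+1%:R^-1%R.
have r0 n : (0 < r_ n)%R by rewrite invr_gt0.
have nr : nonincreasing_seq r_.
  by move=> m n mn; rewrite lef_pV2 ?posrE// ler_nat ltnS.
have cr : r_ n @[n --> \oo] --> (0 : R)%R by exact: cvg_harmonic.
have mL : measurable_fun [set: R] (fun u => u `^ (a - 1) * expR (- (c * u `^ b)))%R.
  apply: measurable_funM => //; apply: measurableT_comp => //.
  by apply: measurableT_comp => //; exact: measurable_funM.
have mG : measurable_fun [set: R] (fun v => v `^ (a / b - 1) * expR (- v) / k)%R.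
  by apply: measurable_funM => //; exact: measurable_powR_expR.
have h1 := @cvg_integral_itvcy0 _ r_ mL _ r0 nr cr.
have h2 := @cvg_integral_itvcy0 _ (fun n => c * r_ n `^ b)%R mG.
transitivity (\int[lambda]_(v in `]0%R, +oo[)
    (v `^ (a / b - 1) * expR (- v) / k)%:E); last first.
  under eq_integral do rewrite mulrC EFinM.
  rewrite ge0_integralZl//; last 3 first.
  - by apply: measurable_funTS; apply/measurable_EFinP; exact: measurable_powR_expR.
  - by move=> s _; rewrite lee_fin mulr_ge0 ?powR_ge0 ?expR_ge0.
  - by rewrite lee_fin invr_ge0 ltW.
  by rewrite GammaE// -EFinM mulrC.
have {}h1 := h1 (fun x _ => mulr_ge0 (powR_ge0 _ _) (expR_ge0 _)).
apply: etrans (esym (cvg_lim (@ereal_hausdorff R) h1)) _.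
apply: (cvg_lim (@ereal_hausdorff R)).
under eq_fun do rewrite -powR_expR_substitution//.
apply: h2.
- move=> x x0; apply: mulr_ge0; last by rewrite invr_ge0 ltW.
  by apply: mulr_ge0; [exact: powR_ge0|exact: expR_ge0].
- by move=> n; rewrite mulr_gt0// powR_gt0.
- move=> m n mn; rewrite ler_pM2l//; apply: ge0_ler_powR.
  + exact: ltW.
  + by rewrite nnegrE ltW.
  + by rewrite nnegrE ltW.
  + exact: nr.
- rewrite -[X in _ --> X](mulr0 c); apply: cvgM; first exact: cvg_cst.
  have /cvg_at_rightP : (a `^ b)%R @[a --> 0^'+] --> (0 : R)%R by exact: powR_cvg0.
  by apply; split.
Qed.

End gamma_integrals.

Lemma integral_mkcond_indic (R : realType) (d : measure_display)
    (T : measurableType d) (m : {measure set T -> \bar R}) (D : set T)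
    (g : T -> R) :
  \int[m]_(x in D) (g x)%:E = \int[m]_x (\1_D x * g x)%:E.
Proof.
rewrite integral_mkcond; apply: eq_integral => x _.
by rewrite patchE indicE; case: (x \in D); rewrite ?mul1r ?mul0r.
Qed.

Section stable_laplace.
Context (R : realType) (m : probability (measurableTypeR R) R) (t alpha : R).
Hypotheses (t_gt0 : (0 < t)%R) (alpha_gt0 : (0 < alpha)%R)
  (alpha_le1 : (alpha <= 1)%R).
Hypothesis m_lt0 : m [set s | (s < 0)%R] = 0.
Hypothesis laplace : forall x : R, (0 <= x)%R ->
  \int[m]_(s in `[0%R, +oo[) (expR (- (x * s)))%:E =
  (expR (- (t * x `^ alpha)))%:E.
Local Notation lambda := (@lebesgue_measure R).

Let mexp (x : R) : measurable_fun [set: measurableTypeR R]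
  (fun s : R => expR (- (x * s)))%R.
Proof.
apply: measurableT_comp => //; apply: measurableT_comp => //.
Qed.

(** The integrand of the Laplace transform is [1] at the origin, so the mass there is at most
    [exp (- t x^alpha)] for every [x], and this tends to [0]. *)
Lemma stable_set1_0 : m [set 0%R] = 0.
Proof.
apply/eqP; rewrite eq_le measure_ge0 andbT leNgt; apply/negP => p0.
have mfin : m [set 0%R] \is a fin_num by exact: fin_num_measure.
pose p := fine (m [set 0%R]).
have {}p0 : (0 < p)%R by rewrite fine_gt0// p0/= ltey_eq mfin.
(* At [x = y^(1/alpha)] the transform equals [exp (- (|ln p| + 1))], which is below [p]. *)
pose y := ((`|ln p| + 1) / t)%R.
have y0 : (0 < y)%R by rewrite divr_gt0// ltr_wpDl.
have := laplace (powR_ge0 y alpha^-1).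
rewrite -powRrM mulVf ?gt_eqF// powRr1; last exact: ltW.
have -> : (t * y = `|ln p| + 1)%R by rewrite /y mulrC divfK// gt_eqF.
move=> h.
have : m [set 0%R] <= (expR (- (`|ln p| + 1)))%:E.
  rewrite -h -[leLHS]mul1e -integral_cst//.
  apply: (@le_trans _ _ (\int[m]_(s in [set 0%R])
     (expR (- (y `^ alpha^-1 * s)))%:E)).
    rewrite le_eqVlt; apply/orP; left; apply/eqP; apply: eq_integral => s.
    by rewrite inE => ->; rewrite mulr0 oppr0 expR0.
  apply: ge0_subset_integral => //.
  - by apply: measurable_funTS; apply/measurable_EFinP.
  - by move=> s ->; rewrite /= in_itv/= lexx.
rewrite -(fineK mfin) lee_fin -/p -ler_ln ?posrE ?expR_gt0// expRK.
by have := ler_norm (- ln p)%R; rewrite normrN; lra.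
Qed.

Lemma stable_npos_itv : m `]-oo, 0%R]%classic = 0.
Proof.
rewrite (_ : `]-oo, 0%R]%classic = [set s | (s < 0)%R] `|` [set 0%R]).
  apply/eqP; rewrite eq_le measure_ge0 andbT.
  have mneg : measurable ([set s | (s < 0)%R] : set (measurableTypeR R)).
    rewrite (_ : [set s | _] = `]-oo, 0%R[%classic); first exact: measurable_itv.
    by apply/seteqP; split => s; rewrite /= in_itv.
  rewrite (le_trans (measureU2 _ _ _))//.
  apply: (@le_trans _ _ (0 + 0)); last by rewrite adde0.
  apply: leeD; rewrite le_eqVlt; apply/orP; left; apply/eqP; first exact: m_lt0.
  exact: stable_set1_0.
apply/seteqP; split => s /=; rewrite in_itv/= le_eqVlt.
  by move=> /predU1P[->|?]; [right|left].
by move=> [->|->]; rewrite ?orbT ?eqxx.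
Qed.

Lemma stable_laplace_oy (x : R) : (0 <= x)%R ->
  \int[m]_(s in `]0%R, +oo[) (expR (- (x * s)))%:E =
  (expR (- (t * x `^ alpha)))%:E.
Proof.
move=> x0; rewrite -laplace//.
rewrite -[in RHS](@setU1itv _ _ _ _ false)//.
rewrite ge0_integral_setU//.
- rewrite [X in _ = X + _](_ : _ = 0) ?add0e//.
  apply/eqP; rewrite eq_le; apply/andP; split; last first.
    by apply: integral_ge0 => s _; rewrite lee_fin expR_ge0.
  rewrite -stable_set1_0 -[leRHS]mul1e -integral_cst//.
  rewrite le_eqVlt; apply/orP; left; apply/eqP; apply: eq_integral => s.
  by rewrite inE => ->; rewrite mulr0 oppr0 expR0.
- by apply: measurable_funTS; apply/measurable_EFinP.
- by apply/disj_setPS => s [/= ->]; rewrite in_itv/= ltxx.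
Qed.

(** [integral_powR_expR_powR] is used at both ends: with exponent [1] and factor [s] it produces
    [Gamma kappa] times [s^-kappa], and with exponent [alpha] and factor [t] it evaluates the
    integral of [u^(kappa-1) exp (- t u^alpha)] left after the exchange. *)
Lemma stable_negative_moment (kappa : R) : (1 <= kappa)%R ->
  \int[m]_(s in `]0%R, +oo[) (s `^ (- kappa))%:E =
  (Gamma (kappa / alpha) / (alpha * t `^ (kappa / alpha) * Gamma kappa))%:E.
Proof.
move=> kappa1.
pose D : set (measurableTypeR R) := `]0%R, +oo[%classic.
have mD : measurable D by exact: measurable_itv.
(* Both restrictions to the half-line sit in the integrand, so that Tonelli's theorem applies on the
   full product. *)
pose f (su : measurableTypeR R * measurableTypeR R) : \bar R :=
  (\1_D su.1 * (\1_D su.2 * (su.2 `^ (kappa - 1) * expR (- (su.1 * su.2)))))%:E.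
have f0 su : 0 <= f su.
  by rewrite lee_fin !mulr_ge0 ?powR_ge0 ?expR_ge0.
have mf : measurable_fun [set: measurableTypeR R * measurableTypeR R] f.
  apply/measurable_EFinP; apply: measurable_funM.
    by apply: measurableT_comp => //; exact: measurable_indic.
  apply: measurable_funM.
    by apply: measurableT_comp => //; exact: measurable_indic.
  apply: measurable_funM.
    by apply: (measurableT_comp (measurable_powR _)).
  apply: measurableT_comp => //; apply: measurableT_comp => //.
  exact: measurable_funM.
have G0 := Gamma_gt0 kappa1.
have mpowN : measurable_fun [set: measurableTypeR R] (fun s : R => s `^ (- kappa))%R.
  exact: measurable_powR.
have key : (Gamma kappa)%:E * \int[m]_(s in D) (s `^ (- kappa))%:E =
    (Gamma (kappa / alpha) / (alpha * t `^ (kappa / alpha)))%:E.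
  rewrite -integral_powR_expR_powR//.
  rewrite -ge0_integralZl//; last 3 first.
  - by apply: measurable_funTS; apply/measurable_EFinP.
  - by move=> s _; rewrite lee_fin powR_ge0.
  - by rewrite lee_fin ltW.
  transitivity (\int[m]_s \int[lambda]_u f (s, u)).
    rewrite integral_mkcond; apply: eq_integral => s _; rewrite patchE.
    case: ifPn => [sD|/negbTE sD].
      have s0 : (0 < s)%R by move: sD; rewrite inE /D/= in_itv/= andbT.
      rewrite -EFinM.
      transitivity (\int[lambda]_(u in D) (u `^ (kappa - 1) * expR (- (s * u `^ 1)))%:E).
        rewrite integral_powR_expR_powR// !divr1 mul1r powRN.
        by [].
      rewrite integral_mkcond_indic; apply: eq_integral => u _.
      rewrite /f/= [\1_D s]indicE sD mul1r.
      rewrite indicE; have [|] := boolP (u \in D); last by rewrite !mul0r.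
      by rewrite inE /D/= in_itv/= andbT => u0; rewrite powRr1// ltW.
    by rewrite integral0_eq// => u _; rewrite /f/= indicE sD mul0r.
  rewrite (fubini_tonelli f)//.
  rewrite [in RHS]integral_mkcond; apply: eq_integral => u _; rewrite patchE.
  case: ifPn => [uD|/negbTE uD]; last first.
    by rewrite integral0_eq// => s _; rewrite /f/= [\1_D u]indicE uD mul0r mulr0.
  have u0 : (0 < u)%R by move: uD; rewrite inE /D/= in_itv/= andbT.
  rewrite EFinM -stable_laplace_oy ?ltW// -ge0_integralZl//; last 2 first.
  - by apply: measurable_funTS; apply/measurable_EFinP.
  - by rewrite lee_fin powR_ge0.
  under [in RHS]eq_integral do rewrite -EFinM.
  rewrite [RHS]integral_mkcond_indic; apply: eq_integral => s _.
  by rewrite /f/= [\1_D u]indicE uD mul1r [(s * u)%R]mulrC.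
have : \int[m]_(s in D) (s `^ (- kappa))%:E =
    (Gamma kappa)^-1%:E * ((Gamma kappa)%:E * \int[m]_(s in D) (s `^ (- kappa))%:E).
  by rewrite muleA -EFinM mulVf ?gt_eqF// mul1e.
rewrite key -EFinM => ->; congr EFin; move: (alpha * _)%R => Y.
by rewrite mulrC -mulrA -invfM.
Qed.

End stable_laplace.

(** * The subordinated kernel *)

Section subordinated_kernel.
Context (R : realType) (d : measure_display) (E : measurableType d).
Variables (K : R.-pker (E * measurableTypeR R)%type ~> E).
Variable (m : probability (measurableTypeR R) R).

Definition time_law (x : E) : {measure set (measurableTypeR R) -> \bar R} := m.

Let measurable_time_law U : measurable U ->
  measurable_fun [set: E] (time_law ^~ U).
Proof. by move=> mU; exact: measurable_cst. Qed.

HB.instance Definition _ :=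
  isKernel.Build _ _ _ _ R time_law measurable_time_law.

Let time_law_prob x : time_law x [set: measurableTypeR R] = 1.
Proof. exact: probability_setT. Qed.

HB.instance Definition _ :=
  Kernel_isProbability.Build _ _ _ _ R time_law time_law_prob.

(** Composition with a law of the time that ignores the starting point: for [m = nu t] it is the
    transition kernel of the subordinated process. *)
Definition mixture (x : E) : {measure set E -> \bar R} := (time_law \; K) x.

Let measurable_mixture U : measurable U ->
  measurable_fun [set: E] (mixture ^~ U).
Proof. exact: measurable_kernel. Qed.

HB.instance Definition _ :=
  isKernel.Build _ _ _ _ R mixture measurable_mixture.

Let mixture_prob x : mixture x [set: E] = 1.
Proof.
rewrite /mixture /= /kcomp (eq_integral (cst 1)).
  by rewrite integral_cst// mul1e time_law_prob.
by move=> s _; exact: prob_kernel.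
Qed.

HB.instance Definition _ :=
  Kernel_isProbability.Build _ _ _ _ R mixture mixture_prob.

Lemma ge0_integral_mixture x (f : E -> \bar R) : measurable_fun [set: E] f ->
  (forall y, 0 <= f y) -> \int[mixture x]_y f y = \int[m]_s \int[K (x, s)]_y f y.
Proof. by move=> mf f0; rewrite /mixture /= integral_kcomp. Qed.

End subordinated_kernel.

Section subordinated_semigroup.
Context (R : realType) (d : measure_display) (E : polishType R d).
Variables (P : R -> R.-pker E ~> E) (nu : R -> probability (measurableTypeR R) R).
Variables (K : R.-pker (E * measurableTypeR R)%type ~> E) (t : R).
Hypothesis KP : forall x s A, (0 <= s)%R -> measurable A -> K (x, s) A = P s x A.
Hypothesis nu_lt0 : nu t [set s | (s < 0)%R] = 0.

Let Q : R.-pker E ~> E := mixture K (nu t).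

Lemma nonneg_time_integral (g : measurableTypeR R -> \bar R) :
  measurable_fun [set: measurableTypeR R] g ->
  \int[nu t]_(s in `[0%R, +oo[) g s = \int[nu t]_s g s.
Proof.
move=> mg; rewrite integral_mkcond; apply: ae_eq_integral => //.
  apply/(measurable_restrictT _ _).1; first exact: measurable_itv.
  exact: measurable_funS mg.
have mneg : measurable ([set s | (s < 0)%R] : set (measurableTypeR R)).
  rewrite (_ : [set s | _] = `]-oo, 0%R[%classic); first exact: measurable_itv.
  by apply/seteqP; split => s; rewrite /= in_itv.
exists [set s | (s < 0)%R]; split => // s /= h; rewrite ltNge; apply/negP => s0.
by apply: h => _; rewrite patchE mem_set//= in_itv/= s0.
Qed.

Let semigroup_opE (f : E -> \bar R) x s : (0 <= s)%R ->
  semigroup_op P s f x = \int[K (x, s)]_y f y.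
Proof.
move=> s0; apply: eq_measure_integral => A mA _ /=.
by rewrite KP.
Qed.

Lemma ge0_subordinatedE x (f : E -> \bar R) : measurable_fun [set: E] f ->
  (forall y, 0 <= f y) -> subordinated P nu t f x = \int[Q x]_y f y.
Proof.
move=> mf f0; rewrite ge0_integral_mixture// -nonneg_time_integral; last first.
  apply: (@measurable_fun_integral_kernel _ _ _ _ _ (fun s => K (x, s))) => //.
  by move=> U mU; apply: measurableT_comp (measurable_kernel K _ mU) _.
apply: eq_integral => s; rewrite inE/= in_itv/= andbT => s0.
exact: semigroup_opE.
Qed.

Let mG (f : E -> \bar R) : measurable_fun [set: E] f ->
  measurable_fun [set: E * measurableTypeR R] (fun xs => \int[K xs]_y f y).
Proof.
move=> mf; under eq_fun do rewrite integralE.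
apply: emeasurable_funB.
- apply: (@measurable_fun_integral_kernel _ _ _ _ _ K) => //.
    by move=> U mU; exact: measurable_kernel.
  exact: measurable_funepos.
- apply: (@measurable_fun_integral_kernel _ _ _ _ _ K) => //.
    by move=> U mU; exact: measurable_kernel.
  exact: measurable_funeneg.
Qed.

Let subordinatedE x (f : E -> \bar R) : measurable_fun [set: E] f ->
  subordinated P nu t f x = \int[nu t]_s \int[K (x, s)]_y f y.
Proof.
move=> mf; rewrite -nonneg_time_integral; last first.
  exact: measurableT_comp (mG mf) _.
apply: eq_integral => s; rewrite inE/= in_itv/= andbT => s0.
exact: semigroup_opE.
Qed.

(** Test functions of the adjoint are only in [L^2] of [mu] and may fail to be integrable for
    [K (x, s)] at some points, so measurability is obtained for all [f] by separating positive and
    negative parts at both levels of integration. *)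
Lemma measurable_subordinated (f : E -> \bar R) : measurable_fun [set: E] f ->
  measurable_fun [set: E] (subordinated P nu t f).
Proof.
move=> mf; rewrite (_ : subordinated _ _ _ _ =
  (fun x => \int[nu t]_s \int[K (x, s)]_y f y)); last first.
  by apply/funext => x; exact: subordinatedE.
under eq_fun do rewrite integralE.
apply: emeasurable_funB.
- have := @measurable_fun_fubini_tonelli_F _ _ E (measurableTypeR R) R (nu t)
    (fun xs => \int[K xs]_y f y)^\+ (measurable_funepos (mG mf)) (@funepos_ge0 _ _ _).
  by apply: eq_measurable_fun => x _; apply: eq_integral => s _; rewrite !funeposE.
- have := @measurable_fun_fubini_tonelli_F _ _ E (measurableTypeR R) R (nu t)
    (fun xs => \int[K xs]_y f y)^\- (measurable_funeneg (mG mf)) (@funeneg_ge0 _ _ _).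
  by apply: eq_measurable_fun => x _; apply: eq_integral => s _; rewrite !funenegE.
Qed.

(** Integrability for the mixture gives both parts of [f] finite iterated integrals, so their
    difference may be integrated over time term by term. *)
Lemma integrable_subordinatedE x (f : E -> \bar R) :
  (Q x).-integrable [set: E] f -> subordinated P nu t f x = \int[Q x]_y f y.
Proof.
move=> intf; have mf := measurable_int _ intf.
have mfp : measurable_fun [set: E] f^\+ by exact: measurable_funepos.
have mfn : measurable_fun [set: E] f^\- by exact: measurable_funeneg.
rewrite subordinatedE// [RHS]integralE.
transitivity (\int[nu t]_s (\int[K (x, s)]_y f^\+ y - \int[K (x, s)]_y f^\- y)).
  by apply: eq_integral => s _; rewrite integralE.
have aux (g : E -> \bar R) : measurable_fun [set: E] g -> (forall y, 0 <= g y) ->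
    \int[Q x]_y g y < +oo ->
    (nu t).-integrable [set: measurableTypeR R] (fun s => \int[K (x, s)]_y g y).
  move=> mg g0; rewrite ge0_integral_mixture// => goo.
  apply/integrableP; split; first exact: measurableT_comp (mG mg) _.
  apply: le_lt_trans goo; rewrite le_eqVlt; apply/orP; left; apply/eqP.
  by apply: eq_integral => s _; rewrite gee0_abs// integral_ge0.
rewrite integralB//.
- by rewrite !ge0_integral_mixture.
- apply: aux => //.
  by have /integrableP[_] := integrable_funepos measurableT intf;
    under eq_integral do rewrite gee0_abs//.
- apply: aux => //.
  by have /integrableP[_] := integrable_funeneg measurableT intf;
    under eq_integral do rewrite gee0_abs//.
Qed.

End subordinated_semigroup.

(** * Images of finite measures under kernels *)

Section kernel_pushforward.
Context (R : realType) (d d' : measure_display) (X : measurableType d)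
  (Y : measurableType d').
Variables (m : {finite_measure set X -> \bar R}) (Q : R.-pker X ~> Y).

(** A measure seen as a kernel from the one-point space, so that its image under [Q] is a
    composition of kernels. *)
Definition const_kernel (x : unit) : {measure set X -> \bar R} := m.

Let measurable_const_kernel U : measurable U ->
  measurable_fun [set: unit] (const_kernel ^~ U).
Proof. by move=> mU; exact: measurable_cst. Qed.

HB.instance Definition _ :=
  isKernel.Build _ _ _ _ R const_kernel measurable_const_kernel.

Let const_kernel_uub : measure_fam_uub const_kernel.
Proof.
exists (fine (m setT) + 1)%R => x; rewrite /const_kernel EFinD fineK//.
  by rewrite lteDl// ?fin_num_measure// lte_fin.
exact: fin_num_measure.
Qed.

HB.instance Definition _ :=
  Kernel_isFinite.Build _ _ _ _ R const_kernel const_kernel_uub.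

Definition snd_kernel (ux : unit * X) : {measure set Y -> \bar R} := Q ux.2.

Let measurable_snd_kernel U : measurable U ->
  measurable_fun [set: unit * X] (snd_kernel ^~ U).
Proof. by move=> mU; apply: measurableT_comp (measurable_kernel Q _ mU) _. Qed.

HB.instance Definition _ :=
  isKernel.Build _ _ _ _ R snd_kernel measurable_snd_kernel.

Let snd_kernel_prob ux : snd_kernel ux [set: Y] = 1.
Proof. exact: prob_kernel. Qed.

HB.instance Definition _ :=
  Kernel_isProbability.Build _ _ _ _ R snd_kernel snd_kernel_prob.

Definition kernel_push : set Y -> \bar R := mkcomp const_kernel snd_kernel tt.

HB.instance Definition _ := Measure.on kernel_push.

Lemma kernel_pushE A : kernel_push A = \int[m]_x Q x A.
Proof. by []. Qed.

Let kernel_push_fin : fin_num_fun kernel_push.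
Proof.
move=> A mA; rewrite ge0_fin_numE//.
apply: (@le_lt_trans _ _ (kernel_push setT)).
  by apply: le_measure => //; rewrite inE.
rewrite kernel_pushE (eq_integral (cst 1)).
  by rewrite integral_cst// mul1e -ge0_fin_numE// fin_num_measure.
by move=> x _; exact: prob_kernel.
Qed.

HB.instance Definition _ :=
  @Measure_isFinite.Build _ _ R kernel_push kernel_push_fin.

Lemma ge0_integral_kernel_push (f : Y -> \bar R) : measurable_fun [set: Y] f ->
  (forall y, 0 <= f y) -> \int[kernel_push]_y f y = \int[m]_x \int[Q x]_y f y.
Proof. by move=> mf f0; rewrite /kernel_push /= integral_kcomp. Qed.

End kernel_pushforward.

(** * Measures given by a density *)

Section density_measure.
Context (R : realType) (d : measure_display) (X : measurableType d).
Variables (mu : probability X R) (f : X -> R).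
Hypotheses (f0 : forall x, (0 <= f x)%R)
  (intf : mu.-integrable [set: X] (EFin \o f)).

(** The two proofs are arguments so that the measure structure built from them can be recovered from
    the term. *)
Definition density_measure (_ : forall x, (0 <= f x)%R)
    (_ : mu.-integrable [set: X] (EFin \o f)) : set X -> \bar R :=
  with_density f mu.

Let mf : measurable_fun [set: X] f.
Proof. by apply/measurable_EFinP; exact: measurable_int intf. Qed.

Let density_measure0 : density_measure f0 intf set0 = 0.
Proof. by rewrite /density_measure /with_density integral_set0. Qed.

Let density_measure_ge0 A : 0 <= density_measure f0 intf A.
Proof. by apply: integral_ge0 => x _; rewrite lee_fin. Qed.

Let density_measure_sigma_additive : semi_sigma_additive (density_measure f0 intf).
Proof.
apply: semi_sigma_additive_nng_induced; first exact/measurable_EFinP.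
by move=> x; rewrite lee_fin.
Qed.

HB.instance Definition _ := isMeasure.Build d X R (density_measure f0 intf)
  density_measure0 density_measure_ge0 density_measure_sigma_additive.

Let density_measure_fin : fin_num_fun (density_measure f0 intf).
Proof.
move=> A mA; rewrite /density_measure /with_density.
apply: integrable_fin_num => //.
exact: integrableS intf.
Qed.

HB.instance Definition _ :=
  @Measure_isFinite.Build d X R (density_measure f0 intf) density_measure_fin.

Lemma density_measure_dominates : density_measure f0 intf `<< mu.
Proof.
apply/null_content_dominatesP => A mA muA; rewrite /density_measure /with_density.
rewrite -[RHS](@integral_abs_eq0 _ _ _ mu A (EFin \o f))//.
  by apply: eq_integral => x _; rewrite gee0_abs// lee_fin.
by apply: measurable_funTS; apply/measurable_EFinP.
Qed.

(** Change of variables holds for the Radon-Nikodym derivative, and this derivative coincides with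
    [f] almost everywhere because both have the same integrals over measurable sets. *)
Lemma ge0_integral_density (h : X -> \bar R) : measurable_fun [set: X] h ->
  (forall x, 0 <= h x) ->
  \int[density_measure f0 intf]_x h x = \int[mu]_x ((f x)%:E * h x).
Proof.
move=> mh h0.
have dom := density_measure_dominates.
rewrite -(Radon_Nikodym_SigmaFinite.change_of_variables dom)//.
have intr := Radon_Nikodym_SigmaFinite.f_integrable dom.
apply: ae_eq_integral => //.
- by apply: emeasurable_funM => //; exact: measurable_int intr.
- by apply: emeasurable_funM => //; apply/measurable_EFinP.
have ae : ae_eq mu setT (Radon_Nikodym_SigmaFinite.f (density_measure f0 intf) mu) (EFin \o f).
  apply: integral_ae_eq => //; first exact/measurable_EFinP.
  by move=> A _ mA; rewrite -(Radon_Nikodym_SigmaFinite.f_integral dom).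
by apply: filterS ae => x /(_ Logic.I) -> _; rewrite muleC.
Qed.

End density_measure.

(** * Invariance, absolute continuity and log-Harnack inequality for the subordinated kernel *)

Section subordinated_log_Harnack.
Context (R : realType) (d : measure_display) (E : polishType R d).
Variables (P : R -> R.-pker E ~> E) (nu : R -> probability (measurableTypeR R) R).
Variables (K : R.-pker (E * measurableTypeR R)%type ~> E) (t : R).
Hypothesis KP : forall x s A, (0 <= s)%R -> measurable A -> K (x, s) A = P s x A.
Hypothesis nu_lt0 : nu t [set s | (s < 0)%R] = 0.
Hypothesis P_time : measurable_in_time P.

Local Notation Q := (mixture K (nu t)).

Lemma mixture_invariant (mu : probability E R) : invariant_measure P mu ->
  forall A, measurable A -> \int[mu]_x Q x A = mu A.
Proof.
move=> mu_inv A mA.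
have mK : measurable_fun [set: E * measurableTypeR R] (fun xs => K xs A).
  exact: measurable_kernel.
rewrite /mixture /= /kcomp.
rewrite (@fubini_tonelli _ _ E (measurableTypeR R) R mu (nu t) (fun xs => K xs A))//.
rewrite -(@nonneg_time_integral R nu t); [|exact: nu_lt0|]; last first.
  exact: (@measurable_fun_fubini_tonelli_G _ _ E (measurableTypeR R) R mu
    (fun xs => K xs A)).
transitivity (\int[nu t]_(s in `[0%R, +oo[) mu A).
  apply: eq_integral => s; rewrite inE/= in_itv/= andbT => s0.
  rewrite -(mu_inv s s0 A mA); apply: eq_integral => x _.
  by rewrite KP.
rewrite nonneg_time_integral//.
by rewrite integral_cst// [X in _ * X]probability_setT mule1.
Qed.

(** Absolute continuity is known at positive times; at time [0] the kernel is a point mass, but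
    [nu t] does not charge the times [s <= 0]. *)
Lemma mixture_null_dominates (mu : probability E R) :
  nu t `]-oo, 0%R]%classic = 0 ->
  (forall s : R, (0 < s)%R -> forall x, kernel_at (P s) x `<< mu) ->
  forall x, kernel_at Q x `<< mu.
Proof.
move=> nu_le0 Pmu x; apply/null_content_dominatesP => A mA muA.
pose N : set (measurableTypeR R) := `]-oo, 0%R]%classic.
have mN : measurable N by exact: measurable_itv.
rewrite /kernel_at /mixture /= /kcomp.
have mK : measurable_fun [set: measurableTypeR R] (fun s => K (x, s) A).
  by apply: measurableT_comp (measurable_kernel K _ mA) _.
rewrite (@ge0_negligible_integral _ _ _ (nu t) _ N)//.
apply: integral0_eq => s [_]; rewrite /N/= in_itv/= => /negP; rewrite -ltNge => s0.
rewrite KP ?ltW//.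
by have /null_content_dominatesP := Pmu s s0 x; exact.
Qed.

Lemma bounded_measurable_integrable (m : probability E R) (f : E -> R) :
  bounded_measurable f -> m.-integrable [set: E] (EFin \o f).
Proof.
move=> [mf bf]; apply: measurable_bounded_integrable => //.
by rewrite -ge0_fin_numE// fin_num_measure.
Qed.

Lemma bounded_measurable_ln (f : E -> R) : bounded_measurable f ->
  (forall z, (1 <= f z)%R) -> bounded_measurable (fun z => ln (f z)).
Proof.
move=> [mf [M [Mr bf]]] f1; split; first exact: measurableT_comp.
exists (`|M| + 1)%R; split; first exact: num_real.
move=> r Mr1 z _ /=; have fz : (f z <= r)%R.
  rewrite (le_trans (ler_norm _))//; apply: (bf r) => //.
  by rewrite (le_lt_trans (ler_norm _))// (lt_trans _ Mr1)// ltrDl.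
rewrite ger0_norm ?ln_ge0//; apply: le_trans fz.
by apply/ltW/ln_sublinear; exact: lt_le_trans (f1 z).
Qed.

(** The tangent to [ln] is taken at [B], the integral of [f] for [Q y]: in
    [ln b <= ln B + b / B - 1] the value [b s] has mean [B] under [nu t], so the correction
    integrates to [0]. *)
Lemma mixture_log_Harnack (H : E * E -> R) (eps kappa alpha : R) :
  log_Harnack P H eps kappa -> (forall xy, (0 <= H xy)%R) -> (0 <= eps)%R ->
  nu t `]-oo, 0%R]%classic = 0 ->
  \int[nu t]_(s in `]0%R, +oo[) (s `^ (- kappa))%:E =
    (Gamma (kappa / alpha) / (alpha * t `^ (kappa / alpha) * Gamma kappa))%:E ->
  forall x y f, bounded_measurable f -> (forall z, (1 <= f z)%R) ->
  (\int[kernel_at Q x]_z ln (f z) <=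
   ln (\int[kernel_at Q y]_z f z) + H (x, y) * rate eps kappa alpha t)%R.
Proof.
move=> LH H0 eps0 nu_le0 moment x y f bf f1.
have [mf _] := bf; have blf := bounded_measurable_ln bf f1; have [mlf _] := blf.
have D1 : nu t `]0%R, +oo[%classic = 1.
  have := @probability_setC _ _ _ (nu t) `]-oo, 0%R]%classic (measurable_itv _).
  by rewrite nu_le0 sube0 setCitvl.
set h := H (x, y); have h0 : (0 <= h)%R by exact: H0.
pose a s := semigroup_op P s (EFin \o (fun z => ln (f z))) x.
pose b s := semigroup_op P s (EFin \o f) y.
have ma : measurable_fun (`]0%R, +oo[ : set (measurableTypeR R)) a.
  by apply: measurable_funS (P_time blf x) => //; apply: subset_itvr; rewrite bnd_simp.
have mb : measurable_fun (`]0%R, +oo[ : set (measurableTypeR R)) b.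
  by apply: measurable_funS (P_time bf y) => //; apply: subset_itvr; rewrite bnd_simp.
have a0 s : 0 <= a s.
  by apply: integral_ge0 => z _; rewrite lee_fin ln_ge0.
have b1 s : 1 <= b s.
  rewrite -(@prob_kernel _ _ _ _ _ (P s) y) -[leLHS]mul1e -integral_cst//.
  apply: ge0_le_integral => //; first exact/measurable_EFinP.
  by move=> z _; rewrite lee_fin.
have bfin s : b s \is a fin_num.
  apply: (@integrable_fin_num _ _ _ (kernel_at (P s) y)) => //.
  exact: bounded_measurable_integrable.
pose B := (\int[kernel_at Q y]_z f z)%R.
have BE : B%:E = \int[Q y]_z (f z)%:E.
  rewrite /B /Rintegral fineK//.
  apply: (@integrable_fin_num _ _ _ (kernel_at Q y)) => //.
  exact: bounded_measurable_integrable.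
have AE : (\int[kernel_at Q x]_z ln (f z))%R%:E = \int[Q x]_z (ln (f z))%:E.
  rewrite /Rintegral fineK//.
  apply: (@integrable_fin_num _ _ _ (kernel_at Q x)) => //.
  exact: bounded_measurable_integrable.
pose N : set (measurableTypeR R) := `]-oo, 0%R]%classic.
have mN : measurable N by exact: measurable_itv.
have toD (g : measurableTypeR R -> \bar R) :
    measurable_fun (`[0%R, +oo[ : set (measurableTypeR R)) g -> (forall s, 0 <= g s) ->
    \int[nu t]_(s in `[0%R, +oo[) g s = \int[nu t]_(s in `]0%R, +oo[) g s.
  move=> mg g0; rewrite (@ge0_negligible_integral _ _ _ (nu t) _ N)//.
    congr integral; apply/seteqP; split => s /=; rewrite !in_itv/= !andbT.
      by move=> [_ /negP]; rewrite -ltNge.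
    by move=> s0; split; [exact: ltW|apply/negP; rewrite -ltNge].
have Ea : \int[Q x]_z (ln (f z))%:E = \int[nu t]_(s in `]0%R, +oo[) a s.
  rewrite -(ge0_subordinatedE KP nu_lt0)//; last 2 first.
  - exact/measurable_EFinP.
  - by move=> z; rewrite lee_fin ln_ge0.
  by rewrite /subordinated -toD//; exact: P_time.
have Eb : \int[Q y]_z (f z)%:E = \int[nu t]_(s in `]0%R, +oo[) b s.
  rewrite -(ge0_subordinatedE KP nu_lt0)//; last 2 first.
  - exact/measurable_EFinP.
  - by move=> z; rewrite lee_fin (le_trans _ (f1 z)).
  rewrite /subordinated -toD//; first exact: P_time.
  by move=> s; rewrite (le_trans _ (b1 s)).
have B1 : (1 <= B)%R.
  rewrite -lee_fin BE -(@prob_kernel _ _ _ _ _ Q y) -[leLHS]mul1e -integral_cst//.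
  apply: ge0_le_integral => //; first exact/measurable_EFinP.
  by move=> z _; rewrite lee_fin.
have B0 : (0 < B)%R by exact: lt_le_trans B1.
have lnB0 : (0 <= ln B)%R by exact: ln_ge0.
(* The [1] of the tangent is moved to the left so that all integrands are nonnegative and their
   integrals add up without integrability conditions. *)
have ptw s : (0 < s)%R -> a s + 1 <= (ln B + h * eps)%:E +
    ((B^-1)%:E * b s + h%:E * (s `^ (- kappa))%:E).
  move=> s0.
  have := LH x y s s0 f bf f1; rewrite -/(b s) -/h => LHs.
  have bs0 : (0 < fine (b s))%R.
    by rewrite fine_gt0// (lt_le_trans _ (b1 s))//= -ge0_fin_numE// (le_trans _ (b1 s)).
  have lnb : (ln (fine (b s)) <= ln B + fine (b s) / B - 1)%R.
    have -> : (ln (fine (b s)) = ln B + ln (1 + (fine (b s) / B - 1)))%R.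
      by rewrite addrCA subrr addr0 ln_div ?posrE// addrC subrK.
    rewrite -addrA lerD2l le_ln1Dx//.
    by rewrite -[ltLHS]add0r ltrD2r divr_gt0.
  apply: (@le_trans _ _ ((ln (fine (b s)) + h * (eps + s `^ (- kappa)))%R%:E + 1)).
    rewrite leeD2r// (le_trans LHs)// EFinD leeD2r//.
    by rewrite -[in leLHS](fineK (bfin s)) lne_EFin.
  rewrite -(fineK (bfin s)) -!EFinM -!EFinD lee_fin.
  by move: lnb; rewrite mulrDr [(B^-1 * _)%R]mulrC; lra.
have step : \int[nu t]_(s in `]0%R, +oo[) (a s + 1) <=
   \int[nu t]_(s in `]0%R, +oo[) ((ln B + h * eps)%:E +
    ((B^-1)%:E * b s + h%:E * (s `^ (- kappa))%:E)).
  have mpow : measurable_fun (`]0%R, +oo[ : set (measurableTypeR R))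
      (fun s : R => (s `^ (- kappa))%:E).
    by apply: measurable_funTS; apply/measurable_EFinP; exact: measurable_powR.
  apply: ge0_le_integral => //.
  - by move=> s _; rewrite adde_ge0.
  - by apply: emeasurable_funD.
  - apply: emeasurable_funD => //; apply: emeasurable_funD; exact: measurable_funeM.
  - by move=> s; rewrite /= in_itv/= andbT; exact: ptw.
have mpow : measurable_fun (`]0%R, +oo[ : set (measurableTypeR R))
    (fun s : R => (s `^ (- kappa))%:E).
  by apply: measurable_funTS; apply/measurable_EFinP; exact: measurable_powR.
have b0 s : 0 <= b s by rewrite (le_trans _ (b1 s)).
have Bi0 : (0 <= B^-1)%R by rewrite invr_ge0 ltW.
clearbody a b.
move: step; rewrite ge0_integralD// integral_cst// [X in 1 * X]D1 mule1.
rewrite ge0_integralD; [|exact: measurable_itv|..]; last 4 first.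
- by move=> s _; rewrite lee_fin addr_ge0// mulr_ge0.
- exact: measurable_cst.
- by move=> s _; rewrite adde_ge0// mule_ge0 ?lee_fin// powR_ge0.
- by apply: emeasurable_funD; exact: measurable_funeM.
rewrite integral_cst// [X in _ * X + _]D1 mule1.
rewrite ge0_integralD; [|exact: measurable_itv|..]; last 4 first.
- by move=> s _; rewrite mule_ge0.
- exact: measurable_funeM.
- by move=> s _; rewrite mule_ge0 ?lee_fin// powR_ge0.
- exact: measurable_funeM.
have -> : \int[nu t]_(s in `]0%R, +oo[) ((B^-1)%:E * b s) = (B^-1)%:E * B%:E.
  by rewrite BE Eb ge0_integralZl.
have -> : \int[nu t]_(s in `]0%R, +oo[) (h%:E * (s `^ (- kappa))%:E) =
    h%:E * \int[nu t]_(s in `]0%R, +oo[) (s `^ (- kappa))%:E.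
  by rewrite ge0_integralZl// => s _; rewrite lee_fin powR_ge0.
rewrite moment -Ea -AE -!EFinM mulVf ?gt_eqF// -!EFinD lee_fin /rate -/h -/B.
rewrite mulrDr -/B.
move=> h'; rewrite -(lerD2r 1%R); apply: (le_trans h').
by rewrite [(1 + _)%R]addrC !addrA.
Qed.

End subordinated_log_Harnack.

(** * Entropy *)

Section entropy_bound.
Context (R : realType) (d : measure_display) (X : measurableType d).

(** [f] may fail to be integrable, so positive and negative parts are compared separately. *)
Lemma le_integral_integrable (m : {measure set X -> \bar R}) (f g : X -> \bar R) :
  measurable_fun [set: X] f -> m.-integrable [set: X] g ->
  (forall x, f x <= g x) -> \int[m]_x f x <= \int[m]_x g x.
Proof.
move=> mf ig fg; have mg := measurable_int _ ig.
rewrite [leLHS]integralE [leRHS]integralE; apply: leeB.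
- apply: ge0_le_integral => //; [exact: measurable_funepos..|].
  by move=> x _; apply: (@funepos_le _ _ setT) => //; rewrite inE.
- apply: ge0_le_integral => //; [exact: measurable_funeneg..|].
  by move=> x _; apply: (@funeneg_le _ _ setT) => //; rewrite inE.
Qed.

(* A Donsker--Varadhan type bound for the test functions [min(r, n) + delta]
   passes to the limit [n -> oo] by monotone convergence, then to [delta -> 0]. *)
Lemma entropy_le (m : probability X R) (p r : X -> R) (C : R) :
  measurable_fun [set: X] p -> measurable_fun [set: X] r ->
  (forall x, 0 <= p x)%R -> (forall x, 0 <= r x)%R ->
  (forall x, r x = 0 -> p x = 0)%R ->
  \int[m]_x (p x)%:E = 1 ->
  (forall (n : nat) (delta : R), (0 < delta)%R ->
    \int[m]_x (p x * ln (Num.min (r x) n%:R + delta))%:E <=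
    (ln (1 + delta) + C)%:E) ->
  \int[m]_x (p x * ln (r x))%:E <= C%:E.
Proof.
(* The tolerance [e] doubles as the shift [delta]; at the end [ln (1 + e) <= e] absorbs it. *)
move=> mp mr p0 r0 pr p1 hyp; apply/lee_addgt0Pr => e e0.
have me0 n x : (0 < Num.min (r x) n%:R + e)%R.
  by rewrite ltr_wpDl// le_min r0 ler0n.
have intp : m.-integrable [set: X] (EFin \o p).
  apply/integrableP; split; first exact/measurable_EFinP.
  under eq_integral do rewrite /= ger0_norm//.
  by rewrite p1 ltry.
have intpe : m.-integrable [set: X] (fun x => (p x * ln e)%:E).
  under eq_fun do rewrite mulrC EFinM.
  exact: integrableZl.
have intpeE : \int[m]_x (p x * ln e)%:E = (ln e)%:E.
  under eq_integral do rewrite mulrC EFinM.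
  by rewrite integralZl//= p1 mule1.
have mln n : measurable_fun [set: X] (fun x => ln (Num.min (r x) n%:R + e))%R.
  apply: measurableT_comp => //; apply: measurable_funD => //.
  exact: measurable_minr.
have mlr : measurable_fun [set: X] (fun x => ln (r x + e))%R.
  by apply: measurableT_comp => //; exact: measurable_funD.
(* Since [min (r, n) + e >= e], subtracting [ln e] makes the integrands nonnegative, and they
   increase with [n]; [p] having mass [1], the subtraction costs exactly [ln e]. *)
pose w n x := (p x * (ln (Num.min (r x) n%:R + e) - ln e))%:E.
pose w' x := (p x * (ln (r x + e) - ln e))%:E.
have mw n : measurable_fun [set: X] (w n).
  by apply/measurable_EFinP; apply: measurable_funM => //; exact: measurable_funB.
have mw' : measurable_fun [set: X] w'.
  by apply/measurable_EFinP; apply: measurable_funM => //; exact: measurable_funB.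
have w0 n x : 0 <= w n x.
  rewrite lee_fin mulr_ge0// subr_ge0 ler_ln ?posrE//.
  by rewrite lerDr le_min r0 ler0n.
have w'0 x : 0 <= w' x.
  rewrite lee_fin mulr_ge0// subr_ge0 ler_ln ?posrE//; first by rewrite lerDr.
  by rewrite ltr_wpDl.
have intpn n : m.-integrable [set: X] (fun x => (p x * ln (Num.min (r x) n%:R + e))%:E).
  apply: (@le_integrable _ _ _ m setT measurableT _
    (fun x => (p x * (`|ln e| + `|ln (n%:R + e)|))%:E)).
  - by apply/measurable_EFinP; exact: measurable_funM.
  - move=> x _ /=; rewrite lee_fin !normrM ler_wpM2l// [leRHS]ger0_norm ?addr_ge0//.
    have h1 : (ln e <= ln (Num.min (r x) n%:R + e))%R.
      by rewrite ler_ln ?posrE// lerDr le_min r0 ler0n.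
    have h2 : (ln (Num.min (r x) n%:R + e) <= ln (n%:R + e))%R.
      rewrite ler_ln ?posrE//; first by rewrite lerD2r ge_min lexx orbT.
      by rewrite ltr_wpDl.
    rewrite ler_norml; apply/andP; split.
      by rewrite (le_trans _ h1)// lerNl (le_trans (ler_norm _))// normrN lerDl.
    by rewrite (le_trans h2)// (le_trans (ler_norm _))// lerDr.
  - under eq_fun do rewrite mulrC EFinM.
    exact: integrableZl.
have wE n : \int[m]_x w n x <= (ln (1 + e) + C - ln e)%:E.
  rewrite /w; under eq_integral do rewrite mulrBr EFinB.
  rewrite integralB//= intpeE EFinB leeD2r//.
  exact: hyp.
have w'E : \int[m]_x w' x <= (ln (1 + e) + C - ln e)%:E.
  have wcvg x : w n x @[n --> \oo] --> w' x.
    apply: cvg_near_cst.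
    have [N _ hN] : \forall n \near \oo, (r x <= n%:R)%R by exact: nbhs_infty_ger.
    exists N => // n /hN /= rn.
    by rewrite /w /w' min_l.
  rewrite (_ : \int[m]_x w' x = limn (fun n => \int[m]_x w n x)).
    apply: lime_le; last by apply: nearW => n; exact: wE.
    apply: ereal_nondecreasing_is_cvgn => a b ab; apply: ge0_le_integral => //.
    move=> x _; rewrite lee_fin ler_wpM2l// lerD2r ler_ln ?posrE// lerD2r.
    by rewrite le_min !ge_min lexx/= ler_nat ab orbT.
  rewrite -monotone_convergence//; last first.
    move=> x _ a b ab; rewrite lee_fin ler_wpM2l// lerD2r ler_ln ?posrE// lerD2r.
    by rewrite le_min !ge_min lexx/= ler_nat ab orbT.
  by apply: eq_integral => x _; apply/esym/cvg_lim => //; exact: wcvg.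
have intw' : m.-integrable [set: X] w'.
  apply/integrableP; split => //.
  under eq_integral do rewrite gee0_abs//.
  by rewrite (le_lt_trans w'E)// ltry.
have split_ln x : (p x * ln (r x + e))%:E = w' x + (p x * ln e)%:E.
  by rewrite /w' -EFinD mulrBr subrK.
have intr : m.-integrable [set: X] (fun x => (p x * ln (r x + e))%:E).
  by under eq_fun do rewrite split_ln; exact: integrableD.
apply: (@le_trans _ _ (\int[m]_x (p x * ln (r x + e))%:E)).
  apply: le_integral_integrable => //.
    apply/measurable_EFinP; apply: measurable_funM => //.
    exact: measurableT_comp.
  (* Where [r] vanishes, [ln (r x)] has the default value [0], which exceeds [ln e] for [e < 1];
     there [p] vanishes as well. *)
  move=> x; rewrite lee_fin; have [rx|rx] := eqVneq (r x) 0%R.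
    by rewrite (pr x rx) !mul0r.
  rewrite ler_wpM2l// ler_ln ?posrE ?lerDl ?ltW//.
    by rewrite lt_neqAle eq_sym rx r0.
  by rewrite ltr_wpDl.
under eq_integral do rewrite split_ln.
rewrite integralD// intpeE.
apply: (le_trans (leeD2r _ w'E)) => //.
rewrite -!EFinD subrK lee_fin [leRHS]addrC lerD2r.
by rewrite le_ln1Dx// (lt_trans _ e0)// oppr_lt0.
Qed.

End entropy_bound.

(** * Regularity of log-Harnack kernels *)

Lemma Rintegral_probability_cst (R : realType) (d : measure_display)
    (T : measurableType d) (m : probability T R) (k : R) : (\int[m]_x k = k)%R.
Proof.
rewrite Rintegral_cst// -[RHS]mulr1; congr (_ * _)%R.
exact: (congr1 fine (probability_setT m)).
Qed.

Section kernel_log_Harnack.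
Context (R : realType) (d : measure_display) (E : polishType R d).
Variables (Q : R.-pker E ~> E) (H : E * E -> R) (c : R).
Hypothesis H0 : forall xy, (0 <= H xy)%R.
Hypothesis c0 : (0 <= c)%R.
Hypothesis LH : forall x y f, bounded_measurable f -> (forall z, 1 <= f z)%R ->
  (\int[kernel_at Q x]_z ln (f z) <=
   ln (\int[kernel_at Q y]_z f z) + H (x, y) * c)%R.

Lemma bounded_measurable_itv (f : E -> R) (a b : R) : measurable_fun [set: E] f ->
  (forall z, a <= f z <= b)%R -> bounded_measurable f.
Proof.
move=> mf fab; split => //; exists (`|a| + `|b|)%R; split; first exact: num_real.
move=> r r1 z _ /=; apply/(le_trans _ (ltW r1)).
have /andP[fa fb] := fab z; rewrite ler_norml; apply/andP; split.
  rewrite (le_trans _ fa)// lerNl (le_trans (ler_norm _))// normrN lerDl.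
  exact: normr_ge0.
by rewrite (le_trans fb)// (le_trans (ler_norm _))// lerDr.
Qed.

Lemma Rintegral_itv (m : probability E R) (f : E -> R) (a b : R) :
  measurable_fun [set: E] f -> (forall z, a <= f z <= b)%R ->
  (a <= \int[m]_z f z <= b)%R.
Proof.
move=> mf fab; have If := bounded_measurable_integrable m (bounded_measurable_itv mf fab).
have Icst (k : R) : m.-integrable [set: E] (EFin \o (fun _ : E => k)).
  apply: bounded_measurable_integrable.
  by apply: (@bounded_measurable_itv _ k k) => // z; rewrite lexx.
apply/andP; split.
  rewrite -[leLHS](Rintegral_probability_cst m); apply: le_Rintegral => //.
  by move=> z _; have /andP[] := fab z.
rewrite -[leRHS](Rintegral_probability_cst m); apply: le_Rintegral => //.
by move=> z _; have /andP[] := fab z.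
Qed.

(** Dividing [f] by its lower bound [delta] makes it at least [1] and shifts both sides by
    [ln delta]. *)
Lemma log_Harnack_pos x y f (delta M : R) : measurable_fun [set: E] f ->
  (0 < delta)%R -> (forall z, delta <= f z <= M)%R ->
  (\int[kernel_at Q x]_z ln (f z) <=
   ln (\int[kernel_at Q y]_z f z) + H (x, y) * c)%R.
Proof.
move=> mf d0 fdM.
have bf : bounded_measurable f := bounded_measurable_itv mf fdM.
pose g z := (delta^-1 * f z)%R.
have mg : measurable_fun [set: E] g by exact: measurable_funM.
have g1M z : (1 <= g z <= M / delta)%R.
  have /andP[f1 f2] := fdM z; rewrite /g mulrC.
  by rewrite ler_pdivlMr// mul1r f1 ler_pM2r ?invr_gt0.
have bg : bounded_measurable g := bounded_measurable_itv mg g1M.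
have g1 z : (1 <= g z)%R by have /andP[] := g1M z.
have := LH x y bg g1.
have fz0 z : (0 < f z)%R by have /andP[f1 _] := fdM z; exact: lt_le_trans f1.
have lnE : (\int[kernel_at Q x]_z ln (g z) =
            \int[kernel_at Q x]_z ln (f z) - ln delta)%R.
  rewrite -[X in (_ - X)%R](Rintegral_probability_cst (kernel_at Q x)).
  rewrite -RintegralB//; first last.
  - apply: bounded_measurable_integrable.
    by apply: (@bounded_measurable_itv _ (ln delta) (ln delta)) => // z; rewrite lexx.
  - apply: bounded_measurable_integrable.
    apply: (@bounded_measurable_itv _ (ln delta) (ln M)); first exact: measurableT_comp.
    move=> z; have /andP[f1 f2] := fdM z.
    by rewrite !ler_ln ?posrE ?f1 ?f2// (lt_le_trans _ f2).
  apply: eq_Rintegral => z _; rewrite /g lnM ?posrE ?invr_gt0// lnV ?posrE//.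
  by rewrite addrC.
have IE : (\int[kernel_at Q y]_z g z = delta^-1 * \int[kernel_at Q y]_z f z)%R.
  rewrite RintegralZl//; exact: bounded_measurable_integrable.
have I0 : (0 < \int[kernel_at Q y]_z f z)%R.
  by have /andP[h _] := Rintegral_itv (kernel_at Q y) mf fdM; exact: lt_le_trans h.
by rewrite lnE IE lnM ?posrE ?invr_gt0// lnV ?posrE// addrC -addrA lerD2l.
Qed.

(** From [ln v <= v - 1] at [v = 1 / (1 + u)] comes [ln (1 + u) >= u / (1 + u)], and
    [(u - u^2) (1 + u) = u - u^3 <= u]. *)
Lemma ln1D_ge (u : R) : (0 <= u)%R -> (u - u ^+ 2 <= ln (1 + u))%R.
Proof.
move=> u0; have u1 : (0 < 1 + u)%R by rewrite ltr_wpDr.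
have : (ln (1 + (- u / (1 + u))) <= - u / (1 + u))%R.
  by rewrite le_ln1Dx// ltr_pdivlMr// mulN1r ltrN2 ltrDr.
have -> : (1 + (- u / (1 + u)) = (1 + u)^-1)%R.
  by field; rewrite gt_eqF.
rewrite lnV ?posrE// mulNr lerN2 => /(le_trans _); apply.
rewrite ler_pdivlMr//.
have : (0 <= u ^+ 3)%R by exact: exprn_ge0.
by rewrite (_ : (u - u ^+ 2) * (1 + u) = u - u ^+ 3)%R; [lra|ring].
Qed.

(** On the left [ln (1 + e f) >= e f - e^2], on the right [ln (1 + e m) <= e m] for the mean [m] of
    [f]; division by [e] leaves the error [e] beside the Harnack term. The parameter [e] stays free,
    to be balanced against [H (x, y)]. *)
Lemma kernel_oscillation x y (f : E -> R) (e : R) : measurable_fun [set: E] f ->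
  (forall z, 0 <= f z <= 1)%R -> (0 < e)%R ->
  (\int[kernel_at Q x]_z f z - \int[kernel_at Q y]_z f z <= e + H (x, y) * c / e)%R.
Proof.
move=> mf f01 e0.
have ef0 z : (0 <= e * f z)%R by have /andP[? _] := f01 z; rewrite mulr_ge0// ltW.
have ef1 z : (e * f z <= e)%R by have /andP[_ ?] := f01 z; rewrite ler_piMr// ltW.
have bf : bounded_measurable f := bounded_measurable_itv mf f01.
have mef : measurable_fun [set: E] (fun z => 1 + e * f z)%R.
  by apply: measurable_funD => //; exact: measurable_funM.
have bound z : (1 <= 1 + e * f z <= 1 + e)%R by rewrite lerDl ef0 lerD2l ef1.
have := log_Harnack_pos x y mef ltr01 bound.
have If w : (kernel_at Q w).-integrable [set: E] (EFin \o f).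
  exact: bounded_measurable_integrable.
have cst1 w (k : R) : (\int[kernel_at Q w]_z k = k)%R.
  exact: Rintegral_probability_cst.
have Icst w (k : R) : (kernel_at Q w).-integrable [set: E] (EFin \o (fun _ : E => k)).
  apply: bounded_measurable_integrable.
  by apply: (@bounded_measurable_itv _ k k) => // z; rewrite lexx.
have Ief w : (kernel_at Q w).-integrable [set: E] (EFin \o (fun z => e * f z)%R).
  apply: bounded_measurable_integrable.
  apply: (@bounded_measurable_itv _ 0%R e); first exact: measurable_funM.
  by move=> z; rewrite ef0 ef1.
have -> : (\int[kernel_at Q y]_z (1 + e * f z) = 1 + e * \int[kernel_at Q y]_z f z)%R.
  rewrite RintegralD; [|by []|exact: Icst|exact: Ief].
  by rewrite cst1 RintegralZl//; exact: If.
have lower : (e * \int[kernel_at Q x]_z f z - e ^+ 2 <=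
    \int[kernel_at Q x]_z ln (1 + e * f z))%R.
  have -> : (e * \int[kernel_at Q x]_z f z - e ^+ 2 =
      \int[kernel_at Q x]_z (e * f z - e ^+ 2))%R.
    rewrite RintegralB; [|by []|exact: Ief|exact: Icst].
    rewrite RintegralZl; [|by []|exact: If].
    by rewrite cst1.
  apply: le_Rintegral => //.
  - apply: bounded_measurable_integrable.
    apply: (@bounded_measurable_itv _ (- e ^+ 2)%R e).
      by apply: measurable_funB => //; exact: measurable_funM.
    move=> z; rewrite lerBrDr addNr ef0/= lerBlDr (le_trans (ef1 z))// lerDl.
    exact: sqr_ge0.
  - apply: bounded_measurable_integrable.
    apply: (@bounded_measurable_itv _ 0%R (ln (1 + e))); first exact: measurableT_comp.
    move=> z; rewrite ln_ge0/= ?lerDl// ler_ln ?posrE ?lerD2l//.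
      by rewrite ltr_wpDr.
    by rewrite ltr_wpDr// ltW.
  - move=> z _; apply: le_trans (ln1D_ge (ef0 z)).
    by rewrite lerD2l lerN2 ler_pXn2r ?nnegrE// ltW.
have I0 : (0 <= e * \int[kernel_at Q y]_z f z)%R.
  apply: mulr_ge0; first exact: ltW.
  by apply: Rintegral_ge0 => z _; have /andP[] := f01 z.
have upper : (ln (1 + e * \int[kernel_at Q y]_z f z) <= e * \int[kernel_at Q y]_z f z)%R.
  by rewrite le_ln1Dx// (lt_le_trans _ I0)// ltrN10.
move=> main; have := le_trans lower (le_trans main (lerD upper (lexx _))).
rewrite lerBlDr => main'.
rewrite -(ler_pM2l e0) mulrBr mulrDr -expr2 mulrCA divff ?gt_eqF// mulr1.
by rewrite lerBlDr (le_trans main')// -addrA addrC [(H _ * _ + _)%R]addrC.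
Qed.

(** The oscillation bound is one-sided, and [H] is known to be small only with [x] as first
    argument; applied to [(M + f) / (2 M)] and to [(M - f) / (2 M)], it bounds the difference from
    both sides without exchanging [x] and [y]. *)
Lemma kernel_continuous (f : E -> R) : (forall x : E, H (x, y) @[y --> x^'] --> (0 : R)%R) ->
  bounded_measurable f -> continuous (fun x => \int[kernel_at Q x]_z f z)%R.
Proof.
move=> Hcvg bf x; have [mf [M0 [M0r hM0]]] := bf.
pose M := (`|M0| + 1)%R; have M_gt0 : (0 < M)%R by rewrite ltr_wpDl.
have fM z : (`|f z| <= M)%R.
  by apply: (hM0 M) => //; rewrite (le_lt_trans (ler_norm _))// ltrDl.
have M2 : (0 < 2 * M)%R by rewrite mulr_gt0.
pose u (s : bool) z := ((M + (-1) ^+ s * f z) / (2 * M))%R.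
have mu_ s : measurable_fun [set: E] (u s).
  by apply: measurable_funM => //; apply: measurable_funD => //; exact: measurable_funM.
have u01 s z : (0 <= u s z <= 1)%R.
  have : (`|(-1) ^+ s * f z| <= M)%R by rewrite normrMsign.
  rewrite ler_norml => /andP[h1 h2]; apply/andP; split.
    by apply: divr_ge0; [rewrite -lerBlDl sub0r|exact: ltW].
  by rewrite ler_pdivrMr// mul1r mulrDl !mul1r lerD2l.
have If w : (kernel_at Q w).-integrable [set: E] (EFin \o f).
  exact: bounded_measurable_integrable.
have Icst w (k : R) : (kernel_at Q w).-integrable [set: E] (EFin \o (fun _ : E => k)).
  apply: bounded_measurable_integrable.
  by apply: (@bounded_measurable_itv _ k k) => // z; rewrite lexx.
have Isf w s : (kernel_at Q w).-integrable [set: E] (EFin \o (fun z => (-1) ^+ s * f z)%R).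
  apply: bounded_measurable_integrable.
  apply: (@bounded_measurable_itv _ (- M)%R M); first exact: measurable_funM.
  by move=> z; rewrite -ler_norml normrMsign.
have IsfM w s : (kernel_at Q w).-integrable [set: E] (EFin \o (fun z => M + (-1) ^+ s * f z)%R).
  rewrite (_ : _ \o _ = (EFin \o cst M) \+ (EFin \o (fun z => (-1) ^+ s * f z)%R)).
    by apply: integrableD; [by []|exact: Icst|exact: Isf].
  by apply/funext => z; rewrite /= EFinD.
have uE s w : (\int[kernel_at Q w]_z u s z =
    (M + (-1) ^+ s * \int[kernel_at Q w]_z f z) / (2 * M))%R.
  rewrite /u RintegralZr; [|by []|exact: IsfM].
  rewrite RintegralD; [|by []|exact: Icst|exact: Isf].
  rewrite RintegralZl; [|by []|exact: If].
  by rewrite Rintegral_probability_cst.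
apply/cvgrPdist_lt => e e0.
(* With [H (x, y) < eta^2] the bound is at most [eta (1 + c)], strictly less than
   [eta (2 + c) = e / (2 M)]. *)
pose eta := (e / (2 * M) / (2 + c))%R.
have c2 : (0 < 2 + c)%R by rewrite ltr_wpDr.
have eta0 : (0 < eta)%R by rewrite !divr_gt0.
have near_H : \forall y \near x, y != x -> (H (x, y) < eta ^+ 2)%R.
  have e2 : (0 < eta ^+ 2)%R by rewrite exprn_gt0.
  have /cvgr0Pnorm_lt/(_ _ e2) := Hcvg x.
  rewrite -nbhs_nearE => hn.
  have {}hn : nbhs x [set y | y != x -> `|H (x, y)| < eta ^+ 2]%R := hn.
  apply: filterS hn => y hy yx; have := hy yx.
  by rewrite ger0_norm.
(* The limit is over [y != x] and says nothing of [H (x, x)], so [y = x] is treated apart. *)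
near=> y; have [->|yx] := eqVneq y x; first by rewrite subrr normr0.
have hy : (H (x, y) < eta ^+ 2)%R by have : y != x -> (H (x, y) < eta ^+ 2)%R; [near: y|exact].
have osc (s : bool) : ((-1) ^+ s * (\int[kernel_at Q x]_z f z - \int[kernel_at Q y]_z f z) < e)%R.
  have := kernel_oscillation x y (mu_ s) (u01 s) eta0.
  rewrite !uE -mulrBl opprD addrACA subrr add0r -mulrBr => h.
  have h1 : (H (x, y) * c / eta <= eta * c)%R.
    rewrite ler_pdivrMr// mulrAC -expr2 ler_wpM2r//.
    exact: ltW.
  have := le_trans h (lerD (lexx eta) h1).
  rewrite ler_pdivrMr// => /le_lt_trans; apply.
  have -> : (e = (eta * (2 + c)) * (2 * M))%R.
    by rewrite /eta; field; rewrite !gt_eqF.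
  rewrite ltr_pM2r// mulrDr ltrD2r -[ltLHS]mulr1 ltr_pM2l//.
  by rewrite ltr1n.
have := osc false; have := osc true; rewrite expr0 expr1 mul1r mulN1r => o1 o2.
by rewrite ltr_norml o2 andbT ltrNl.
Unshelve. all: end_near. Qed.

End kernel_log_Harnack.

(** * Densities with respect to a probability measure *)

Section densities.
Context (R : realType) (d : measure_display) (X : measurableType d).

Lemma integral_density (m m' : {measure set X -> \bar R}) (g : X -> R)
    (h : X -> \bar R) : (forall x, 0 <= g x)%R ->
  (forall k, measurable_fun [set: X] k -> (forall x, 0 <= k x) ->
    \int[m]_x k x = \int[m']_x ((g x)%:E * k x)) ->
  measurable_fun [set: X] h -> \int[m]_x h x = \int[m']_x ((g x)%:E * h x).
Proof.
move=> g0 gE mh; rewrite [LHS]integralE [RHS]integralE.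
rewrite !gE//; [|exact: measurable_funeneg|exact: measurable_funepos].
congr (_ - _); apply: eq_integral => x _.
- by rewrite !funeposE maxe_pMr ?lee_fin// mule0.
- by rewrite !funenegE -muleN maxe_pMr ?lee_fin// mule0.
Qed.

Lemma density_exists (m : {finite_measure set X -> \bar R}) (mu : probability X R) :
  m `<< mu -> exists g : X -> R, [/\ measurable_fun [set: X] g,
    forall x, (0 <= g x)%R & forall h, measurable_fun [set: X] h ->
    \int[m]_x h x = \int[mu]_x ((g x)%:E * h x)].
Proof.
move=> dom; pose f := Radon_Nikodym_SigmaFinite.f m mu.
have ff x : f x \is a fin_num := Radon_Nikodym_SigmaFinite.f_fin_num dom x.
have f0 x : 0 <= f x := Radon_Nikodym_SigmaFinite.f_ge0 dom x.
have mf : measurable_fun [set: X] f.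
  exact: measurable_int (Radon_Nikodym_SigmaFinite.f_integrable dom).
have g0 x : (0 <= fine (f x))%R by exact: fine_ge0.
exists (fine \o f); split => //; first exact: measurableT_comp.
move=> h mh; apply: integral_density => // k mk k0.
rewrite -(Radon_Nikodym_SigmaFinite.change_of_variables dom)//.
by apply: eq_integral => x _; rewrite /= fineK// muleC.
Qed.

(** Tested on the set where [u] is negative, the hypothesis makes the integral of [|u|] over it
    vanish. *)
Lemma ae_ge0_of_integral_ge0 (mu : probability X R) (u : X -> R) :
  measurable_fun [set: X] u ->
  (forall A, measurable A -> 0 <= \int[mu]_(x in A) (u x)%:E) ->
  {ae mu, forall x, (0 <= u x)%R}.
Proof.
move=> mu_ uA; pose A := [set x | (u x < 0)%R].
have mA : measurable A.
  rewrite (_ : A = u @^-1` `]-oo, 0%R[%classic).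
    by rewrite -[X in measurable X]setTI; exact: mu_.
  by apply/seteqP; split => x /=; rewrite in_itv.
have muA : measurable_fun A (EFin \o u).
  by apply: measurable_funTS; exact/measurable_EFinP.
have I0 : \int[mu]_(x in A) `|(EFin \o u) x| = 0.
  apply/eqP; rewrite eq_le integral_ge0// andbT -oppe_ge0.
  rewrite -integral_ge0N//; apply: le_trans (uA A mA) _.
  rewrite le_eqVlt; apply/orP; left; apply/eqP; apply: eq_integral => x.
  by rewrite inE /A /= => /ltr0_norm ->; rewrite ?EFinN ?oppeK ?opprK.
have := (ae_eq_integral_abs mu mA muA).1 I0.
apply: filterS => x /= h; rewrite leNgt; apply/negP => ux.
by have [ux0] := h ux; rewrite ux0 ltxx in ux.
Qed.

End densities.

(** The identity [x^-1 = x (x^2)^-1], true at [0] too since [0^-1 = 0], reduces the claim to a real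
    power of a nonnegative base. *)
Lemma measurable_invr (R : realType) : measurable_fun [set: R] (fun x : R => x^-1)%R.
Proof.
rewrite (_ : (fun x => _) = (fun x => x * (x ^+ 2) `^ (-1))%R).
  apply: measurable_funM => //; apply: (measurableT_comp (measurable_powR _)).
  exact: measurable_funX.
apply/funext => x; rewrite powR_inv1 ?sqr_ge0//.
by have [->|x0] := eqVneq x 0%R; [rewrite invr0 mul0r|rewrite expr2 invfM mulVKf].
Qed.

(** * Strong Feller property, transition densities and their relative entropy *)

Section entropy_inequality.
Context (R : realType) (d : measure_display) (E : polishType R d).
Variables (Q : R.-pker E ~> E) (mu : probability E R) (H : E * E -> R) (c : R)
  (T : (E -> \bar R) -> E -> \bar R).
Hypothesis H0 : forall xy, (0 <= H xy)%R.
Hypothesis c0 : (0 <= c)%R.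
Hypothesis LH : forall x y f, bounded_measurable f -> (forall z, 1 <= f z)%R ->
  (\int[kernel_at Q x]_z ln (f z) <=
   ln (\int[kernel_at Q y]_z f z) + H (x, y) * c)%R.
Hypothesis dom : forall x, kernel_at Q x `<< mu.
Hypothesis TE : forall f, bounded_measurable f -> forall x,
  T (EFin \o f) x = \int[kernel_at Q x]_z (f z)%:E.

Lemma bounded_RintegralE (m : probability E R) (f : E -> R) :
  bounded_measurable f -> \int[m]_x (f x)%:E = (\int[m]_x f x)%:E.
Proof.
move=> bf; rewrite /Rintegral fineK//; apply: integrable_fin_num => //.
exact: bounded_measurable_integrable.
Qed.

Lemma kernel_strong_Feller : (forall x : E, H (x, y) @[y --> x^'] --> (0 : R)%R) ->
  strong_Feller T.
Proof.
move=> Hcvg f bf; exists (fun x => \int[kernel_at Q x]_z f z)%R; split.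
- exact: (kernel_continuous H0 c0 LH Hcvg bf).
- have [mf [M [Mr hM]]] := bf; exists M; split => // r Mr' x _ /=.
  rewrite ler_norml; apply: Rintegral_itv => // z.
  by rewrite -ler_norml; exact: hM.
- by move=> x; rewrite TE// bounded_RintegralE.
Qed.

Lemma kernel_transition_density : exists p, transition_density mu T p.
Proof.
have /choice[p pP] x := density_exists (dom x).
exists p => x _; have [mp p0 pE] := pP x; split => // f bf; rewrite TE// pE.
  by apply: eq_integral => z _; rewrite EFinM.
by apply/measurable_EFinP; exact: bf.1.
Qed.

(** The test function is [1 + k 1_A] with [k] large, as for absolute continuity with respect to
    [mu]. The consequence of interest is that the density at [x] vanishes almost everywhere where
    the density at [y] does. *)
Lemma log_Harnack_null x y A : measurable A -> Q y A = 0 -> Q x A = 0.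
Proof.
move=> mA QyA; have indE w : (\int[kernel_at Q w]_z \1_A z = fine (Q w A))%R.
  by rewrite /Rintegral integral_indic// setIT.
have Ind w : (kernel_at Q w).-integrable [set: E] (EFin \o \1_A).
  exact/bounded_measurable_integrable/bounded_measurable_indic.
have Qfin w : Q w A \is a fin_num.
  exact: (@fin_num_measure _ _ _ (kernel_at Q w) A mA).
suff : fine (Q x A) = 0%R by move=> h; rewrite -(fineK (Qfin x)) h.
apply/eqP; rewrite eq_le fine_ge0// andbT leNgt; apply/negP => p0.
set p := fine (Q x A) in p0; pose C := (H (x, y) * c)%R.
have C0 : (0 <= C)%R by exact: mulr_ge0.
pose k := expR ((C + 1) / p); have k0 : (0 < k)%R by exact: expR_gt0.
have fk z : (1 <= 1 + k * \1_A z <= 1 + k)%R.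
  rewrite lerDl lerD2l mulr_ge0 ?(ltW k0)//= indicE.
  by case: (_ \in _); rewrite ?mulr1 ?mulr0// ltW.
have mf : measurable_fun [set: E] (fun z => 1 + k * \1_A z : R)%R.
  by apply: measurable_funD => //; exact: measurable_funM.
have := log_Harnack_pos LH x y mf ltr01 fk.
have -> : (\int[kernel_at Q y]_z (1 + k * \1_A z) = 1)%R.
  rewrite RintegralD//; last 2 first.
  - apply: bounded_measurable_integrable.
    by apply: (@bounded_measurable_itv _ _ _ _ 1%R 1%R) => // z; rewrite lexx.
  - apply: bounded_measurable_integrable.
    apply: (@bounded_measurable_itv _ _ _ _ 0%R k); first exact: measurable_funM.
    by move=> z; have := fk z; rewrite lerDl lerD2l.
  rewrite Rintegral_probability_cst RintegralZl//; last exact: Ind.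
  by rewrite indE QyA mulr0 addr0.
have -> : (\int[kernel_at Q x]_z ln (1 + k * \1_A z) = ln (1 + k) * p)%R.
  rewrite /p -indE -RintegralZl; [|by []|exact: Ind].
  apply: eq_Rintegral => z _; rewrite indicE.
  by case: (_ \in _); rewrite ?mulr1 ?mulr0// addr0 ln1.
rewrite ln1 add0r -/C -ler_pdivlMr// leNgt => /negP; apply.
rewrite (@lt_trans _ _ ((C + 1) / p)%R)//.
  by rewrite ltr_pM2r ?invr_gt0// ltrDl.
by rewrite -[ltLHS]expRK ltr_ln ?posrE ?ltrDr// addr_gt0.
Qed.
(** The case split spells out the conventions: the extended inverse of [0] is [+oo], and [lne] is
    [-oo] on nonpositive reals. *)
Lemma measurable_mul_lne_div (u v : E -> R) : measurable_fun [set: E] u ->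
  measurable_fun [set: E] v ->
  measurable_fun [set: E] (fun z => (u z)%:E * lne ((u z)%:E / (v z)%:E)).
Proof.
move=> mu_ mv; have muv : measurable_fun [set: E] (fun z => u z / v z)%R.
  by apply: measurable_funM => //; exact: measurableT_comp (@measurable_invr R) _.
rewrite (_ : (fun z => _) = (fun z => if v z == 0%R then
    if u z == 0%R then 0 else +oo else
    if (u z / v z <= 0)%R then (u z)%:E * -oo else (u z * ln (u z / v z))%:E)).
  apply: measurable_fun_ifT; first exact: measurable_fun_eqr.
    apply: measurable_fun_ifT => //; exact: measurable_fun_eqr.
  apply: measurable_fun_ifT; first exact: measurable_fun_ler.
    by apply: emeasurable_funM => //; exact/measurable_EFinP.
  apply/measurable_EFinP; apply: measurable_funM => //; exact: measurableT_comp.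
apply/funext => z; rewrite inver; case: eqVneq => vz.
  have [->|uz] := eqVneq (u z) 0%R; first by rewrite mul0e.
  have [u0|u0|/eqP] := ltgtP (u z) 0%R; last by rewrite (negbTE uz).
    by rewrite lt0_muley ?lte_fin//= lt0_muleNy ?lte_fin.
  by rewrite gt0_muley ?lte_fin//= gt0_muley ?lte_fin.
by rewrite -EFinM /=; case: ifPn => //; rewrite EFinM.
Qed.

(** The sections of [p] are replaced, up to [mu]-null sets, by nonnegative ones. With [r] their
    ratio, [r p_y <= p_x] bounds the mean of [min (r, n) + delta] under [Q y] by [1 + delta], which
    is what [entropy_le] asks for with [C = H (x, y) c]. *)
Lemma kernel_entropy_inequality p x y : transition_density mu T p ->
  supp mu x -> supp mu y ->
  \int[mu]_z ((p x z)%:E * lne ((p x z)%:E / (p y z)%:E)) <= (H (x, y) * c)%:E.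
Proof.
move=> pP sx sy.
pose pos w z := Num.max (p w z) 0%R.
have pos0 w z : (0 <= pos w z)%R by rewrite le_max lexx orbT.
have mp w : supp mu w -> measurable_fun [set: E] (p w).
  by move=> sw; have [] := pP w sw.
have mpos w : supp mu w -> measurable_fun [set: E] (pos w).
  by move=> sw; apply: measurable_maxr => //; exact: mp.
have ae_pos w : supp mu w -> {ae mu, forall z, p w z = pos w z}.
  move=> sw; have [mw wE] := pP w sw.
  have : {ae mu, forall z, (0 <= p w z)%R}.
    apply: ae_ge0_of_integral_ge0 => // A mA.
    rewrite integral_mkcond_indic; under eq_integral do rewrite mulrC.
    rewrite -(wE \1_A); last exact: bounded_measurable_indic.
    rewrite TE; last exact: bounded_measurable_indic.
    by apply: integral_ge0 => z _; rewrite lee_fin indicE.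
  by apply: filterS => z w0; rewrite /pos max_l.
have posE w f : supp mu w -> bounded_measurable f ->
    \int[kernel_at Q w]_z (f z)%:E = \int[mu]_z (pos w z * f z)%:E.
  move=> sw bf; have [mw wE] := pP w sw; have [mf _] := bf.
  rewrite -TE// wE//; apply: ae_eq_integral => //.
  - by apply/measurable_EFinP; exact: measurable_funM.
  - by apply/measurable_EFinP; apply: measurable_funM => //; exact: mpos.
  - by apply: filterS (ae_pos w sw) => z -> _.
have indE w A : supp mu w -> measurable A -> Q w A = \int[mu]_z (pos w z * \1_A z)%:E.
  move=> sw mA; rewrite -posE//; last exact: bounded_measurable_indic.
  by rewrite integral_indic// setIT.
pose A := [set z | pos y z = 0%R].
have mA : measurable A.
  rewrite (_ : A = pos y @^-1` [set 0%R])//.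
  by rewrite -[X in measurable X]setTI; exact: (mpos y sy).
have QxA : Q x A = 0.
  apply: (@log_Harnack_null _ y) => //; rewrite indE//.
  apply: integral0_eq => z _; rewrite indicE.
  by case: (boolP (z \in A)); rewrite ?mulr0// inE => ->; rewrite mul0r.
(* Setting the density at [x] to [0] where that at [y] vanishes gives [u = r p_y] at every point; by
   [log_Harnack_null] the change is [mu]-negligible. *)
pose u z := (if pos y z == 0 then 0 else pos x z)%R.
have mu_ : measurable_fun [set: E] u.
  apply: measurable_fun_ifT => //; last exact: mpos.
  by apply: measurable_fun_eqr => //; exact: mpos.
have u0 z : (0 <= u z)%R by rewrite /u; case: ifP.
have ae_u : {ae mu, forall z, pos x z = u z}.
  have : \int[mu]_z `|(pos x z * \1_A z)%:E| = 0.
    rewrite -QxA indE//; apply: eq_integral => z _.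
    by rewrite gee0_abs// lee_fin mulr_ge0// indicE.
  have mxA : measurable_fun [set: E] (fun z => (pos x z * \1_A z)%:E).
    by apply/measurable_EFinP; apply: measurable_funM => //; exact: mpos.
  move/(ae_eq_integral_abs mu measurableT mxA); apply: filterS => z /(_ I) /=.
  rewrite /u; case: eqP => // yz; rewrite indicE mem_set//= mulr1.
  by move=> [].
have uE f : bounded_measurable f ->
    \int[kernel_at Q x]_z (f z)%:E = \int[mu]_z (u z * f z)%:E.
  move=> bf; have [mf _] := bf; rewrite posE//; apply: ae_eq_integral => //.
  - by apply/measurable_EFinP; apply: measurable_funM => //; exact: mpos.
  - by apply/measurable_EFinP; exact: measurable_funM.
  - by apply: filterS ae_u => z -> _.
have b1 : bounded_measurable (cst 1%R : E -> R).
  by apply: (@bounded_measurable_itv _ _ _ _ 1%R 1%R) => // z; rewrite lexx.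
have total w v : (forall f, bounded_measurable f ->
    \int[kernel_at Q w]_z (f z)%:E = \int[mu]_z (v z * f z)%:E) ->
    \int[mu]_z (v z)%:E = 1.
  move=> vE; have -> : 1 = \int[kernel_at Q w]_z 1%:E.
    rewrite (_ : (fun _ => _) = cst 1)// integral_cst// mul1e.
    by apply/esym; exact: prob_kernel.
  by rewrite (vE _ b1); apply: eq_integral => z _; rewrite mulr1.
have u1 : \int[mu]_z (u z)%:E = 1 by exact: (total x u uE).
pose r z := (u z / pos y z)%R.
have mr : measurable_fun [set: E] r.
  apply: measurable_funM => //; apply: (measurableT_comp (@measurable_invr R)).
  exact: mpos.
have r0 z : (0 <= r z)%R by exact: divr_ge0.
have ru z : (r z = 0 -> u z = 0)%R.
  rewrite /r /u; case: eqP => // /eqP yz /eqP.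
  by rewrite mulf_eq0 invr_eq0 (negbTE yz) orbF => /eqP.
rewrite (_ : \int[mu]_z _ = \int[mu]_z (u z * ln (r z))%:E).
  apply: entropy_le => // n delta d0.
  have mphi : measurable_fun [set: E] (fun z => Num.min (r z) n%:R + delta)%R.
    by apply: measurable_funD => //; exact: measurable_minr.
  have phi_itv z : (delta <= Num.min (r z) n%:R + delta <= n%:R + delta)%R.
    by rewrite lerDr lerD2r le_min r0 ler0n ge_min lexx orbT.
  have bphi := bounded_measurable_itv mphi phi_itv.
  have bln : bounded_measurable (fun z => ln (Num.min (r z) n%:R + delta))%R.
    apply: (@bounded_measurable_itv _ _ _ _ (ln delta) (ln (n%:R + delta))).
      exact: measurableT_comp.
    move=> z; have /andP[h1 h2] := phi_itv z.
    by rewrite !ler_ln ?posrE ?h1 ?h2// (lt_le_trans d0)// (le_trans h1).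
  rewrite -uE// bounded_RintegralE// lee_fin.
  apply: (le_trans (log_Harnack_pos LH x y mphi d0 phi_itv)); rewrite lerD2r.
  have [J _] := andP (Rintegral_itv (kernel_at Q y) mphi phi_itv).
  rewrite ler_ln ?posrE; [|exact: lt_le_trans J|by rewrite ltr_wpDr// ltW].
  rewrite -lee_fin -bounded_RintegralE// posE//.
  apply: (@le_trans _ _ (\int[mu]_z ((u z)%:E + delta%:E * (pos y z)%:E))).
    apply: ge0_le_integral => //.
    - by move=> z _; rewrite lee_fin mulr_ge0// addr_ge0//; [rewrite le_min r0 ler0n|exact: ltW].
    - by apply/measurable_EFinP; apply: measurable_funM => //; exact: mpos.
    - apply: emeasurable_funD; first exact/measurable_EFinP.
      by apply: emeasurable_funM => //; apply/measurable_EFinP; exact: mpos.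
    - move=> z _; rewrite -EFinM -EFinD lee_fin mulrDr [(delta * _)%R]mulrC lerD2r.
      have [->|yz] := eqVneq (pos y z) 0%R; first by rewrite mul0r.
      rewrite (@le_trans _ _ (pos y z * r z)%R)//.
        by rewrite ler_wpM2l// ge_min lexx.
      by rewrite /r mulrC divfK.
  rewrite ge0_integralD//; last 4 first.
  - by move=> z _; rewrite lee_fin.
  - exact/measurable_EFinP.
  - by move=> z _; rewrite mule_ge0// lee_fin// ltW.
  - by apply: emeasurable_funM => //; apply/measurable_EFinP; exact: mpos.
  rewrite ge0_integralZl//; last 3 first.
  - by apply/measurable_EFinP; exact: mpos.
  - by move=> z _; rewrite lee_fin.
  - by rewrite lee_fin ltW.
  by rewrite u1 (total y (pos y)) ?mule1 ?EFinD// => f bf; exact: posE.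
apply: ae_eq_integral => //.
- by apply: measurable_mul_lne_div; exact: mp.
- apply/measurable_EFinP; apply: measurable_funM => //; exact: measurableT_comp.
(* Almost everywhere the extended integrand is the real one: both are [0] where [p x] vanishes, and
   elsewhere both densities are positive. *)
- apply: filterS3 (ae_pos x sx) (ae_pos y sy) ae_u => z -> -> xu _.
  rewrite -xu /r -xu; have [xz|xz] := eqVneq (pos x z) 0%R.
    by rewrite xz mul0e mul0r.
  have yz : pos y z != 0%R.
    by apply: contraNneq xz => yz; rewrite xu /u yz eqxx.
  rewrite inver (negbTE yz) -EFinM lne_EFin ?EFinM//.
  by rewrite divr_gt0// lt_neqAle eq_sym ?xz ?yz pos0.
Qed.

End entropy_inequality.

(** * The adjoint in [L^1] *)

Section adjoint_tools.
Context (R : realType) (d : measure_display) (E : polishType R d).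

Lemma measurable_kernel_integral (Q : R.-pker E ~> E) (h : E -> \bar R) :
  measurable_fun [set: E] h -> measurable_fun [set: E] (fun x => \int[Q x]_y h y).
Proof.
move=> mh; under eq_fun do rewrite integralE.
apply: emeasurable_funB.
- apply: (@measurable_fun_integral_kernel _ _ _ _ _ Q) => //.
    by move=> U mU; exact: measurable_kernel.
  exact: measurable_funepos.
- apply: (@measurable_fun_integral_kernel _ _ _ _ _ Q) => //.
    by move=> U mU; exact: measurable_kernel.
  exact: measurable_funeneg.
Qed.

Lemma bounded_kernel_integral (Q : R.-pker E ~> E) (h : E -> R) :
  bounded_measurable h ->
  bounded_measurable (fun x => \int[kernel_at Q x]_y h y)%R.
Proof.
move=> [mh [M [Mr hM]]]; split.
  apply: measurableT_comp => //; apply: measurable_kernel_integral.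
  exact/measurable_EFinP.
exists M; split => // r Mr' x _ /=; rewrite ler_norml.
by apply: Rintegral_itv => // z; rewrite -ler_norml; exact: hM.
Qed.

Lemma integral_kernel_push (m : {finite_measure set E -> \bar R})
    (Q : R.-pker E ~> E) (h : E -> \bar R) :
  (kernel_push m Q).-integrable [set: E] h ->
  \int[kernel_push m Q]_y h y = \int[m]_x \int[Q x]_y h y.
Proof.
move=> ih; have mh := measurable_int _ ih.
have aux (g : E -> \bar R) : measurable_fun [set: E] g -> (forall y, 0 <= g y) ->
    \int[kernel_push m Q]_y g y < +oo ->
    m.-integrable [set: E] (fun x => \int[Q x]_y g y).
  move=> mg g0; rewrite ge0_integral_kernel_push// => goo.
  apply/integrableP; split; first exact: measurable_kernel_integral.
  apply: le_lt_trans goo; rewrite le_eqVlt; apply/orP; left; apply/eqP.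
  by apply: eq_integral => x _; rewrite gee0_abs// integral_ge0.
have mp : measurable_fun [set: E] h^\+ by exact: measurable_funepos.
have mn : measurable_fun [set: E] h^\- by exact: measurable_funeneg.
rewrite [LHS]integralE !ge0_integral_kernel_push// -integralB//.
- by apply: eq_integral => x _; rewrite -integralE.
- apply: aux => //.
  by have /integrableP[_] := integrable_funepos measurableT ih;
    under eq_integral do rewrite gee0_abs//.
- apply: aux => //.
  by have /integrableP[_] := integrable_funeneg measurableT ih;
    under eq_integral do rewrite gee0_abs//.
Qed.

Lemma bounded_Lfun2 (mu : probability E R) (f : E -> R) :
  bounded_measurable f -> f \in Lfun mu 2%:E.
Proof.
move=> [mf [M [Mr fM]]]; rewrite inE; apply/andP; split; rewrite inE//=.
rewrite /finite_norm unlock /=.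
apply: poweR_lty.
have fM1 x : (`|f x| <= `|M| + 1)%R.
  by apply: fM => //; rewrite (le_lt_trans (ler_norm _))// ltrDl.
apply: (@le_lt_trans _ _ (\int[mu]_x ((`|M| + 1) ^+ 2)%:E)).
  apply: ge0_le_integral => //.
  - apply/measurable_EFinP; apply: (measurableT_comp (measurable_powR _)).
    exact: measurableT_comp.
  - move=> x _ /=; rewrite lee_fin powR_mulrn//.
    by rewrite ler_pXn2r ?nnegrE ?addr_ge0.
rewrite (_ : (fun _ => _) = cst ((`|M| + 1) ^+ 2)%:E)// integral_cst//.
by rewrite [X in _ * X](_ : _ = 1) ?mule1 ?ltry//; exact: probability_setT.
Qed.

Lemma density_le (m1 m2 : set E -> \bar R) (mu : probability E R) (g1 g2 : E -> R) :
  mu.-integrable [set: E] (EFin \o g1) -> mu.-integrable [set: E] (EFin \o g2) ->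
  (forall A, measurable A -> m1 A = \int[mu]_(x in A) (g1 x)%:E) ->
  (forall A, measurable A -> m2 A = \int[mu]_(x in A) (g2 x)%:E) ->
  (forall A, measurable A -> m1 A <= m2 A) ->
  {ae mu, forall x, (g1 x <= g2 x)%R}.
Proof.
move=> i1 i2 m1E m2E m12.
have mg1 : measurable_fun [set: E] g1 by apply/measurable_EFinP; exact: measurable_int i1.
have mg2 : measurable_fun [set: E] g2 by apply/measurable_EFinP; exact: measurable_int i2.
have : {ae mu, forall x, (0 <= g2 x - g1 x)%R}.
  apply: ae_ge0_of_integral_ge0; first exact: measurable_funB.
  move=> A mA; under eq_integral do rewrite EFinB.
  have iA g : mu.-integrable [set: E] (EFin \o g) -> mu.-integrable A (EFin \o g).
    by move=> ig; apply: integrableS ig.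
  rewrite integralB//; [|exact: iA..].
  have := m12 A mA; rewrite m1E// m2E// => h; rewrite subre_ge0//.
  by apply: integrable_fin_num => //; exact: iA.
by apply: filterS => x; rewrite subr_ge0.
Qed.

Lemma density_setE (m : {measure set E -> \bar R}) (mu : probability E R) (g : E -> R) :
  (forall h, measurable_fun [set: E] h ->
    \int[m]_x h x = \int[mu]_x ((g x)%:E * h x)) ->
  forall A, measurable A -> m A = \int[mu]_(x in A) (g x)%:E.
Proof.
move=> gE A mA; rewrite integral_mkcond_indic.
have -> : m A = \int[m]_x (\1_A x)%:E by rewrite integral_indic// setIT.
rewrite gE; last exact/measurable_EFinP.
by apply: eq_integral => x _; rewrite mulrC EFinM.
Qed.

(* Pairing with a bounded function is continuous for the [L^1] distance. *)
Lemma cvg_integral_bounded (mu : probability E R) (f_ : nat -> E -> R) (f w : E -> R) :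
  (forall n, mu.-integrable [set: E] (EFin \o f_ n)) ->
  mu.-integrable [set: E] (EFin \o f) -> bounded_measurable w ->
  \int[mu]_x `|f_ n x - f x|%:E @[n --> \oo] --> 0 ->
  \int[mu]_x (f_ n x * w x)%:E @[n --> \oo] --> \int[mu]_x (f x * w x)%:E.
Proof.
move=> if_ if0 [mw [M0 [Mr wM]]] f_f.
pose M := (`|M0| + 1)%R; have M_gt0 : (0 < M)%R by rewrite ltr_wpDl.
have wM1 x : (`|w x| <= M)%R.
  by apply: wM => //; rewrite (le_lt_trans (ler_norm _))// ltrDl.
have iw g : mu.-integrable [set: E] (EFin \o g) ->
    mu.-integrable [set: E] (fun x => (g x * w x)%:E).
  move=> ig; have mg : measurable_fun [set: E] g.
    by apply/measurable_EFinP; exact: measurable_int ig.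
  apply: (@le_integrable _ _ _ mu setT measurableT _ (fun x => (M%:E * (g x)%:E))).
  - by apply/measurable_EFinP; exact: measurable_funM.
  - move=> x _; rewrite -EFinM /= lee_fin !normrM mulrC ler_wpM2r//.
    by rewrite (le_trans (wM1 x))// ler_norm.
  - exact: integrableZl.
have bound n : `|\int[mu]_x (f_ n x * w x)%:E - \int[mu]_x (f x * w x)%:E| <=
    M%:E * \int[mu]_x `|f_ n x - f x|%:E.
  have mf_ : measurable_fun [set: E] (f_ n).
    by apply/measurable_EFinP; exact: measurable_int (if_ n).
  have mf : measurable_fun [set: E] f.
    by apply/measurable_EFinP; exact: measurable_int if0.
  have mfw : measurable_fun [set: E] (fun x => (f_ n x * w x)%:E - (f x * w x)%:E).
    by apply: emeasurable_funB; [exact: measurable_int (iw _ (if_ n))|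
                                 exact: measurable_int (iw _ if0)].
  have mff : measurable_fun [set: E] (fun x => `|f_ n x - f x|%:E).
    apply/measurable_EFinP; apply: measurableT_comp => //; exact: measurable_funB.
  rewrite -integralB//; [|exact: iw..].
  rewrite -ge0_integralZl//; last by rewrite lee_fin ltW.
  apply: (le_trans (le_abse_integral _ _ _)) => //.
  apply: ge0_le_integral => //.
  - exact: measurableT_comp.
  - by apply: emeasurable_funM.
  - move=> x _; rewrite -EFinB -EFinM /= lee_fin -mulrBl normrM mulrC ler_wpM2r//.
apply: (sube_cvg0 _ _).1; first by apply: integrable_fin_num => //; exact: iw.
apply/cvg_abse0P.
apply: (@squeeze_cvge _ _ _ _ (cst 0) _ (fun n => M%:E * \int[mu]_x `|f_ n x - f x|%:E)).
- by apply: nearW => n; rewrite abse_ge0 bound.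
- exact: cvg_cst.
- by rewrite -[X in _ --> X](mule0 M%:E); apply: cvgeZl.
Qed.

End adjoint_tools.

Section adjoint.
Context (R : realType) (d : measure_display) (E : polishType R d).
Variables (Q : R.-pker E ~> E) (mu : probability E R)
  (T : (E -> \bar R) -> E -> \bar R).
Hypothesis Qinv : forall A, measurable A -> \int[mu]_x Q x A = mu A.
Hypothesis Tint : forall x h, (kernel_at Q x).-integrable [set: E] h ->
  T h x = \int[kernel_at Q x]_y h y.
Hypothesis Tmeas : forall h, measurable_fun [set: E] h ->
  measurable_fun [set: E] (T h).

Lemma ge0_invariant_integral (h : E -> \bar R) : measurable_fun [set: E] h ->
  (forall x, 0 <= h x) -> \int[mu]_x \int[Q x]_y h y = \int[mu]_x h x.
Proof.
move=> mh h0; rewrite -(ge0_integral_kernel_push mu)//.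
by apply: eq_measure_integral => A mA _; exact: Qinv.
Qed.

Section density.
Variables (f : E -> R) (f0 : forall x, (0 <= f x)%R)
  (intf : mu.-integrable [set: E] (EFin \o f)).

Let mf : measurable_fun [set: E] f.
Proof. by apply/measurable_EFinP; exact: measurable_int intf. Qed.

(** The image of [f mu] under [Q]. Its density with respect to [mu] pairs with [h] as [f] does with
    [Q h], hence is the image of [f] under the adjoint. *)
Definition adjoint_measure : set E -> \bar R :=
  kernel_push (density_measure f0 intf) Q.

HB.instance Definition _ := FiniteMeasure.on adjoint_measure.

Lemma adjoint_measureE A : measurable A ->
  adjoint_measure A = \int[mu]_x ((f x)%:E * Q x A).
Proof.
move=> mA; rewrite /adjoint_measure kernel_pushE ge0_integral_density//.
exact: measurable_kernel.
Qed.

(** By invariance, a [mu]-null set [A] satisfies [Q x A = 0] for [mu]-almost every [x]. *)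
Lemma adjoint_measure_dominates : adjoint_measure `<< mu.
Proof.
apply/null_content_dominatesP => A mA muA; rewrite adjoint_measureE//.
have mQA : measurable_fun [set: E] (fun x => Q x A) by exact: measurable_kernel.
have : \int[mu]_x `|Q x A| = 0.
  rewrite -[RHS](etrans (Qinv mA) muA).
  by apply: eq_integral => x _; rewrite gee0_abs.
move=> /(ae_eq_integral_abs mu measurableT mQA) QA0.
rewrite (ae_eq_integral (cst 0)) ?integral0//.
  by apply: emeasurable_funM => //; exact/measurable_EFinP.
by apply: filterS QA0 => x /(_ I) -> _; rewrite mule0.
Qed.

Lemma integral_adjoint_measure (h : E -> \bar R) :
  adjoint_measure.-integrable [set: E] h ->
  \int[adjoint_measure]_x h x = \int[mu]_x ((f x)%:E * \int[kernel_at Q x]_y h y).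
Proof.
move=> ih; rewrite /adjoint_measure integral_kernel_push//.
apply: integral_density => //.
  by move=> k mk k0; rewrite ge0_integral_density.
by apply: measurable_kernel_integral; exact: measurable_int ih.
Qed.

Lemma adjoint_density : exists g : E -> R, [/\ measurable_fun [set: E] g,
  forall x, (0 <= g x)%R, mu.-integrable [set: E] (EFin \o g) &
  forall h, measurable_fun [set: E] h ->
    \int[adjoint_measure]_x h x = \int[mu]_x ((g x)%:E * h x)].
Proof.
have [g [mg g0 gE]] := density_exists adjoint_measure_dominates.
exists g; split => //; apply/integrableP; split; first exact/measurable_EFinP.
rewrite (_ : \int[mu]_x _ = adjoint_measure setT).
  by rewrite -ge0_fin_numE// fin_num_measure.
rewrite -[RHS]mul1e -integral_cst// gE//; apply: eq_integral => x _.
by rewrite mule1 gee0_abs// lee_fin.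
Qed.

Lemma adjoint_L2_bounded (g : E -> R) : bounded_measurable f ->
  bounded_measurable g -> (forall x, 0 <= g x)%R ->
  (forall h, measurable_fun [set: E] h ->
    \int[adjoint_measure]_x h x = \int[mu]_x ((g x)%:E * h x)) ->
  adjoint_L2 mu T f g.
Proof.
move=> bf bg g0 gE; split; [exact: bounded_Lfun2|exact: bounded_Lfun2|].
move=> h h2; have ih : mu.-integrable [set: E] (EFin \o h).
  by apply/Lfun1_integrable; apply: Lfun_subset12 h2; exact: fin_num_measure.
have mh := measurable_int _ ih; have [mg [M0 [Mr gM]]] := bg.
pose M := (`|M0| + 1)%R; have M_gt0 : (0 < M)%R by rewrite ltr_wpDl.
have gM1 x : (`|g x| <= M)%R.
  by apply: gM => //; rewrite (le_lt_trans (ler_norm _))// ltrDl.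
have iah : adjoint_measure.-integrable [set: E] (EFin \o h).
  apply/integrableP; split => //; rewrite gE; last exact: measurableT_comp.
  apply: (@le_lt_trans _ _ (\int[mu]_x (M%:E * `|(h x)%:E|))).
    apply: ge0_le_integral => //.
    - by move=> x _; rewrite mule_ge0// lee_fin.
    - apply: emeasurable_funM; first exact/measurable_EFinP.
      exact: measurableT_comp.
    - apply: emeasurable_funM => //; exact: measurableT_comp.
    - by move=> x _; rewrite lee_wpmul2r// lee_fin -[leLHS]ger0_norm.
  rewrite ge0_integralZl//; last 2 first.
  - exact: measurableT_comp.
  - by rewrite lee_fin ltW.
  by rewrite lte_mul_pinfty// ?lee_fin ?(ltW M_gt0)//; have /integrableP[] := ih.
transitivity (\int[adjoint_measure]_x (EFin \o h) x).
  by rewrite gE//; apply: eq_integral => x _; rewrite EFinM.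
rewrite integral_adjoint_measure//; apply: ae_eq_integral => //.
- apply: emeasurable_funM; first exact/measurable_EFinP.
  exact: measurable_kernel_integral.
- apply: emeasurable_funM; first exact/measurable_EFinP.
  exact: Tmeas.
(* [T h x] is known to be the kernel integral where [h] is integrable for [Q x]; by invariance [F]
   has the same finite integral as [|h|], so this is the case for [mu]-almost every [x]. *)
pose F x := \int[Q x]_y `|(EFin \o h) y|.
have mah : measurable_fun [set: E] (fun y => `|(EFin \o h) y|).
  exact: measurableT_comp.
have iF : mu.-integrable [set: E] F.
  apply/integrableP; split; first exact: measurable_kernel_integral.
  under eq_integral do rewrite gee0_abs ?integral_ge0//.
  by rewrite ge0_invariant_integral//; have /integrableP[] := ih.
apply: filterS (integrable_ae measurableT iF) => x /(_ I) Fx _.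
congr (_ * _); rewrite Tint//; apply/integrableP; split => //.
by rewrite -ge0_fin_numE// integral_ge0.
Qed.

End density.

(** The truncations [min (f, n)] are bounded, and by invariance so are their adjoints, almost
    everywhere. The adjoint preserves order and mass: hence [g_n <= g] almost everywhere, and the
    [L^1] distance from [g_n] to [g] equals that from [f_n] to [f], which tends to [0]. *)
Lemma adjoint_L1_exists (f : E -> R) (f0 : forall x, (0 <= f x)%R)
    (intf : mu.-integrable [set: E] (EFin \o f)) :
  exists g, adjoint_L1 mu T f g.
Proof.
have mf : measurable_fun [set: E] f by apply/measurable_EFinP; exact: measurable_int intf.
pose f_ n x := Num.min (f x) n%:R.
have f_0 n x : (0 <= f_ n x)%R by rewrite le_min f0 ler0n.
have f_n n x : (f_ n x <= n%:R)%R by rewrite ge_min lexx orbT.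
have f_f n x : (f_ n x <= f x)%R by rewrite ge_min lexx.
have mf_ n : measurable_fun [set: E] (f_ n) by exact: measurable_minr.
have bf_ n : bounded_measurable (f_ n).
  by apply: (@bounded_measurable_itv _ _ _ _ 0%R n%:R) => // x; rewrite f_0 f_n.
have intf_ n : mu.-integrable [set: E] (EFin \o f_ n).
  exact: bounded_measurable_integrable.
have [g [mg g0 intg gE]] := adjoint_density f0 intf.
have /choice[u uP] n := adjoint_density (f_0 n) (intf_ n).
(* The density [u n] is at most [n] almost everywhere; the cut selects a version that is bounded at
   every point. *)
pose g_ n x := Num.min (u n x) n%:R.
have mg_ n : measurable_fun [set: E] (g_ n).
  by apply: measurable_minr => //; have [] := uP n.
have g_0 n x : (0 <= g_ n x)%R.
  by rewrite le_min ler0n andbT; have [_ + _ _] := uP n; exact.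
have bg_ n : bounded_measurable (g_ n).
  apply: (@bounded_measurable_itv _ _ _ _ 0%R n%:R) => // x.
  by rewrite g_0 ge_min lexx orbT.
have intg_ n : mu.-integrable [set: E] (EFin \o g_ n).
  exact: bounded_measurable_integrable.
have intn n : mu.-integrable [set: E] (EFin \o (fun=> n%:R : R)).
  apply: bounded_measurable_integrable.
  by apply: (@bounded_measurable_itv _ _ _ _ n%:R n%:R) => // x; rewrite lexx.
have le_adj (p q : E -> R) : measurable_fun [set: E] p -> measurable_fun [set: E] q ->
    (forall x, 0 <= p x)%R -> (forall x, p x <= q x)%R -> forall A, measurable A ->
    \int[mu]_x ((p x)%:E * Q x A) <= \int[mu]_x ((q x)%:E * Q x A).
  move=> mp mq p0 pq A mA; apply: ge0_le_integral => //.
  - by move=> x _; rewrite mule_ge0// lee_fin.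
  - by apply: emeasurable_funM; [exact/measurable_EFinP|exact: measurable_kernel].
  - by apply: emeasurable_funM; [exact/measurable_EFinP|exact: measurable_kernel].
  - by move=> x _; rewrite lee_wpmul2r// lee_fin.
have u_n n : {ae mu, forall x, (u n x <= n%:R)%R}.
  have [mu_ u0 iu uE] := uP n.
  apply: (density_le iu (intn n) (density_setE uE) (fun A _ => erefl)) => A mA.
  rewrite [leLHS](adjoint_measureE (f_0 n) (intf_ n) mA).
  apply: (le_trans (le_adj _ _ (mf_ n) _ (f_0 n) (f_n n) A mA)) => //.
  rewrite ge0_integralZl//; last exact: measurable_kernel.
  by rewrite Qinv// -integral_cst.
have gu n : {ae mu, forall x, u n x = g_ n x}.
  by apply: filterS (u_n n) => x ux; rewrite /g_ min_l.
have g_E n h : measurable_fun [set: E] h ->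
    \int[adjoint_measure (f_0 n) (intf_ n)]_x h x = \int[mu]_x ((g_ n x)%:E * h x).
  move=> mh; have [mu_ u0 iu uE] := uP n; rewrite uE//; apply: ae_eq_integral => //.
  - by apply: emeasurable_funM => //; exact/measurable_EFinP.
  - by apply: emeasurable_funM => //; exact/measurable_EFinP.
  - by apply: filterS (gu n) => x -> _.
have g_g n : {ae mu, forall x, (g_ n x <= g x)%R}.
  apply: (density_le (intg_ n) intg (density_setE (g_E n)) (density_setE gE)) => A mA.
  rewrite [leLHS](adjoint_measureE (f_0 n) (intf_ n) mA).
  by rewrite [leRHS](adjoint_measureE f0 intf mA); exact: le_adj.
have total (p v : E -> R) (p0 : forall x, (0 <= p x)%R)
    (intp : mu.-integrable [set: E] (EFin \o p)) :
    (forall h, measurable_fun [set: E] h ->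
      \int[adjoint_measure p0 intp]_x h x = \int[mu]_x ((v x)%:E * h x)) ->
    \int[mu]_x (v x)%:E = \int[mu]_x (p x)%:E.
  move=> vE; rewrite -(density_setE vE measurableT).
  rewrite [LHS](adjoint_measureE p0 intp measurableT).
  by apply: eq_integral => x _; rewrite prob_kernel mule1.
have f_cvg : \int[mu]_x `|f_ n x - f x|%:E @[n --> \oo] --> 0.
  have [] := @dominated_convergence _ _ _ mu setT measurableT
    (fun n => EFin \o f_ n) (EFin \o f) (EFin \o f).
  - by move=> n; exact/measurable_EFinP.
  - exact/measurable_EFinP.
  - apply: aeW => x _; apply: cvg_near_cst.
    have [N _ hN] : \forall n \near \oo, (f x <= n%:R)%R by exact: nbhs_infty_ger.
    by exists N => // n /hN /= fn; rewrite /f_ min_l.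
  - exact: intf.
  - by apply: aeW => x n _; rewrite /= lee_fin ger0_norm.
  by [].
exists g; split; [exact/Lfun1_integrable|exact/Lfun1_integrable|].
exists f_, g_; split => //.
  by move=> n; exact: (adjoint_L2_bounded (bf_ n) (bg_ n) (g_0 n) (g_E n)).
rewrite (_ : (fun n => _) = (fun n => \int[mu]_x `|f_ n x - f x|%:E))//.
apply/funext => n.
transitivity (\int[mu]_x ((g x)%:E - (g_ n x)%:E)).
  apply: ae_eq_integral => //.
  - by apply/measurable_EFinP; apply: measurableT_comp => //; exact: measurable_funB.
  - by apply: emeasurable_funB; exact/measurable_EFinP.
  - apply: filterS (g_g n) => x gx _; rewrite ler0_norm ?subr_le0//.
    by rewrite opprB.
transitivity (\int[mu]_x ((f x)%:E - (f_ n x)%:E)).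
  rewrite [LHS]integralB; [|by []|exact: intg|exact: intg_].
  rewrite [RHS]integralB; [|by []|exact: intf|exact: intf_].
  by rewrite (total f g f0 intf gE) (total (f_ n) (g_ n) (f_0 n) (intf_ n) (g_E n)).
by apply: eq_integral => x _; rewrite ler0_norm ?subr_le0// opprB.
Qed.

(** Both sides are continuous for [L^1] convergence because [h] and [Q h] are bounded. The entropy
    estimate rests on this duality, which holds for every admissible [g]. *)
Lemma adjoint_L1_integral (f g : E -> R) : adjoint_L1 mu T f g ->
  forall h, bounded_measurable h ->
  \int[mu]_x (g x * h x)%:E = \int[mu]_x (f x * \int[kernel_at Q x]_y h y)%:E.
Proof.
move=> [/Lfun1_integrable intf /Lfun1_integrable intg [f_ [g_ [fg f_f g_g]]]] h bh.
have L2int (p : E -> R) : p \in Lfun mu 2%:E -> mu.-integrable [set: E] (EFin \o p).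
  by move=> p2; apply/Lfun1_integrable; apply: Lfun_subset12 p2; exact: fin_num_measure.
have intf_ n : mu.-integrable [set: E] (EFin \o f_ n) by apply: L2int; have [] := fg n.
have intg_ n : mu.-integrable [set: E] (EFin \o g_ n) by apply: L2int; have [] := fg n.
have cf := cvg_integral_bounded intf_ intf (bounded_kernel_integral Q bh) f_f.
have cg := cvg_integral_bounded intg_ intg bh g_g.
suff E_ : (fun n => \int[mu]_x (g_ n x * h x)%:E) =
    (fun n => \int[mu]_x (f_ n x * \int[kernel_at Q x]_y h y)%:E).
  by rewrite E_ in cg; exact: cvg_unique cg cf.
apply/funext => n; have [_ _ ->] := fg n; last exact: bounded_Lfun2.
apply: eq_integral => x _; rewrite Tint; last exact: bounded_measurable_integrable.
by rewrite bounded_RintegralE// EFinM.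
Qed.

End adjoint.

(** * The entropy-cost inequality *)

Section entropy_cost.
Context (R : realType) (d : measure_display) (E : polishType R d).
Variables (Q : R.-pker E ~> E) (mu : probability E R) (H : E * E -> R) (c : R)
  (T : (E -> \bar R) -> E -> \bar R).
Hypothesis H0 : forall xy, (0 <= H xy)%R.
Hypothesis mH : measurable_fun [set: E * E] H.
Hypothesis c0 : (0 < c)%R.
Hypothesis LH : forall x y f, bounded_measurable f -> (forall z, 1 <= f z)%R ->
  (\int[kernel_at Q x]_z ln (f z) <=
   ln (\int[kernel_at Q y]_z f z) + H (x, y) * c)%R.
Hypothesis Qinv : forall A, measurable A -> \int[mu]_x Q x A = mu A.
Hypothesis Tint : forall x h, (kernel_at Q x).-integrable [set: E] h ->
  T h x = \int[kernel_at Q x]_y h y.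

Lemma bounded_measurable_comp (phi : E * E -> E) (k : E -> R)
    (pi : probability (E * E)%type R) : measurable_fun [set: E * E] phi ->
  bounded_measurable k -> pi.-integrable [set: E * E] (EFin \o (k \o phi)).
Proof.
move=> mphi [mk [M [Mr kM]]]; apply: measurable_bounded_integrable => //.
- by rewrite -ge0_fin_numE// fin_num_measure.
- exact: measurableT_comp.
- by exists M; split => // r Mr' z _; exact: kM.
Qed.

Lemma integral_marginal (phi : E * E -> E) (m : {measure set E -> \bar R})
    (pi : probability (E * E)%type R) (k : E -> R) :
  measurable_fun [set: E * E] phi ->
  (forall A, measurable A -> pi (phi @^-1` A) = m A) -> bounded_measurable k ->
  \int[pi]_z (k (phi z))%:E = \int[m]_x (k x)%:E.
Proof.
move=> mphi piE bk; have [mk _] := bk.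
have ik := bounded_measurable_comp pi mphi bk.
rewrite -[LHS](@integral_pushforward _ _ _ _ _ phi mphi pi setT (EFin \o k))//.
  by apply: eq_measure_integral => A mA _; exact: piE.
exact/measurable_EFinP.
Qed.

(** Under [pi] the point [x] has law [f mu], so the left side of the log-Harnack inequality has mean
    the integral of [g ln phi]. On the right the tangent to [ln] is taken at [B = 1 + delta]: as [y]
    has law [mu], invariance makes the mean of [Q phi] the integral of [phi], at most [B], and the
    tangent terms add up to at most [ln B]. *)
Lemma adjoint_entropy_coupling (f g : E -> R) (pi : probability (E * E)%type R) :
  (forall x, 0 <= f x)%R -> \int[mu]_x (f x)%:E = 1 -> adjoint_L1 mu T f g ->
  coupling (with_density f mu) mu pi -> \int[pi]_z (H z)%:E < +oo ->
  \int[mu]_x (g x * ln (g x))%:E <= \int[pi]_z (H z)%:E * c%:E.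
Proof.
move=> f0 f1 adj cpl Hoo; have [/Lfun1_integrable intf /Lfun1_integrable intg _] := adj.
have mf : measurable_fun [set: E] f by apply/measurable_EFinP; exact: measurable_int intf.
have mg : measurable_fun [set: E] g by apply/measurable_EFinP; exact: measurable_int intg.
have gE := adjoint_L1_integral Tint adj.
have bq := bounded_kernel_integral Q.
pose g' x := Num.max (g x) 0%R.
have g'0 x : (0 <= g' x)%R by rewrite le_max lexx orbT.
have mg' : measurable_fun [set: E] g' by exact: measurable_maxr.
have ae_g : {ae mu, forall x, g x = g' x}.
  have : {ae mu, forall x, (0 <= g x)%R}.
    apply: ae_ge0_of_integral_ge0 => // A mA.
    rewrite integral_mkcond_indic; under eq_integral do rewrite mulrC.
    rewrite (gE \1_A); last exact: bounded_measurable_indic.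
    apply: integral_ge0 => x _; by rewrite lee_fin mulr_ge0// Rintegral_ge0.
  by apply: filterS => x gx; rewrite /g' max_l.
have fst_marginal k : bounded_measurable k ->
    \int[pi]_z (k z.1)%:E = \int[mu]_x (f x * k x)%:E.
  move=> bk; rewrite (integral_marginal (m := density_measure f0 intf))//.
    rewrite (integral_density (m' := mu) (g := f))//.
    - by move=> l ml l0; rewrite ge0_integral_density.
    - by apply/measurable_EFinP; exact: bk.1.
  move=> A mA; have [E1 _] := cpl A mA; apply: (etrans _ E1); congr (pi _).
  by apply/seteqP; split => z //= [].
have snd_marginal k : bounded_measurable k ->
    \int[pi]_z (k z.2)%:E = \int[mu]_x (k x)%:E.
  move=> bk; rewrite (integral_marginal (m := mu))// => A mA.
  have [_ E2] := cpl A mA; apply: (etrans _ E2); congr (pi _).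
  by apply/seteqP; split => z //= [].
have g'E k : bounded_measurable k ->
    \int[mu]_x (g' x * k x)%:E = \int[pi]_z (\int[kernel_at Q z.1]_y k y)%R%:E.
  move=> bk; have [mk _] := bk.
  rewrite (fst_marginal (fun x => \int[kernel_at Q x]_y k y)%R); last exact: bq.
  rewrite -gE//; apply: ae_eq_integral => //.
  - by apply/measurable_EFinP; exact: measurable_funM.
  - by apply/measurable_EFinP; exact: measurable_funM.
  - by apply: filterS ae_g => x -> _.
have bcst (r : R) : bounded_measurable (fun _ : E => r).
  by apply: (@bounded_measurable_itv _ _ _ _ r r) => // z; rewrite lexx.
have icst (r : R) : pi.-integrable [set: E * E] (EFin \o (fun=> r)).
  have mfst : measurable_fun [set: E * E] (@fst E E) by [].
  exact: (bounded_measurable_comp pi mfst (bcst r)).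
have cstE (r : R) : \int[pi]_z r%:E = r%:E.
  rewrite (_ : (fun=> _) = cst r%:E)// integral_cst//.
  by rewrite [X in _ * X](_ : _ = 1) ?mule1//; exact: probability_setT.
have g'1 : \int[mu]_x (g' x)%:E = 1.
  transitivity (\int[mu]_x (g' x * 1)%:E).
    by apply: eq_integral => x _; rewrite mulr1.
  rewrite (g'E (fun=> 1%R))//; under eq_integral do rewrite Rintegral_probability_cst.
  exact: cstE.
have Hfin : \int[pi]_z (H z)%:E \is a fin_num.
  by rewrite ge0_fin_numE// integral_ge0// => z _; rewrite lee_fin.
have intH : pi.-integrable [set: E * E] (EFin \o H).
  apply/integrableP; split; first exact/measurable_EFinP.
  by under eq_integral do rewrite gee0_abs ?lee_fin//.
rewrite (_ : \int[mu]_x _ = \int[mu]_x (g' x * ln (g' x))%:E); last first.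
  apply: ae_eq_integral => //.
  - by apply/measurable_EFinP; apply: measurable_funM => //; exact: measurableT_comp.
  - by apply/measurable_EFinP; apply: measurable_funM => //; exact: measurableT_comp.
  - by apply: filterS ae_g => x -> _.
rewrite -(fineK Hfin) -EFinM; apply: entropy_le => // n delta d0.
set C := (fine _ * c)%R; pose B := (1 + delta)%R.
have B0 : (0 < B)%R by rewrite ltr_wpDr// ltW.
pose phi x := (Num.min (g' x) n%:R + delta)%R.
have mphi : measurable_fun [set: E] phi.
  by apply: measurable_funD => //; exact: measurable_minr.
have phi_itv z : (delta <= phi z <= n%:R + delta)%R.
  by rewrite lerDr lerD2r le_min g'0 ler0n ge_min lexx orbT.
have bphi := bounded_measurable_itv mphi phi_itv.
have bln : bounded_measurable (fun z => ln (phi z))%R.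
  apply: (@bounded_measurable_itv _ _ _ _ (ln delta) (ln (n%:R + delta))).
    exact: measurableT_comp.
  move=> z; have /andP[h1 h2] := phi_itv z.
  by rewrite !ler_ln ?posrE ?h1 ?h2// (lt_le_trans d0)// (le_trans h1).
rewrite g'E//.
pose b y := (\int[kernel_at Q y]_z phi z)%R.
have bb : bounded_measurable b by exact: bq.
have ib : pi.-integrable [set: E * E] (fun z => (b z.2)%:E).
  have msnd : measurable_fun [set: E * E] (@snd E E) by [].
  exact: (bounded_measurable_comp pi msnd bb).
have pointwise z : (\int[kernel_at Q z.1]_y ln (phi y) <=
    (ln B - 1) + (B^-1 * b z.2 + c * H z))%R.
  apply: (le_trans (log_Harnack_pos LH z.1 z.2 mphi d0 phi_itv)).
  rewrite -surjective_pairing [(H z * c)%R]mulrC addrA lerD2r -/(b z.2).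
  have /andP[J _] := Rintegral_itv (kernel_at Q z.2) mphi phi_itv.
  have b0 : (0 < b z.2)%R by exact: lt_le_trans J.
  have := @le_ln1Dx R (B^-1 * b z.2 - 1)%R.
  rewrite addrCA subrr addr0 lnM ?posrE ?invr_gt0// lnV ?posrE//.
  rewrite ltrBrDl subrr mulr_gt0 ?invr_gt0// => /(_ isT).
  rewrite [(- ln B + _)%R]addrC lerBlDr => /le_trans; apply.
  by rewrite le_eqVlt; apply/orP; left; apply/eqP; ring.
apply: (@le_trans _ _ (\int[pi]_z ((ln B - 1)%:E +
    (B^-1%:E * (b z.2)%:E + c%:E * (H z)%:E)))).
  apply: le_integral_integrable.
  - apply/measurable_EFinP; apply: (measurableT_comp (bq _ bln).1).
    exact: measurable_fst.
  - apply: integrableD => //; first exact: icst.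
    by apply: integrableD => //; exact: integrableZl.
  - by move=> z; rewrite -!EFinM -!EFinD lee_fin.
rewrite integralD//; [|exact: icst|by apply: integrableD => //; exact: integrableZl].
rewrite integralD//; [|exact: integrableZl..].
rewrite !integralZl// cstE (snd_marginal b)//.
have -> : \int[mu]_x (b x)%:E = \int[mu]_x (phi x)%:E.
  rewrite -[RHS](ge0_invariant_integral Qinv); last 2 first.
  - exact/measurable_EFinP.
  - by move=> x; have /andP[J _] := phi_itv x; rewrite lee_fin (le_trans _ J)// ltW.
  by apply: eq_integral => x _; rewrite -bounded_RintegralE.
have phiB : \int[mu]_x (phi x)%:E <= B%:E.
  apply: (@le_trans _ _ (\int[mu]_x ((g' x)%:E + delta%:E))).
    apply: ge0_le_integral => //.
    - by move=> x _; have /andP[J _] := phi_itv x; rewrite lee_fin (le_trans _ J)// ltW.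
    - exact/measurable_EFinP.
    - by apply: emeasurable_funD => //; exact/measurable_EFinP.
    - by move=> x _; rewrite -EFinD lee_fin lerD2r ge_min lexx.
  rewrite ge0_integralD//; last 3 first.
  - by move=> x _; rewrite lee_fin.
  - exact/measurable_EFinP.
  - by move=> x _; rewrite lee_fin ltW.
  rewrite g'1 (_ : (fun=> _) = cst delta%:E)// integral_cst//.
  by rewrite [X in _ * X](_ : _ = 1) ?mule1//; exact: probability_setT.
apply: (@le_trans _ _ ((ln B - 1)%:E + (B^-1%:E * B%:E + c%:E * \int[pi]_z (H z)%:E))).
  rewrite leeD2l// leeD2r// lee_wpmul2l// lee_fin invr_ge0; exact: ltW.
rewrite -(fineK Hfin) -!EFinM -!EFinD lee_fin mulVf ?gt_eqF//.
by rewrite /C mulrC addrA subrK.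
Qed.

(** As [c > 0], dividing by it leaves a lower bound to be proved for the cost of each coupling; it
    is trivial for an infinite cost. *)
Lemma adjoint_entropy_cost (f g : E -> R) :
  (forall x, 0 <= f x)%R -> \int[mu]_x (f x)%:E = 1 -> adjoint_L1 mu T f g ->
  \int[mu]_x (g x * ln (g x))%:E <= Wasserstein H (with_density f mu) mu * c%:E.
Proof.
move=> f0 f1 adj; rewrite -lee_pdivrMr//; apply/ereal_infP => _ [pi cpl <-].
rewrite lee_pdivrMr//; have [Hoo|] := ltP (\int[pi]_z (H z)%:E) +oo.
  exact: adjoint_entropy_coupling cpl Hoo.
by rewrite leye_eq => /eqP ->; rewrite gt0_mulye ?lte_fin// leey.
Qed.

End entropy_cost.

(** * Entropy-cost inequality, strong Feller property and entropy of densities for the subordinated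
    semigroup *)

Theorem corollary1p5 (R : realType) (d : measure_display) (E : polishType R d)
    (P : R -> R.-pker E ~> E) (H : E * E -> R) (eps kappa : R)
    (mu : probability E R)
    (P_semigroup : markov_semigroup P)
    (P_time : measurable_in_time P)
    (H_ge0 : forall xy, (0 <= H xy)%R)
    (H_meas : measurable_fun [set: E * E] H)
    (eps_ge0 : (0 <= eps)%R) (kappa_ge1 : (1 <= kappa)%R)
    (P_Harnack : log_Harnack P H eps kappa)
    (mu_inv : invariant_measure P mu)
    (alpha : R) (alpha_gt0 : (0 < alpha)%R) (alpha_le1 : (alpha <= 1)%R)
    (nu : R -> probability (measurableTypeR R) R)
    (nu_stable : stable_subordinator alpha nu) :
  (forall t : R, (0 < t)%R ->
   forall f : E -> R, measurable_fun [set: E] f -> (forall x, (0 <= f x)%R) ->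
     \int[mu]_x (f x)%:E = 1 ->
     (exists g, adjoint_L1 mu (subordinated P nu t) f g) /\
     (forall g, adjoint_L1 mu (subordinated P nu t) f g ->
        \int[mu]_x (g x * ln (g x))%:E <=
        Wasserstein H (with_density f mu) mu * (rate eps kappa alpha t)%:E))
  /\
  ((forall x : E, H (x, y) @[y --> x^'] --> (0 : R)%R) ->
   forall t : R, (0 < t)%R ->
     [/\ strong_Feller (subordinated P nu t),
         exists p, transition_density mu (subordinated P nu t) p &
         forall p, transition_density mu (subordinated P nu t) p ->
         forall x y, supp mu x -> supp mu y ->
           \int[mu]_z ((p x z)%:E * lne ((p x z)%:E / (p y z)%:E)) <=
           (H (x, y) * rate eps kappa alpha t)%:E]).
Proof.
have [[nu_lt0 _ _ _] laplace] := nu_stable.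
have P_null := log_Harnack_null_dominates P_Harnack mu_inv.
have [K KP] := semigroup_joint_kernel P_semigroup P_time P_null.
(* Since [alpha <= 1 <= kappa], both Gamma values have an argument at least [1], the range covered
   by [GammaE] and [Gamma_gt0]. *)
have kappa_alpha : (1 <= kappa / alpha)%R.
  by rewrite ler_pdivlMr// mul1r (le_trans alpha_le1).
(* Strict positivity, valid even for [eps = 0], is what permits division by the rate in the
   entropy-cost inequality. *)
have rate_gt0 t : (0 < t)%R -> (0 < rate eps kappa alpha t)%R.
  move=> t0; rewrite /rate ltr_wpDl// divr_gt0//; first exact: Gamma_gt0.
  by rewrite mulr_gt0 ?Gamma_gt0// mulr_gt0// powR_gt0.
have lt0 t (t0 : (0 < t)%R) := nu_lt0 t (ltW t0).
have lap t (t0 : (0 < t)%R) x (x0 : (0 <= x)%R) := laplace t x (ltW t0) x0.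
have nu_npos t (t0 : (0 < t)%R) :=
  stable_npos_itv t0 alpha_gt0 (lt0 t t0) (lap t t0).
have moment t (t0 : (0 < t)%R) :=
  stable_negative_moment t0 alpha_gt0 alpha_le1 (lap t t0) kappa_ge1.
have Qinv t (t0 : (0 < t)%R) := mixture_invariant KP (lt0 t t0) mu_inv.
have Qnull t (t0 : (0 < t)%R) x : kernel_at (mixture K (nu t)) x `<< mu.
  exact: (mixture_null_dominates KP (nu_npos t t0) P_null).
have QH t (t0 : (0 < t)%R) := mixture_log_Harnack KP (lt0 t t0) P_time P_Harnack
  H_ge0 eps_ge0 (nu_npos t t0) (moment t t0).
have Tint t (t0 : (0 < t)%R) := integrable_subordinatedE KP (lt0 t t0).
have Tmeas t (t0 : (0 < t)%R) := measurable_subordinated KP (lt0 t t0).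
have TE t (t0 : (0 < t)%R) f : bounded_measurable f -> forall x,
    subordinated P nu t (EFin \o f) x = \int[kernel_at (mixture K (nu t)) x]_z (f z)%:E.
  move=> bf x; apply: (Tint t t0).
  exact: (bounded_measurable_integrable (kernel_at (mixture K (nu t)) x) bf).
split.
  move=> t t0 f mf f0 f1.
  have intf : mu.-integrable [set: E] (EFin \o f).
    apply/integrableP; split; first exact/measurable_EFinP.
    under eq_integral do rewrite gee0_abs ?lee_fin//.
    by rewrite f1 ltry.
  split.
    exact: (adjoint_L1_exists (Qinv t t0) (Tint t t0) (Tmeas t t0) f0 intf).
  move=> g; exact: (adjoint_entropy_cost H_ge0 H_meas (rate_gt0 t t0) (QH t t0)
    (Qinv t t0) (Tint t t0) f0 f1).
move=> H_cvg t t0; split.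
- exact: (kernel_strong_Feller H_ge0 (ltW (rate_gt0 t t0)) (QH t t0) (TE t t0) H_cvg).
- exact: (kernel_transition_density (Qnull t t0) (TE t t0)).
- move=> p pP x y; exact: (kernel_entropy_inequality H_ge0 (ltW (rate_gt0 t t0))
    (QH t t0) (TE t t0) pP).
Qed.
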